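(* Let $\Gamma=\mathrm{SL}_2(\mathbb{Z})$ and for $\gamma=\begin{pmatrix}a&b\\c&d\end{pmatrix}\in\Gamma$ put $\nu_{\mathbb H}(\gamma)=a^2+b^2+c^2+d^2$. Let $\pi_E(x)=\#\{\gamma\in\Gamma:\ \nu_{\mathbb H}(\gamma)=p\le x,\ p \text{ prime}\}$. Assume that $\pi_E(x)\asymp \frac{x}{\log x}$, i.e. there are constants $0<c_1\le c_2$ with $c_1\frac{x}{\log x}\le \pi_E(x)\le c_2\frac{x}{\log x}$ for all sufficiently large $x$. Then the sequence $E=\big((\theta_1(\gamma)/\pi,\ \theta_2(\gamma)/\pi)\big)\subseteq(\mathbb R/\mathbb Z)^2$, indexed by $\gamma\in\Gamma$ with size function $\nu_{\mathbb H}$, is equidistributed on $(\mathbb R/\mathbb Z)^2$ over primes: for every continuous $f$ on $(\mathbb R/\mathbb Z)^2$, $$\frac{1}{\pi_E(x)}\sum_{\substack{\gamma\in\Gamma\\ \nu_{\mathbb H}(\gamma)=p\le x,\ p\text{ prime}}} f\big(\theta_1(\gamma)/\pi,\theta_2(\gamma)/\pi\big)\longrightarrow \int_{(\mathbb R/\mathbb Z)^2} f\,d\mu\quad (x\to\infty),$$ with $\mu$ the Lebesgue measure.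
   Context: For $\theta\in\mathbb R$ and $r\ge0$ let $k(\theta)=\begin{pmatrix}\cos\theta&\sin\theta\\-\sin\theta&\cos\theta\end{pmatrix}$ and $a(e^{-r})=\begin{pmatrix}e^{-r/2}&0\\0&e^{r/2}\end{pmatrix}$. Every $\gamma\in\mathrm{SL}_2(\mathbb R)$ can be written (Cartan decomposition) as $\gamma=k(\theta_1(\gamma))\,a(e^{-r})\,k(\theta_2(\gamma))$, where $r=d_{\mathbb H}(\gamma i,i)$ is the hyperbolic distance in the upper half-plane; when $r>0$ the angles $\theta_1(\gamma),\theta_2(\gamma)$ are determined modulo $\pi$, so $\theta_j(\gamma)/\pi\in\mathbb R/\mathbb Z$ is well defined. (Only finitely many $\gamma\in\Gamma$ have $\gamma i=i$; they do not affect the limit.) *)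

(* Defs.v *)
From HB Require Import structures.
From mathcomp Require Import all_boot all_order all_algebra.
From mathcomp Require Import all_classical all_reals all_analysis.
Set Implicit Arguments. Unset Strict Implicit. Unset Printing Implicit Defensive.
Import Order.TTheory GRing.Theory Num.Theory.
Import numFieldNormedType.Exports.
Local Open Scope ring_scope.

(* An integer 2x2 matrix (a b; c d) is encoded as the quadruple (a, b, c, d). *)
Definition quad := (int * int * int * int)%type.

Definition qa (g : quad) : int := g.1.1.1.
Definition qb (g : quad) : int := g.1.1.2.
Definition qc (g : quad) : int := g.1.2.
Definition qd (g : quad) : int := g.2.

Definition inSL2Z (g : quad) : bool := qa g * qd g - qb g * qc g == 1.

Definition nuH (g : quad) : nat :=
  (`|qa g| ^ 2 + `|qb g| ^ 2 + `|qc g| ^ 2 + `|qd g| ^ 2)%N.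

Definition toRmx (R : realType) (g : quad) : 'M[R]_2 :=
  \matrix_(i < 2, j < 2)
     (if i == 0 :> nat then (if j == 0 :> nat then (qa g)%:~R else (qb g)%:~R)
      else (if j == 0 :> nat then (qc g)%:~R else (qd g)%:~R)).

Definition kmat (R : realType) (t : R) : 'M[R]_2 :=
  \matrix_(i < 2, j < 2)
     (if i == 0 :> nat then (if j == 0 :> nat then cos t else sin t)
      else (if j == 0 :> nat then - sin t else cos t)).

Definition amat (R : realType) (r : R) : 'M[R]_2 :=
  \matrix_(i < 2, j < 2)
     (if i == j then (if i == 0 :> nat then expR (- (r / 2)) else expR (r / 2))
      else 0).

(* Cartan decomposition gamma = k(t1) a(e^{-r}) k(t2) with r >= 0
   (r is then necessarily d_H(gamma i, i)). *)
Definition cartan (R : realType) (M : 'M[R]_2) (t1 t2 : R) : Prop :=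
  exists r : R, 0 <= r /\ M = kmat t1 *m amat r *m kmat t2.

Definition zbox (M : nat) : seq int := [seq (i%:Z - M%:Z) | i <- iota 0 (M.*2.+1)].

Definition quadbox (M : nat) : seq quad :=
  flatten [seq flatten [seq [seq (a, b, c, d) | c <- zbox M, d <- zbox M]
                          | b <- zbox M] | a <- zbox M].

(* gamma in SL_2(Z) with nu_H(gamma) = p <= x, p prime.
   Every such gamma has all entries of absolute value <= x, so lies in the box. *)
Definition primeSL (R : realType) (x : R) : seq quad :=
  [seq g <- quadbox (Num.truncn x) |
     inSL2Z g && prime (nuH g) && ((nuH g)%:R <= x)].

Definition piEcount (R : realType) (x : R) : R := (size (primeSL x))%:R.

Definition leb2 (R : realType) := ((@lebesgue_measure R) \x (@lebesgue_measure R))%E.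

(* Main.v *)
(* For [gamma] with entries a, b, c, d and nu(gamma) = p put z = (a + d) + i (b - c) and
   w = (a - d) + i (b + c).  Then |z|^2 = p + 2 and |w|^2 = p - 2, and the Cartan decomposition
   says that arg z = theta1 + theta2 and arg w = theta2 - theta1 modulo pi.  Hence the Weyl sum of
   frequency (m1, m2) over nu(gamma) = p is 0 or at most 8 |c_k(p + 2)| |c_l(p - 2)|, where
   2k = |m1 + m2|, 2l = |m2 - m1| and c_k(n), written [cc R k n], is half the sum of cos (2 k arg z) over the Gaussian
   integers z of norm n with odd real part and even imaginary part.

   The function c_k is multiplicative, |c_k| <= c_0 and |c_k| <= 3/4 c_0 + 1/4 c_(2k).  The
   Dirichlet series of c_(2k) is bounded near 1 for k > 0, while that of c_0 has a simple pole, so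
   the sum of |c_k(p)| / p over p <= y is at most s ln ln y + O(1), with s = 1 for k = 0 and s = 3/4
   for k > 0.  Splitting p + 2 and p - 2 into smooth and rough parts and applying Brun's sieve to
   p, p + 2, p - 2 with prescribed smooth parts (the few large smooth parts are disposed of by
   Rankin's trick and fourth moments) gives, for (k, l) <> (0, 0), a bound
   N (ln N)^(-3 + 7/4 + 1/5) = o(N / ln N) for the sum over p <= N.  This is where the lower bound on
   pi_E is used.

   Equidistribution follows from the decay of Weyl sums by convolution with Fejer kernels on the
   grid (i/q, j/q), which reduces the mean of f to a Riemann sum. *)

Require Import Defs.
From HB Require Import structures.
From mathcomp Require Import all_boot all_order all_algebra.
From mathcomp Require Import all_classical all_reals all_analysis.
From mathcomp Require Import ring lra zify.
Set Implicit Arguments. Unset Strict Implicit. Unset Printing Implicit Defensive.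
Import Order.TTheory GRing.Theory Num.Theory.
Import numFieldNormedType.Exports.
Local Open Scope classical_set_scope.
Local Open Scope ring_scope.

(** * Gaussian integers of given norm *)

Section GaussianIntegers.

(** The proof bounds Weyl sums from above and never evaluates them. With absolute values and a
    sieve, the pair (k, l) = (0, 0) would give N (ln N)^(-3 + 1 + 1) = N / ln N, exactly the assumed
    order of pi_E. Saving a fixed power of ln N in one of the two factors therefore suffices,
    provided the losses stay below it. The saving is 1/4, the gap between the slopes 1 and 3/4. The
    allowance of 1/5 pays for sieving only up to z = N^(1 / (100 ln ln N)), which costs 1/20, and
    for the rough parts of p + 2 and p - 2, which cost 1/10. The slope 3/4 rests on |cos t| <= 3/4 +
    1/4 cos 2t: the absolute value is traded for a signed sum of c_(2k)(p) / p that has to be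
    bounded from above only, and this follows from a bound for the Dirichlet series on real s > 1.
    That bound comes from the residue classes modulo 1 + 2i: the sum of sin (2k arg z) N(z)^(-s)
    vanishes by conjugation, while multiplication by 1 + 2i turns a fixed part of it into the cosine
    sum. *)

Definition gauss := (int * int)%type.
Implicit Types (z w x y : gauss) (a b n : nat).

Definition gmul z w : gauss := (z.1 * w.1 - z.2 * w.2, z.1 * w.2 + z.2 * w.1).
Definition gconj z : gauss := (z.1, - z.2).
Definition gopp z : gauss := (- z.1, - z.2).
Definition gint (m : int) : gauss := (m, 0).
Definition gadd z w : gauss := (z.1 + w.1, z.2 + w.2).
Definition gnorm z : nat := (`|z.1| ^ 2 + `|z.2| ^ 2)%N.
(* Normalises the Gaussian integers of odd norm up to sign. *)
Definition godd z := odd `|z.1| && ~~ odd `|z.2|.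

Lemma gmulA : associative gmul.
Proof. by move=> [a b] [c d] [e f]; rewrite /gmul /=; congr pair; ring. Qed.
Lemma gmulC : commutative gmul.
Proof. by move=> [a b] [c d]; rewrite /gmul /=; congr pair; ring. Qed.
Lemma gmul1 z : gmul (gint 1) z = z.
Proof. by case: z => a b; rewrite /gmul /gint /=; congr pair; ring. Qed.
Lemma gconjK : involutive gconj.
Proof. by case=> a b; rewrite /gconj /= opprK. Qed.

Lemma gnormE z : (gnorm z)%:Z = z.1 ^+ 2 + z.2 ^+ 2.
Proof. by rewrite /gnorm; lia. Qed.

Lemma gnormM z w : gnorm (gmul z w) = (gnorm z * gnorm w)%N.
Proof.
apply/eqP; rewrite -eqz_nat PoszM !gnormE; apply/eqP.
by rewrite /gmul /=; ring.
Qed.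
Lemma gnorm_conj z : gnorm (gconj z) = gnorm z.
Proof. by rewrite /gnorm /= abszN. Qed.
Lemma gnorm_opp z : gnorm (gopp z) = gnorm z.
Proof. by rewrite /gnorm /= !abszN. Qed.
Lemma gnorm_int m : gnorm (gint m) = (`|m| ^ 2)%N.
Proof. by rewrite /gnorm /= addn0. Qed.
Lemma gmul_conj z : gmul z (gconj z) = gint (gnorm z)%:Z.
Proof. by rewrite gnormE /gmul /gint /=; congr pair; ring. Qed.
Lemma gnorm_eq0 z : (gnorm z == 0%N) = (z == (0, 0)).
Proof. by case: z => a b; rewrite /gnorm xpair_eqE /=; lia. Qed.

Lemma gmulI z x y : gnorm z != 0%N -> gmul z x = gmul z y -> x = y.
Proof.
move=> z0 e; have: gmul (gconj z) (gmul z x) = gmul (gconj z) (gmul z y) by rewrite e.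
rewrite !gmulA [gmul (gconj z) z]gmulC gmul_conj /gmul /gint /=.
case: x y {e} => [a b] [c d] /=; rewrite !mul0r !subr0 => -[].
have n0 : (gnorm z)%:Z != 0 by rewrite eqz_nat.
by move=> /(mulfI n0) -> /(mulfI n0) ->.
Qed.

Lemma gdiv_close (m : int) n : (0 < n)%N -> exists q : int, (2 * `|(m - q * n%:Z)%R| <= n)%N.
Proof.
move=> n0; have n0' : n%:Z != 0 by lia.
have h := divz_eq m n%:Z; have h1 := modz_ge0 m n0'.
have h2 : (m %% n%:Z)%Z < n%:Z by rewrite ltz_pmod //; lia.
case: (leP (2 * (m %% n)%Z) n%:Z) => h3.
  by exists (m %/ n)%Z; lia.
by exists ((m %/ n)%Z + 1); lia.
Qed.

(** Both coordinates of z conj(w) / N(w) are rounded to the nearest integer; the remainder times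
    conj(w) then has coordinates at most N(w) / 2, hence norm at most N(w)^2 / 2. *)
Lemma gdivP z w : gnorm w != 0%N ->
  exists q, (gnorm (gadd z (gopp (gmul q w))) < gnorm w)%N.
Proof.
move=> w0; have n0 : (0 < gnorm w)%N by rewrite lt0n.
have [q1 h1] := gdiv_close (gmul z (gconj w)).1 n0.
have [q2 h2] := gdiv_close (gmul z (gconj w)).2 n0.
exists (q1, q2); set t := gadd _ _.
have e : gmul t (gconj w) = gadd (gmul z (gconj w)) (gopp (gmul (q1, q2) (gint (gnorm w)%:Z))).
  rewrite -gmul_conj /t; case: z w {h1 h2 w0 n0 t} => [a b] [c d].
  by rewrite /gmul /gadd /gopp /gconj /=; congr pair; ring.
have := gnormM t (gconj w); rewrite gnorm_conj e.
rewrite {1}/gnorm /gadd /gopp /= !mulr0 subr0 add0r.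
set A := `|_|%N; set B := `|_|%N => eN.
have hA : (2 * A <= gnorm w)%N by [].
have hB : (2 * B <= gnorm w)%N by [].
suff: (4 * (A ^ 2 + B ^ 2) < 4 * (gnorm w * gnorm w))%N.
  by rewrite eN ltn_pmul2l // ltn_pmul2r.
have : ((2 * A) ^ 2 <= gnorm w ^ 2)%N by rewrite leq_sqr.
have : ((2 * B) ^ 2 <= gnorm w ^ 2)%N by rewrite leq_sqr.
have : (0 < gnorm w ^ 2)%N by rewrite expn_gt0 n0.
rewrite !expnMn mulnn; lia.
Qed.

(* The generator of the ideal (z, a) has norm gcd(N z, a). *)
Lemma gfactor z a b : coprime a b -> gnorm z = (a * b)%N -> (0 < a)%N -> (0 < b)%N ->
  exists x y, [/\ gnorm x = a, gnorm y = b & z = gmul x y].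
Proof.
move=> cab Nz a0 b0.
pose I (t : gauss) := exists u v, t = gadd (gmul u z) (gmul v (gint a%:Z)).
have Isub t q s : I t -> I s -> I (gadd t (gopp (gmul q s))).
  move=> [u [v ->]] [u' [v' ->]].
  exists (gadd u (gopp (gmul q u'))), (gadd v (gopp (gmul q v'))).
  by rewrite /gadd /gopp /gmul /gint /=; congr pair; ring.
have Iz : I z by exists (gint 1), (gint 0); rewrite /gadd /gmul /gint /=; case: (z) => c d /=; congr pair; ring.
have Ia : I (gint a%:Z) by exists (gint 0), (gint 1); rewrite /gadd /gmul /gint /=; congr pair; ring.
(* Descent on the norm: an ideal element of least non-zero norm divides every other one, since the
   remainder of a division lies in the ideal again. *)
have min k : forall t, I t -> gnorm t != 0%N -> (gnorm t <= k)%N ->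
    exists2 g, I g /\ gnorm g != 0%N & forall s, I s -> exists q, s = gmul q g.
  elim: k => [|k IH] t It t0 tk; first by move: tk t0; lia.
  have [[s [Is s0 st]]|no] := pselect (exists s, [/\ I s, gnorm s != 0%N & (gnorm s < gnorm t)%N]).
    by apply: (IH s) => //; lia.
  exists t => // s Is; have [q hq] := gdivP s t0; exists q.
  case: (eqVneq (gnorm (gadd s (gopp (gmul q t)))) 0%N) => [/eqP|h].
    rewrite gnorm_eq0 => /eqP; case: (s) (gmul q t) => [c d] [e f].
    by rewrite /gadd /gopp /= => -[] h1 h2; congr pair; lia.
  by case: no; exists (gadd s (gopp (gmul q t))); split => //; apply: Isub.
have [||g [[u [v eg]] g0] gdiv] := min (gnorm z) z Iz; rewrite ?Nz ?muln_eq0 //; first by lia.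
have [y ey] := gdiv _ Iz; have [q eq] := gdiv _ Ia.
have d1 : (gnorm g %| a * b)%N by rewrite -Nz ey gnormM dvdn_mull.
have d2 : (gnorm g %| a ^ 2)%N.
  by rewrite -(absz_nat a) -gnorm_int eq gnormM dvdn_mull.
have d3 : (gnorm g %| a)%N.
  suff <- : gcdn (a * b) (a ^ 2) = a by rewrite dvdn_gcd d1 d2.
  by rewrite expnS expn1 -muln_gcdr gcdnC (eqP cab) muln1.
(* N(u z + v a) = N(u) N(z) + N(v) a^2 + 2 a Re(u z conj(v)), and every term is a multiple of a. *)
have d4 : (a %| gnorm g)%N.
  have : (a%:Z %| (gnorm g)%:Z)%Z.
    apply/dvdzP; exists ((gnorm u * b)%:Z + (gnorm v * a)%:Z + 2 * (gmul (gmul u z) (gconj v)).1).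
    rewrite mulrDl mulrDl -[((gnorm u * b)%:Z * _)]PoszM -mulnA [(b * a)%N]mulnC -Nz -gnormM.
    rewrite -[((gnorm v * a)%:Z * _)]PoszM.
    have -> : (gnorm v * a * a)%N = gnorm (gmul v (gint a%:Z)) by rewrite gnormM gnorm_int absz_nat; lia.
    rewrite eg !gnormE /gadd /gmul /gconj /gint /=; ring.
  by rewrite dvdzE.
have Ng : gnorm g = a by apply/eqP; rewrite eqn_dvd d3 d4.
exists g, y; split; rewrite // ?[gmul g y]gmulC //.
by move: Nz; rewrite ey gnormM Ng mulnC => /eqP; rewrite eqn_pmul2l // => /eqP.
Qed.

Lemma godd_norm z : odd (gnorm z) = odd `|z.1| (+) odd `|z.2|.
Proof. by rewrite /gnorm oddD !oddX. Qed.

Lemma goddM z w : godd z -> godd w -> godd (gmul z w).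
Proof. have oddE (m : int) : odd `|m| -> exists k, m = 2 * k + 1 by exists (m %/ 2)%Z; lia.
have evE (m : int) : ~~ odd `|m| -> exists k, m = 2 * k by exists (m %/ 2)%Z; lia.
case: z w => [a b] [c d]; rewrite /godd /gmul /=.
move=> /andP[/oddE[i ->] /evE[j ->]] /andP[/oddE[k ->] /evE[l ->]].
have -> : (2 * i + 1) * (2 * k + 1) - 2 * j * (2 * l) = 2 * (2 * i * k + i + k - 2 * j * l) + 1 by ring.
have -> : (2 * i + 1) * (2 * l) + 2 * j * (2 * k + 1) = 2 * (2 * i * l + l + 2 * j * k + j) by ring.
lia. Qed.

Lemma godd_normP z : odd (gnorm z) -> godd z || godd (gmul (0, 1) z).
Proof.
rewrite godd_norm /godd /gmul /= !mul0r !mul1r sub0r add0r abszN.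
by case: (odd _); case: (odd _).
Qed.

(* The odd-type elements of norm n; for odd n this is half of all the elements of norm n. *)
Definition gset n : seq gauss :=
  [seq z <- [seq (u, v) | u : int <- zbox n, v : int <- zbox n] | godd z && (gnorm z == n)].

Lemma mem_zbox n (m : int) : (m \in zbox n) = (`|m| <= n)%N.
Proof.
apply/mapP/idP => [[i]|h].
  by rewrite mem_iota => /andP[_ hi] ->; lia.
by exists `|(m + n%:Z)%R|%N; rewrite ?mem_iota; lia.
Qed.
Lemma zbox_uniq n : uniq (zbox n).
Proof. by rewrite map_inj_uniq ?iota_uniq // => i j; lia. Qed.

Lemma gset_uniq n : uniq (gset n).
Proof.
by apply: filter_uniq; apply: allpairs_uniq; rewrite ?zbox_uniq // => -[? ?] [? ?].
Qed.

Lemma mem_gset n z : (z \in gset n) = godd z && (gnorm z == n).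
Proof.
rewrite mem_filter andb_idr // => /andP[_ /eqP nz]; case: z nz => a b nz.
by apply/allpairsP; exists (a, b); rewrite /= !mem_zbox -nz /gnorm /=; split=> //; nia.
Qed.

Lemma gset_even n : ~~ odd n -> gset n = [::].
Proof.
move=> no; case E: (gset n) => [//|z s]; have := mem_head z s.
rewrite -E mem_gset => /andP[+ /eqP nz]; move: no; rewrite -nz godd_norm /godd.
by case: (odd _); case: (odd _).
Qed.

(** An odd square plus an even square is 1 modulo 4. In particular the norm 3 does not occur, which
    the treatment of the Euler factor at 3 relies on. *)
Lemma gset_mod4 n : (n %% 4 != 1)%N -> gset n = [::].
Proof.
move=> no; case E: (gset n) => [//|z s]; have := mem_head z s.
rewrite -E mem_gset => /andP[] /andP[] o1 o2 /eqP nz; case/negP: no; rewrite -nz /gnorm.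
rewrite -(odd_double_half `|z.1|) o1 -(odd_double_half `|z.2|) (negbTE o2).
set i := _./2; set j := _./2.
have -> : ((true + i.*2) ^ 2 + (false + j.*2) ^ 2 = (i ^ 2 + i + j ^ 2) * 4 + 1)%N by lia.
by rewrite modnMDl.
Qed.

Lemma gset1 : perm_eq (gset 1) [:: gint 1; gint (- 1)].
Proof. by []. Qed.

Lemma mem_gset_conj n z : (gconj z \in gset n) = (z \in gset n).
Proof. by rewrite !mem_gset gnorm_conj /godd /= abszN. Qed.
Lemma mem_gset_opp n z : (gopp z \in gset n) = (z \in gset n).
Proof. by rewrite !mem_gset gnorm_opp /godd /= !abszN. Qed.

Lemma big_gset_conj (V : nmodType) n (F : gauss -> V) :
  \sum_(z <- gset n) F (gconj z) = \sum_(z <- gset n) F z.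
Proof.
rewrite -(big_map gconj xpredT F); apply: perm_big; apply: uniq_perm.
- by rewrite (map_inj_uniq (can_inj gconjK)) gset_uniq.
- exact: gset_uniq.
move=> z; apply/mapP/idP => [[w hw ->]|hz]; first by rewrite mem_gset_conj.
by exists (gconj z); rewrite ?mem_gset_conj ?gconjK.
Qed.

Lemma big_gset_opp (V : nmodType) n (F : gauss -> V) :
  \sum_(z <- gset n) F (gopp z) = \sum_(z <- gset n) F z.
Proof.
have oK : involutive gopp by case=> a b; rewrite /gopp /= !opprK.
rewrite -(big_map gopp xpredT F); apply: perm_big; apply: uniq_perm.
- by rewrite (map_inj_uniq (can_inj oK)) gset_uniq.
- exact: gset_uniq.
move=> z; apply/mapP/idP => [[w hw ->]|hz]; first by rewrite mem_gset_opp.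
by exists (gopp z); rewrite ?mem_gset_opp ?oK.
Qed.

Lemma gunit_godd e : godd e -> gnorm e = 1%N -> e = gint 1 \/ e = gint (- 1).
Proof.
move=> oe ne; have : e \in gset 1 by rewrite mem_gset oe ne.
by rewrite (perm_mem gset1) !inE => /orP[] /eqP ->; [left|right].
Qed.

(** Otherwise i e has odd type, hence so has i e x; but e x and i e x cannot both have odd type. *)
Lemma godd_cancel x e : godd x -> godd (gmul e x) -> odd (gnorm e) -> godd e.
Proof.
move=> ox oex oe; case/orP: (godd_normP oe) => // h.
have := goddM h ox; rewrite -gmulA; move: oex; case: (gmul e x) => a b.
rewrite {1}/godd => /andP[h1 _].
have -> : gmul (0, 1) (a, b) = (- b, a) by rewrite /gmul /=; congr pair; ring.
by rewrite {1}/godd /= h1 andbF.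
Qed.

(** Comparing norms shows that t is a unit, and x = t x'. Since x and x' have odd type, so has t,
    which leaves t = 1 or t = -1. *)
Lemma gassoc x x' (t : gauss) n : (0 < n)%N -> gnorm x = n -> gnorm x' = n -> godd x -> godd x' ->
  gmul (gconj x') x = gmul (gint n%:Z) t -> x = x' \/ x = gopp x'.
Proof.
move=> n0 nx nx' ox ox' et.
have nt : gnorm t = 1%N.
  have := congr1 gnorm et; rewrite !gnormM gnorm_conj nx nx' gnorm_int absz_nat mulnn => /eqP.
  by rewrite -{1}[(n ^ 2)%N]muln1 eqn_pmul2l ?expn_gt0 ?n0 // => /eqP.
have ex : x = gmul t x'.
  apply: (@gmulI (gint n%:Z)); first by rewrite gnorm_int absz_nat -lt0n expn_gt0 n0.
  by rewrite gmulA -et -{1}nx' -gmul_conj -!gmulA [gmul x' _]gmulC gmulA.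
have ot : godd t by apply: (godd_cancel ox'); rewrite -?ex ?nt.
case: (gunit_godd ot nt) => et1; [left|right]; rewrite ex et1 ?gmul1 //.
by case: (x') => a b; rewrite /gmul /gopp /=; congr pair; ring.
Qed.

(** Uniqueness of the factorisation in [gfactor] up to a common sign. Multiplying x y = x' y' by
    conj(x') conj(y) gives b conj(x') x = a y' conj(y), so a divides conj(x') x by coprimality and
    [gassoc] applies. *)
Lemma gfiber x y x' y' a b : coprime a b -> (0 < a)%N ->
  gnorm x = a -> gnorm y = b -> gnorm x' = a -> gnorm y' = b ->
  godd x -> godd x' -> (0 < b)%N ->
  gmul x y = gmul x' y' -> (x = x' /\ y = y') \/ (x = gopp x' /\ y = gopp y').
Proof.
move=> cab a0 nx ny nx' ny' ox ox' b0 e.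
have eb : gmul (gmul (gconj x') x) (gint b%:Z) = gmul (gint a%:Z) (gmul y' (gconj y)).
  rewrite -ny -gmul_conj -nx' -gmul_conj.
  by rewrite -gmulA [gmul x _]gmulA e -!gmulA [gmul x' (gmul (gconj x') _)]gmulA [gmul x' (gconj x')]gmulC -!gmulA.
have [t et] : exists t, gmul (gconj x') x = gmul (gint a%:Z) t.
  move: eb; case: (gmul (gconj x') x) (gmul y' (gconj y)) => [u v] [c d].
  rewrite /gmul /gint /= !mulr0 !mul0r !subr0 ?addr0 ?add0r => -[e1 e2].
  have cab' : coprimez a%:Z b%:Z by rewrite coprimezE.
  have /dvdzP[p hp] : (a%:Z %| u)%Z by rewrite -(Gauss_dvdzl _ cab') e1 dvdz_mulr.
  have /dvdzP[q hq] : (a%:Z %| v)%Z by rewrite -(Gauss_dvdzl _ cab') e2 dvdz_mulr.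
  by exists (p, q); rewrite /= hp hq; congr pair; ring.
have nx0 : gnorm x != 0%N by rewrite nx -lt0n.
case: (gassoc a0 nx nx' ox ox' et) => ex; [left|right]; split=> //.
  by apply: (gmulI nx0); rewrite e ex.
apply: (gmulI nx0); rewrite e ex; case: (x') (y') => [c d] [u v].
by rewrite /gmul /gopp /=; congr pair; ring.
Qed.

(** Each z of norm a b is hit exactly twice, by (x, y) and (-x, -y): existence is [gfactor],
    uniqueness is [gfiber]. *)
Lemma big_gsetM (V : nmodType) a b (F : gauss -> V) : coprime a b -> odd a -> odd b ->
  \sum_(x <- gset a) \sum_(y <- gset b) F (gmul x y) = \sum_(z <- gset (a * b)) F z *+ 2.
Proof.
move=> cab oa ob; have a0 : (0 < a)%N by case: (a) oa. have b0 : (0 < b)%N by case: (b) ob.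
pose prs := [seq (x, y) | x <- gset a, y <- gset b].
have mprs p : (p \in prs) = (p.1 \in gset a) && (p.2 \in gset b).
  apply/allpairsP/andP => [[[x y] /= [hx hy ->]] //|[h1 h2]].
  by exists p; rewrite h1 h2; case: p {h1 h2}.
have uprs : uniq prs by apply: allpairs_uniq; rewrite ?gset_uniq // => -[? ?] [? ?].
have -> : \sum_(x <- gset a) \sum_(y <- gset b) F (gmul x y) = \sum_(p <- prs) F (gmul p.1 p.2).
  by rewrite big_allpairs.
have -> : \sum_(p <- prs) F (gmul p.1 p.2) =
    \sum_(p <- prs) \sum_(z <- gset (a * b) | z == gmul p.1 p.2) F z.
  rewrite !big_seq; apply: eq_bigr => -[x y]; rewrite mprs !mem_gset /= => /andP[/andP[ox /eqP nx] /andP[oy /eqP ny]].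
  rewrite big_mkcond (bigD1_seq (gmul x y)) ?gset_uniq ?mem_gset ?goddM ?gnormM ?nx ?ny //=.
  rewrite eqxx big1 ?addr0 // => z /negbTE hz; by rewrite hz.
rewrite (exchange_big_dep xpredT) //= !big_seq; apply: eq_bigr => z.
rewrite mem_gset => /andP[oz /eqP nz].
rewrite big_const_seq iter_addr addr0; congr (_ *+ _).
have [x [y [nx ny ez]]] := gfactor cab nz a0 b0.
have [x0 [y0 [nx0 ny0 ez0 ox0 oy0]]] : exists x y, [/\ gnorm x = a, gnorm y = b, z = gmul x y, godd x & godd y].
  (* Once x has odd type, so has y, because z does. If x has not, i x has, and -i y compensates. *)
  have fin x1 y1 : gnorm x1 = a -> gnorm y1 = b -> z = gmul x1 y1 -> godd x1 ->
    exists x y, [/\ gnorm x = a, gnorm y = b, z = gmul x y, godd x & godd y].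
    move=> h1 h2 h3 h4; exists x1, y1; split => //.
    by apply: (godd_cancel h4); rewrite 1?gmulC -?h3 // h2.
  have : odd (gnorm x) by rewrite nx.
  case/godd_normP/orP => ox; first exact: (fin x y).
  apply: (fin (gmul (0, 1) x) (gmul (0, - 1) y)) => //.
  - by rewrite gnormM nx mul1n.
  - by rewrite gnormM ny mul1n.
  by rewrite ez; case: (x) (y) => [c d] [u v]; rewrite /gmul /=; congr pair; ring.
rewrite -size_filter.
have x00 : x0 != gopp x0.
  apply/eqP => h; move: ox0; have := congr1 fst h; rewrite /godd /=; case: (x0) => c d /=; lia.
rewrite (@perm_size _ _ [:: (x0, y0); (gopp x0, gopp y0)]) //.
apply: uniq_perm; first exact: filter_uniq.
  by rewrite /= inE xpair_eqE (negbTE x00).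
move=> [u v]; rewrite mem_filter mprs !mem_gset !inE /= !xpair_eqE.
apply/idP/idP => [/and3P[/eqP euv /andP[ou /eqP nu] /andP[ov /eqP nv]]|].
  have euv' : gmul u v = gmul x0 y0 by rewrite -euv ez0.
  by case: (gfiber cab a0 nu nv nx0 ny0 ou ox0 b0 euv') => -[-> ->]; rewrite !eqxx ?orbT.
case/orP => /andP[/eqP -> /eqP ->].
  by rewrite ez0 !eqxx nx0 ny0 ox0 oy0 !eqxx.
rewrite !gnorm_opp nx0 ny0 !eqxx /godd /= !abszN; move: ox0 oy0; rewrite /godd => -> -> /=.
rewrite ez0 !andbT; apply/eqP; case: (x0) (y0) => [c d] [e f].
by rewrite /gmul /gopp /=; congr pair; ring.
Qed.

(** If q divides the real part, it divides the imaginary part too, because q divides the norm; so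
    testing the real part detects divisibility by q. *)
Lemma gset_prime_pow2 q j : prime q -> odd q ->
  {subset [seq z <- gset (q ^ j.+2) | (q%:Z %| z.1)%Z] <=
   [seq gmul (gint q%:Z) z | z <- gset (q ^ j)]}.
Proof.
move=> pq oq [u v]; rewrite mem_filter mem_gset /= => /andP[/dvdzP[k hk] /andP[ouv /eqP nuv]].
have q0 : (0 < q)%N by exact: prime_gt0.
have Nz := gnormE (u, v).
have /dvdzP[l hl] : (q%:Z %| v)%Z.
  have hv : (q%:Z %| v ^+ 2)%Z.
    have -> : v ^+ 2 = (gnorm (u, v))%:Z - u ^+ 2 by rewrite Nz /=; ring.
    rewrite nuv hk; apply/dvdzP; exists ((q ^ j.+1)%N%:Z - k ^+ 2 * q%:Z).
    rewrite [(q ^ j.+2)%N]expnSr PoszM; ring.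
  by move: hv; rewrite !dvdzE abszX /= Euclid_dvdX // andbT.
apply/mapP; exists (k, l); last by rewrite /gmul /gint /= hk hl; congr pair; ring.
rewrite mem_gset; have e : (u, v) = gmul (gint q%:Z) (k, l).
  by rewrite /gmul /gint /= hk hl; congr pair; ring.
apply/andP; split.
  move: ouv; rewrite /godd hk hl /= !abszM !oddM /= oq !andbT //.
have := gnormM (gint q%:Z) (k, l); rewrite -e nuv gnorm_int absz_nat !expnS.
by rewrite expn0 muln1 mulnA => /eqP; rewrite eqn_pmul2l ?muln_gt0 ?q0 // eq_sym.
Qed.

(* Two elements of norm q^j not divisible by q differ by a unit or by conjugation and a unit. *)
Lemma gprim_assoc q j z w : prime q -> odd q -> gnorm z = (q ^ j)%N -> gnorm w = (q ^ j)%N ->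
  godd z -> godd w -> ~~ (q%:Z %| z.1)%Z -> ~~ (q%:Z %| w.1)%Z -> (0 < j)%N ->
  z \in [:: w; gopp w; gconj w; gopp (gconj w)].
Proof.
move=> pq oq nz nw oz ow pz pw j0.
have q0 : (0 < q ^ j)%N by rewrite expn_gt0 prime_gt0.
(* A = Im(z conj(w)) and B = Im(z w). Their product is a multiple of q^j, and q cannot divide both,
   as it would divide A + B = 2 z.2 w.1; hence q^j divides one of them. *)
pose A := z.2 * w.1 - z.1 * w.2; pose B := z.2 * w.1 + z.1 * w.2.
have hAB : ((q ^ j)%N%:Z %| A * B)%Z.
  have -> : A * B = (gnorm z)%:Z * w.1 ^+ 2 - z.1 ^+ 2 * (gnorm w)%:Z.
    by rewrite !gnormE /A /B; ring.
  rewrite nz nw; apply: rpredB; [exact: dvdz_mulr | exact: dvdz_mull].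
have pqz (m : int) : (q%:Z %| m)%Z = (q %| `|m|)%N by rewrite dvdzE.
have pz2 : ~~ (q %| `|z.2|)%N.
  apply/negP => h; move/negP: pz; apply.
  have : (q %| gnorm z)%N by rewrite nz dvdn_exp.
  by rewrite pqz /gnorm dvdn_addl ?Euclid_dvdX ?h // ?andbT.
have nAB : ~~ ((q %| `|A|) && (q %| `|B|))%N.
  apply/negP => /andP[]; rewrite -!pqz => hA hB.
  have : (q%:Z %| 2 * (z.2 * w.1))%Z.
    have -> : 2 * (z.2 * w.1) = A + B by rewrite /A /B; ring.
    exact: rpredD.
  have pw' := pw; rewrite pqz in pw'.
  rewrite pqz !abszM !Euclid_dvdM // (negbTE pz2) (negbTE pw') !orbF.
  rewrite -[`|2|%N]/2%N dvdn_prime2 // => /eqP h; by move: oq; rewrite h.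
have key w' : gnorm w' = (q ^ j)%N -> godd w' -> ((q ^ j)%N%:Z %| z.2 * w'.1 - z.1 * w'.2)%Z ->
    z = w' \/ z = gopp w'.
  move=> nw' ow' /dvdzP[k hk].
  (* The squares of the real and imaginary parts of z conj(w') add up to q^(2j), so q^j divides the
     real part as well and [gassoc] applies. *)
  have hre : ((q ^ j)%N%:Z %| z.1 * w'.1 + z.2 * w'.2)%Z.
    rewrite dvdzE -(@dvdn_pexp2r _ _ 2) // -!abszX -dvdzE.
    have -> : (z.1 * w'.1 + z.2 * w'.2) ^+ 2 =
      (gnorm z)%:Z * (gnorm w')%:Z - (z.2 * w'.1 - z.1 * w'.2) ^+ 2 by rewrite !gnormE; ring.
    rewrite hk nz nw' exprMn; apply/dvdzP; exists (1 - k ^+ 2); ring.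
  case/dvdzP: hre => l hl.
  apply: (@gassoc z w' (l, k) (q ^ j)) => //.
  rewrite /gmul /gconj /gint /=; congr pair.
    by transitivity (z.1 * w'.1 + z.2 * w'.2); [ring | rewrite hl; ring].
  by transitivity (z.2 * w'.1 - z.1 * w'.2); [ring | rewrite hk; ring].
have cop m : ~~ (q %| `|m|)%N -> coprimez (q ^ j)%N%:Z m.
  by move=> h; rewrite coprimezE /= coprimeXl // prime_coprime.
case hA : (q %| `|A|)%N.
  have hB : ~~ (q %| `|B|)%N by move: nAB; rewrite hA.
  have := hAB; rewrite Gauss_dvdzl ?cop // => h.
  by case: (key w nw ow h) => ->; rewrite !inE eqxx ?orbT.
have := hAB; rewrite Gauss_dvdzr ?cop ?hA // => h.
case: (key (gconj w)); rewrite ?gnorm_conj //.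
- by move: ow; rewrite /godd /= abszN.
- by rewrite /= mulrN opprK.
- by move=> ->; rewrite !inE eqxx ?orbT.
by move=> ->; rewrite !inE eqxx ?orbT.
Qed.

(** By [gprim_assoc] at most 4 elements of norm q^(j+2) are prime to q; the others are q times
    elements of norm q^j. The size thus grows by at most 4 when j grows by 2, starting from 2 for j
    = 0 and at most 4 for j = 1. *)
Lemma size_gset_pow q j : prime q -> (size (gset (q ^ j)) <= 2 * j.+1)%N.
Proof.
move=> pq; case: (boolP (odd q)) => oq; last first.
  case: j => [|j]; first by rewrite expn0 (perm_size gset1).
  by rewrite gset_even // oddX negb_or.
move: j; have prim j : (0 < j)%N -> (size [seq z <- gset (q ^ j) | ~~ (q%:Z %| z.1)%Z] <= 4)%N.
  move=> j0; set s := [seq z <- _ | _]; have us : uniq s by rewrite filter_uniq ?gset_uniq.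
  case E : s => [//|w s']; have : w \in s by rewrite E mem_head.
  rewrite mem_filter mem_gset => /and3P[pw ow /eqP nw]; rewrite -E.
  apply: (@uniq_leq_size _ s [:: w; gopp w; gconj w; gopp (gconj w)]) => // z.
  rewrite mem_filter mem_gset => /and3P[pz oz /eqP nz].
  exact: (gprim_assoc pq oq nz nw).
have rec j : (size (gset (q ^ j.+2)) <= size (gset (q ^ j)) + 4)%N.
  rewrite -(count_predC (fun z : gauss => (q%:Z %| z.1)%Z)) -!size_filter leq_add ?prim //.
  rewrite -(size_map (gmul (gint q%:Z)) (gset (q ^ j))); apply: uniq_leq_size.
    by rewrite filter_uniq ?gset_uniq.
  exact: gset_prime_pow2.
move=> j; suff : (size (gset (q ^ j)) <= 2 * j.+1)%N /\ (size (gset (q ^ j.+1)) <= 2 * j.+2)%N by case.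
elim: j => [|j [h1 h2]].
  rewrite expn0 (perm_size gset1) expn1; split => //.
  rewrite -(count_predC (fun z : gauss => (q%:Z %| z.1)%Z)) -!size_filter.
  rewrite -[X in (_ <= X)%N]/(0 + 4)%N leq_add //; last by have := prim 1%N isT; rewrite expn1.
  rewrite leqn0 size_eq0 -(negbK (_ == _)) -has_filter; apply/hasPn => -[u v].
  rewrite mem_gset => /andP[/andP[ou _] /eqP nu]; apply/negP => /= hd.
  have : (q ^ 2 <= `|u| ^ 2)%N.
    by rewrite leq_sqr dvdn_leq // ?(dvdzE _ _) // lt0n; case: `|u|%N ou.
  have := nu; rewrite /gnorm /=; have := prime_gt1 pq; move: (_ ^ 2)%N => s; rewrite -mulnn.
  set t := (_ ^ 2)%N => q1 e h; have : (q * q <= q * 1)%N by lia.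
  by rewrite leq_pmul2l; lia.
split=> //; apply: (leq_trans (rec j)); lia.
Qed.
End GaussianIntegers.

(** * Sums over smooth numbers, Mertens bounds and Brun's sieve *)

Definition multf (R : realType) (F : nat -> R) :=
  F 1%N = 1 /\ forall a b, coprime a b -> (0 < a)%N -> (0 < b)%N -> F (a * b)%N = F a * F b.

Definition pr (y : nat) : seq nat := [seq p <- iota 0 y.+1 | prime p].

Lemma pr_uniq y : uniq (pr y). Proof. by rewrite filter_uniq ?iota_uniq. Qed.
Lemma mem_pr y p : (p \in pr y) = prime p && (p <= y)%N.
Proof. by rewrite mem_filter mem_iota. Qed.
Lemma pr_prime y : all prime (pr y).
Proof. by apply/allP => p; rewrite mem_pr => /andP[]. Qed.

(** The integers composed of primes in [ps] with exponents at most J. Bounding the exponents makes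
    the Euler product [sum_smooths] an identity between finite expressions. *)
Fixpoint smooths (J : nat) (ps : seq nat) : seq nat :=
  if ps is p :: ps' then [seq (p ^ j * m)%N | j <- iota 0 J.+1, m <- smooths J ps'] else [:: 1%N].

Arguments smooths : simpl never.

Lemma smooths_cons J p ps :
  smooths J (p :: ps) = [seq (p ^ j * m)%N | j <- iota 0 J.+1, m <- smooths J ps].
Proof. by []. Qed.

Lemma smooths_spec J ps : all prime ps -> forall n, n \in smooths J ps ->
  (0 < n)%N /\ forall q, prime q -> (q %| n)%N -> q \in ps.
Proof.
elim: ps => [_ n|p ps IH /= /andP[pp pps] n].
  by rewrite inE => /eqP ->; split => // q pq; rewrite dvdn1 => /eqP q1; rewrite q1 in pq.
rewrite smooths_cons => /allpairsP[] [j m] /= [_ hm ->]; have [m0 hq] := IH pps m hm.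
rewrite muln_gt0 expn_gt0 prime_gt0 // m0; split => // q pq.
rewrite Euclid_dvdM // => /orP[|h]; last by rewrite inE hq ?orbT.
by rewrite Euclid_dvdX // => /andP[]; rewrite dvdn_prime2 // => /eqP -> _; rewrite mem_head.
Qed.

Lemma smooths_coprime J ps p : all prime ps -> prime p -> p \notin ps ->
  forall m, m \in smooths J ps -> coprime p m.
Proof.
move=> pps pp np m hm; rewrite prime_coprime //; apply/negP => hd.
by have [_ /(_ p pp hd)] := smooths_spec pps hm; rewrite (negbTE np).
Qed.

Lemma logn_mul_pow p j m : prime p -> (0 < m)%N -> coprime p m -> logn p (p ^ j * m) = j.
Proof.
move=> pp m0 cpm; rewrite mulnC logn_Gauss ?pfactorK //.
Qed.

Lemma smooths_uniq J ps : all prime ps -> uniq ps -> uniq (smooths J ps).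
Proof.
elim: ps => [//|p ps IH /= /andP[pp pps] /andP[np ups]].
rewrite smooths_cons; apply: allpairs_uniq; rewrite ?IH ?iota_uniq //.
move=> [j m] [j' m'] hx hy e.
have mem2 u w : (u, w) \in [seq (x, y) | x <- iota 0 J.+1, y <- smooths J ps] -> w \in smooths J ps.
  by move=> /allpairsP [[a b]] /= [_ hb [_ ->]].
move: (mem2 _ _ hx) (mem2 _ _ hy) e => {hx hy} hb hd /= e.
have [b0 _] := smooths_spec pps hb; have [d0 _] := smooths_spec pps hd.
have e1 := congr1 (logn p) e; rewrite !logn_mul_pow // in e1; [|exact: (smooths_coprime pps pp np hd)|exact: (smooths_coprime pps pp np hb)].
move: e; rewrite e1 => /eqP; rewrite eqn_pmul2l ?expn_gt0 ?prime_gt0 // => /eqP ->; done.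
Qed.

Lemma mem_smooths J ps n : all prime ps -> (0 < n)%N ->
  (forall q, prime q -> (q %| n)%N -> q \in ps) -> (forall q, (logn q n <= J)%N) -> n \in smooths J ps.
Proof.
elim: ps n => [|p ps IH] n.
  move=> _ n0 h _; rewrite inE; case: (ltngtP n 1) => // n1; first by move: n0 n1; lia.
  by have := h _ (pdiv_prime n1) (pdiv_dvd n).
move=> /= /andP[pp pps] n0 h hJ; rewrite smooths_cons; apply/allpairsP.
have [m cpm en] := pfactor_coprime pp n0; exists (logn p n, m) => /=.
have m0 : (0 < m)%N by case: m en n0 {cpm} => [->|].
split; first by rewrite -[_ :: _]/(iota 0 J.+1) mem_iota ltnS hJ.
  apply: IH => // q; last first.
    by apply: leq_trans (hJ q); rewrite en dvdn_leq_log ?dvdn_mulr // -en.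
  move=> pq hq; have : q \in p :: ps by apply: h => //; rewrite en dvdn_mulr.
  rewrite inE => /orP[/eqP eq|//]; move: cpm; rewrite prime_coprime // -eq hq //.
by rewrite mulnC.
Qed.

Lemma sum_smooths (R : realType) (F : nat -> R) J ps : multf F -> all prime ps -> uniq ps ->
  \sum_(n <- smooths J ps) F n = \prod_(p <- ps) \sum_(0 <= j < J.+1) F (p ^ j)%N.
Proof.
move=> [F1 FM]; elim: ps => [_ _|p ps IH /= /andP[pp pps] /andP[np ups]].
  by rewrite /smooths big_seq1 big_nil F1.
rewrite big_cons -IH // smooths_cons big_allpairs_dep big_distrl /= /index_iota subn0.
apply: eq_bigr => j _; rewrite big_distrr /= !big_seq; apply: eq_bigr => m hm.
have [m0 _] := smooths_spec pps hm.
rewrite FM // ?expn_gt0 ?prime_gt0 // coprimeXl //.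
exact: (smooths_coprime pps pp np hm).
Qed.

Definition smooth (y n : nat) := all (fun p => (p <= y)%N) (primes n).

Lemma logn_leq q n : (logn q n <= n)%N.
Proof.
case: (posnP n) => [->|n0]; first by rewrite logn0.
case: (boolP (prime q)) => pq; last by rewrite /logn (negbTE pq).
apply: leq_trans (_ : q ^ logn q n <= n)%N; first exact: (ltnW (ltn_expl _ (prime_gt1 pq))).
exact: dvdn_leq n0 (pfactor_dvdnn q n).
Qed.

Lemma smooth_mem_smooths J y n : (0 < n)%N -> (n <= J)%N -> smooth y n -> n \in smooths J (pr y).
Proof.
move=> n0 nJ /allP sm; apply: mem_smooths; rewrite ?pr_prime //.
  by move=> q pq hq; rewrite mem_pr pq sm // mem_primes pq n0.
by move=> q; apply: leq_trans (logn_leq q n) nJ.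
Qed.

Lemma sum_smooth_le (R : realType) (F : nat -> R) N y : multf F -> (forall n, 0 <= F n) ->
  \sum_(1 <= n < N.+1 | smooth y n) F n <= \prod_(p <- pr y) (1 + \sum_(1 <= j < N.+1) F (p ^ j)%N).
Proof.
move=> mF F0; have := sum_smooths N mF (pr_prime y) (pr_uniq y).
have -> : \prod_(p <- pr y) \sum_(0 <= j < N.+1) F (p ^ j)%N =
  \prod_(p <- pr y) (1 + \sum_(1 <= j < N.+1) F (p ^ j)%N).
  by apply: eq_bigr => p _; rewrite big_ltn // expn0 mF.1.
move=> <-; rewrite -big_filter.
set s := [seq _ <- _ | _].
rewrite [X in _ <= X](bigID (fun n => n \in s)) /= -[X in _ <= X + _]big_filter.
apply: ler_wpDr; first exact: sumr_ge0.
rewrite le_eqVlt; apply/orP; left; apply/eqP/perm_big/uniq_perm.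
- by rewrite filter_uniq ?iota_uniq.
- by rewrite filter_uniq ?smooths_uniq ?pr_prime ?pr_uniq.
move=> n; rewrite [RHS]mem_filter; apply/idP/andP => [h|[] //]; split=> //.
move: h; rewrite mem_filter mem_index_iota => /and3P[sm n0 nN].
exact: smooth_mem_smooths.
Qed.

Lemma prod_1D_le_exp (R : realType) (ps : seq nat) (G : nat -> R) : (forall p, 0 <= G p) ->
  \prod_(p <- ps) (1 + G p) <= expR (\sum_(p <- ps) G p).
Proof.
move=> G0; rewrite expR_sum; apply: ler_prod => p _.
by rewrite expR_ge1Dx addr_ge0.
Qed.

Lemma sum_inv_sq (R : realType) y : \sum_(p <- pr y) (p%:R ^+ 2)^-1 <= 1 :> R.
Proof.
(* Telescoping from 1 / p^2 <= 1 / (p - 1) - 1 / p. *)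
have step n : \sum_(2 <= p < n.+2) (p%:R ^+ 2)^-1 <= 1 - n.+1%:R^-1 :> R.
  elim: n => [|n IH]; first by rewrite big_geq // invr1 subrr.
  rewrite big_nat_recr //=.
  apply: (le_trans (lerD IH (lexx _))).
  rewrite -lerBrDl -subr_ge0 -[X in X - _]opprK.
  have h1 : n.+1%:R != 0 :> R by rewrite pnatr_eq0.
  have h2 : n.+2%:R != 0 :> R by rewrite pnatr_eq0.
  have -> : - - (1 - n.+2%:R^-1 - (1 - n.+1%:R^-1)) - (n.+2%:R ^+ 2)^-1 = (n.+1%:R * n.+2%:R ^+ 2)^-1 :> R.
    move: h1 h2; rewrite -[n.+2]addn1 natrD; move: (n.+1%:R : R) => t h1 h2; field.
    by rewrite h1 h2.
  by rewrite invr_ge0 mulr_ge0 // exprn_ge0.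
case: y => [|y]; first by rewrite big_nil.
apply: le_trans (_ : \sum_(2 <= p < y.+2) (p%:R ^+ 2)^-1 <= _); last first.
  by apply: le_trans (step y) _; rewrite lerBlDr lerDl.
rewrite big_filter -[iota 0 y.+2]/(0%N :: 1%N :: iota 2 y) !big_cons /=.
rewrite /index_iota subSS subSS subn0 big_mkcond /=; apply: ler_sum => p _.
by case: ifP => // _; rewrite invr_ge0 exprn_ge0.
Qed.

Lemma geometric_tail (R : realType) (x : R) N : 0 <= x -> x <= 3 / 4 ->
  \sum_(2 <= j < N) x ^+ j <= 4 * x ^+ 2.
Proof.
move=> x0 x1.
have key n : \sum_(2 <= j < n.+2) x ^+ j = x ^+ 2 * (1 - x ^+ n) / (1 - x).
  have nz : 1 - x != 0 by lra.
  elim: n => [|n IH]; first by rewrite big_geq // expr0 subrr mulr0 mul0r.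
  rewrite big_nat_recr //= IH; apply: (mulIf nz); rewrite mulrDl !mulfVK //.
  by rewrite !exprS; ring.
have le0 : 0 <= 4 * x ^+ 2 by rewrite mulr_ge0 ?exprn_ge0.
case: N => [|[|n]]; [by rewrite big_geq|by rewrite big_geq|rewrite key].
rewrite ler_pdivrMr; last by lra.
have h2 : 0 <= x ^+ 2 by rewrite exprn_ge0.
have hn : 0 <= x ^+ n by rewrite exprn_ge0.
nra.
Qed.

(** The terms with j >= 2 form a geometric series in x = 3 / (2 p) <= 3/4, bounded by 4 D x^2 = 9 D
    / p^2, and the sum of 1 / p^2 is at most 1. Growth slower than 2^j is what keeps the series at p
    = 2 under control. *)
Lemma prod_mean (R : realType) (v : nat -> R) (D : R) : multf v -> (forall n, 0 <= v n) ->
  (forall p j, prime p -> (1 < j)%N -> v (p ^ j)%N <= D * (3 / 2) ^+ j) -> 0 <= D ->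
  forall N y, \prod_(p <- pr y) (1 + \sum_(1 <= j < N.+1) v (p ^ j)%N / (p ^ j)%:R)
    <= expR (9 * D) * expR (\sum_(p <- pr y) v p / p%:R).
Proof.
move=> [v1 vM] v0 vD D0 N y.
apply: le_trans (prod_1D_le_exp _ _) _; first by move=> p; apply: sumr_ge0 => j _; rewrite divr_ge0.
rewrite -expRD ler_expR.
have -> : 9 * D = 9 * D * 1 by rewrite mulr1.
apply: (@le_trans _ _ (9 * D * (\sum_(p <- pr y) (p%:R ^+ 2)^-1) + \sum_(p <- pr y) v p / p%:R)).
  rewrite mulr_sumr -big_split /= !big_seq; apply: ler_sum => p; rewrite mem_pr => /andP[pp _].
  case: N => [|N].
    by rewrite big_geq // addr_ge0 ?mulr_ge0 ?invr_ge0 ?exprn_ge0.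
  rewrite big_ltn // expn1 [v _ / _ + _]addrC lerD2r.
  have p2 : 2 <= p%:R :> R by rewrite ler_nat prime_gt1.
  have p0 : 0 < p%:R :> R by lra.
  pose x := 3 / 2 / p%:R : R.
  apply: (@le_trans _ _ (D * \sum_(2 <= j < N.+2) x ^+ j)).
    rewrite mulr_sumr !big_nat; apply: ler_sum => j /andP[j1 _].
    rewrite natrX ler_pdivrMr ?exprn_gt0 //; apply: (le_trans (vD p j pp j1)).
    by rewrite -mulrA -exprMn /x divfK // gt_eqF.
  have x34 : x <= 3 / 4 by rewrite /x ler_pdivrMr //; lra.
  have x0 : 0 <= x by rewrite divr_ge0 // ltW.
  rewrite [9 * D]mulrC -mulrA ler_wpM2l // (le_trans (geometric_tail _ x0 x34)) //.
  rewrite /x exprMn exprVn mulrA ler_wpM2r ?invr_ge0 ?exprn_ge0 ?(ltW p0) //; lra.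
by rewrite lerD2r ler_wpM2l ?mulr_ge0 // sum_inv_sq.
Qed.

Lemma div_multf (R : realType) (v : nat -> R) : multf v -> multf (fun n => v n / n%:R).
Proof.
move=> [v1 vM]; split; first by rewrite v1 divr1.
by move=> a b cab a0 b0; rewrite vM // natrM invfM; ring.
Qed.

Lemma smooth_mean (R : realType) (v : nat -> R) (D : R) : multf v -> (forall n, 0 <= v n) ->
  (forall p j, prime p -> (1 < j)%N -> v (p ^ j)%N <= D * (3 / 2) ^+ j) -> 0 <= D ->
  forall N y, \sum_(1 <= n < N.+1 | smooth y n) v n / n%:R
    <= expR (9 * D) * expR (\sum_(p <- pr y) v p / p%:R).
Proof.
move=> mv v0 vD D0 N y; apply: le_trans (prod_mean mv v0 vD D0 N y).
by apply: sum_smooth_le (div_multf mv) _ => n; rewrite divr_ge0.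
Qed.

Lemma smooths_mean (R : realType) (v : nat -> R) (D : R) : multf v -> (forall n, 0 <= v n) ->
  (forall p j, prime p -> (1 < j)%N -> v (p ^ j)%N <= D * (3 / 2) ^+ j) -> 0 <= D ->
  forall J y, \sum_(n <- smooths J (pr y)) v n / n%:R
    <= expR (9 * D) * expR (\sum_(p <- pr y) v p / p%:R).
Proof.
move=> mv v0 vD D0 J y; apply: le_trans (prod_mean mv v0 vD D0 J y).
rewrite (sum_smooths J (div_multf mv) (pr_prime y) (pr_uniq y)).
rewrite le_eqVlt; apply/orP; left; apply/eqP; apply: eq_bigr => p _.
by rewrite big_ltn // expn0 mv.1 divr1.
Qed.

Lemma ln_le_harmonic (R : realType) n : ln n.+1%:R <= \sum_(1 <= m < n.+1) m%:R^-1 :> R.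
Proof.
elim: n => [|n IH]; first by rewrite big_geq // ln1.
rewrite big_nat_recr //= -lerBlDl; apply: le_trans (lerB (lexx _) IH) _.
rewrite -ln_div ?posrE //; have n0 : 0 < n.+1%:R :> R by [].
have -> : n.+2%:R / n.+1%:R = 1 + n.+1%:R^-1 :> R.
  by rewrite -[n.+2]addn1 natrD mulrDl divff ?gt_eqF // mul1r.
by apply: le_ln1Dx; rewrite (lt_trans _ (_ : 0 < n.+1%:R^-1)) ?ltrN10 ?invr_gt0.
Qed.

(** Every m <= n is n-smooth, so the harmonic sum is at most the Euler product of the constant
    function 1. *)
Lemma mertens_lower (R : realType) n : ln n.+1%:R <= expR 9 * expR (\sum_(p <- pr n) p%:R^-1) :> R.
Proof.
apply: le_trans (ln_le_harmonic R n) _.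
have m1 : multf (fun _ : nat => 1 : R) by split => // a b _ _ _; rewrite mulr1.
have := @smooth_mean R (fun=> 1) 1 m1 (fun=> ler01) _ ler01 n n; rewrite mulr1.
have -> : \sum_(p <- pr n) 1 / p%:R = \sum_(p <- pr n) p%:R^-1 :> R.
  by apply: eq_bigr => p _; rewrite div1r.
move=> h; apply: le_trans (h _) => [|p j _ _]; last first.
  by rewrite mul1r exprn_ege1 //; lra.
rewrite le_eqVlt; apply/orP; left; apply/eqP; rewrite [RHS]big_mkcond /=.
rewrite !big_nat; apply: eq_bigr => m /andP[m0 mn]; rewrite div1r.
have -> // : smooth n m; apply/allP => p; rewrite mem_primes => /and3P[_ _ pm].
by apply: leq_trans (dvdn_leq m0 pm) _.
Qed.

Lemma sum_ln_primes (R : realType) m : (0 < m)%N -> \sum_(p <- primes m) ln p%:R <= ln m%:R :> R.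
Proof.
move=> m0; rewrite {2}[m]prod_prime_decomp // prime_decompE big_map natr_prod /=.
rewrite [X in _ <= X](_ : _ = \sum_(p <- primes m) (ln p%:R *+ logn p m)); last first.
  have : all prime (primes m) by apply/allP => p; rewrite mem_primes => /and3P[].
  elim: (primes m) => [_|p s IH /= /andP[pp ps]]; first by rewrite !big_nil ln1.
  rewrite !big_cons lnM ?posrE ?IH // ?natrX ?exprn_gt0 ?ltr0n ?prime_gt0 //.
    by rewrite lnXn // ltr0n prime_gt0.
  by rewrite big_seq prodr_gt0 // => q /(allP ps) pq; rewrite natrX exprn_gt0 // ltr0n prime_gt0.
rewrite !big_seq; apply: ler_sum => p hp; move: (hp); rewrite mem_primes => /and3P[pp _ _].
have l0 : 0 <= ln p%:R :> R by rewrite ln_ge0 // ler1n prime_gt0.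
by move: hp; rewrite -logn_gt0; case: (logn p m) => // k _; rewrite mulrS lerDl mulrn_wge0.
Qed.

(** The sum of ln p over all pairs of m <= n and p dividing m is at most n ln n. Exchanging the sums
    gives each ln p the weight floor(n / p) >= n / (2 p). *)
Lemma chebyshev_upper (R : realType) n : \sum_(p <- pr n) ln p%:R / p%:R <= 2 * ln n%:R :> R.
Proof.
case: n => [|n]; first by rewrite big_nil ln0 ?mulr0.
have n0 : 0 < n.+1%:R :> R by [].
have h1 : \sum_(1 <= m < n.+2) \sum_(p <- primes m) ln p%:R <= n.+1%:R * ln n.+1%:R :> R.
  apply: (@le_trans _ _ (\sum_(1 <= m < n.+2) ln n.+1%:R)); last first.
    by rewrite big_const_nat iter_addr addr0 subn1 mulr_natl.
  rewrite !big_nat; apply: ler_sum => m /andP[m0 mn]; apply: le_trans (sum_ln_primes R m0) _.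
  by rewrite ler_ln ?posrE ?ltr0n // ler_nat -ltnS.
rewrite -(ler_pM2l n0); apply: le_trans (_ : 2 * (n.+1%:R * ln n.+1%:R) <= _); last by lra.
rewrite -ler_pdivrMl // mulr_sumr mulr_sumr; apply: le_trans h1.
have -> : \sum_(1 <= m < n.+2) \sum_(p <- primes m) ln p%:R =
    \sum_(1 <= m < n.+2) \sum_(p <- pr n.+1 | (p %| m)%N) ln p%:R :> R.
  rewrite !big_nat; apply: eq_bigr => m /andP[m0 mn].
  rewrite -[RHS]big_filter; apply/perm_big/uniq_perm.
  exact: primes_uniq.
  by apply: filter_uniq; exact: pr_uniq.
  move=> p; rewrite mem_filter mem_pr mem_primes m0 /= andbC.
  case: (boolP (prime p)); rewrite ?andbF //= andbT => _; apply/idP/andP => [h|[]//]; split=> //.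
  exact: leq_trans (dvdn_leq m0 h) _.
rewrite (exchange_big_dep xpredT) //= !big_seq; apply: ler_sum => p; rewrite mem_pr => /andP[pp pn].
have p0 : (0 < p)%N by exact: prime_gt0.
have l0 : 0 <= ln p%:R :> R by rewrite ln_ge0 // ler1n.
have -> : \sum_(1 <= m < n.+2 | (p %| m)%N) ln p%:R = ln p%:R *+ (n.+1 %/ p) :> R.
  rewrite big_const_seq iter_addr addr0 divn_count_dvd; congr (_ *+ _).
  by rewrite -sum1_count big_mkcond; apply: eq_bigr => m _; case: (p %| m)%N.
rewrite -[X in _ <= X]mulr_natl.
have -> : 2^-1 * (n.+1%:R * (ln p%:R / p%:R)) = (n.+1%:R / (2 * p%:R)) * ln p%:R :> R.
  by field; rewrite pnatr_eq0 -lt0n.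
rewrite ler_wpM2r // ler_pdivrMr ?mulr_gt0 ?ltr0n // -!natrM ler_nat.
have := divn_eq n.+1 p; have := ltn_pmod n.+1 p0; have : (0 < n.+1 %/ p)%N by rewrite divn_gt0.
move: (n.+1 %/ p)%N (n.+1 %% p)%N => u v u0 vp ->; nia.
Qed.

(** The prime p divides n, n - 2 or n + 2; the second case is a congruence, which stays correct for
    n < 2 where subtraction truncates. *)
Definition bad p n := [|| p %| n, n == 2 %[mod p] | p %| n + 2]%N.

Definition scount N q r (ps : seq nat) :=
  count (fun n => (n == r %[mod q]) && all (fun p => ~~ bad p n) ps) (iota 0 N).

Lemma count_iota_mod q k r : (r < q)%N ->
  count (fun n => n %% q == r)%N (iota (k * q) q) = 1%N.
Proof.
move=> rq; rewrite -[(k * q)%N]addn0 iotaDl count_map.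
rewrite (@eq_in_count _ _ (pred1 r)); first by rewrite count_uniq_mem ?iota_uniq // mem_iota rq.
by move=> n; rewrite mem_iota /= => nq; rewrite modnMDl modn_small.
Qed.

Lemma scount_nil (R : realType) N q r : (0 < q)%N ->
  `|(scount N q r [::])%:R - N%:R / q%:R| <= 1 :> R.
Proof.
move=> q0; rewrite /scount; set P := fun n => _.
have blk k : count P (iota 0 (k * q)) = k.
  elim: k => [|k IH]; first by rewrite mul0n.
  rewrite mulSnr iotaD count_cat IH add0n.
  by rewrite -[RHS]addn1; congr addn; rewrite -(count_iota_mod k (ltn_pmod r q0)); apply: eq_count => n; rewrite /P andbT.
have e := divn_eq N q; set k := (N %/ q)%N in e; set t := (N %% q)%N in e.
have tq : (t < q)%N by rewrite ltn_pmod.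
have [h1 h2] : (k <= count P (iota 0 N))%N /\ (count P (iota 0 N) <= k.+1)%N.
  rewrite e iotaD count_cat blk leq_addr add0n -addn1 leq_add2l; split=> //.
  rewrite -(count_iota_mod k (ltn_pmod r q0)).
  have -> : iota (k * q) q = iota (k * q) t ++ iota (k * q + t) (q - t) by rewrite -iotaD subnKC // ltnW.
  rewrite count_cat; apply: leq_trans (leq_addr _ _); rewrite leq_eqVlt; apply/orP; left.
  by apply/eqP/eq_count => n; rewrite /P andbT.
move: (count _ _) h1 h2 => c; rewrite -!(ler_nat R) -[k.+1]addn1 natrD => h1 h2.
have q0' : 0 < q%:R :> R by rewrite ltr0n.
have -> : N%:R / q%:R = k%:R + t%:R / q%:R :> R.
  by rewrite {1}e natrD natrM mulrDl mulfK // gt_eqF.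
have t0 : 0 <= t%:R / q%:R :> R by rewrite divr_ge0.
have t1 : t%:R / q%:R <= 1 :> R by rewrite ler_pdivrMr // mul1r ler_nat ltnW.
by rewrite ler_norml; apply/andP; split; lra.
Qed.

Lemma scount_sub N q r ps : (scount N q r ps <= scount N q r [::])%N.
Proof. by apply: sub_count => n /= /andP[-> _]. Qed.

(** Since p > 4, the three residues are distinct, so exactly one class accounts for each n that is
    bad at p. The Chinese remainder theorem turns each into a single class modulo q p; p - 2 stands
    for -2. *)
Lemma scount_cons N q r p ps : prime p -> (4 < p)%N -> coprime q p ->
  (scount N q r (p :: ps) + \sum_(e <- [:: 0; 2; p - 2]) scount N (q * p) (chinese q p r e) ps
    = scount N q r ps)%N.
Proof.
move=> pp p4 cqp.
have eqE s (P : pred nat) : count P s = (\sum_(n <- s) P n)%N.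
  by elim: s => [|x s IH]; rewrite ?big_nil //= big_cons IH.
rewrite /scount eqE; under [X in (_ + X)%N]eq_bigr do rewrite eqE.
rewrite exchange_big /= eqE -big_split /=; apply: eq_bigr => n _.
under eq_bigr => e _ do rewrite chinese_remainder // chinese_modl // chinese_modr //.
rewrite !big_cons big_nil /bad addn0.
case: (n == r %[mod q])%N => //=; case: (all _ ps); rewrite ?andbF //= ?andbT ?addn0.
have -> : (p %| n)%N = (n == 0 %[mod p])%N by rewrite mod0n.
have -> : (p %| n + 2)%N = (n == p - 2 %[mod p])%N.
  by rewrite -(eqn_modDr 2) subnK ?modnn //; lia.
have m0 : (0 %% p = 0)%N by rewrite mod0n.
have m2 : (2 %% p = 2)%N by rewrite modn_small //; lia.
have m3 : ((p - 2) %% p = p - 2)%N by rewrite modn_small //; lia.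
rewrite m0 m2 m3.
case: (eqVneq (n %% p)%N 0%N) => [->|h0] /=.
  by have -> : (0 == p - 2)%N = false by lia.
case: (eqVneq (n %% p)%N 2%N) => [->|h2] /=; first by have -> : (2 == p - 2)%N = false by lia.
by case: eqP.
Qed.

(** The expansion of the product of 1 - 3 / p, truncated to terms with at most k primes. *)
Fixpoint brunV (R : realType) (ps : seq nat) (k : nat) : R :=
  if ps is p :: ps' then
    if k is k'.+1 then brunV R ps' k - 3 / p%:R * brunV R ps' k' else 1
  else 1.

(** The number of residue classes met in that expansion: a set of primes contributes 3 to the power
    of its size. Each class is counted with an error of at most 1. *)
Fixpoint brunE (R : realType) (ps : seq nat) (k : nat) : R :=
  if ps is p :: ps' then
    if k is k'.+1 then brunE R ps' k + 3 * brunE R ps' k' else 1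
  else 1.

(** Bonferroni inequalities. Both parities are proved together because the counts subtracted in
    [scount_cons] need the opposite bound at level k - 1; the modulus is general because it becomes
    q p there. *)
Lemma brun_bounds (R : realType) N ps : all (fun p => prime p && (4 < p)%N) ps -> uniq ps ->
  forall q r k, (0 < q)%N -> all (coprime q) ps ->
  (~~ odd k -> (scount N q r ps)%:R <= N%:R / q%:R * brunV R ps k + brunE R ps k) /\
  (odd k -> N%:R / q%:R * brunV R ps k - brunE R ps k <= (scount N q r ps)%:R).
Proof.
have base q r : (0 < q)%N -> (scount N q r [::])%:R <= N%:R / q%:R + 1 :> R /\
   N%:R / q%:R - 1 <= (scount N q r [::])%:R :> R.
  move=> q0; have := scount_nil R N r q0; rewrite ler_norml => /andP[h1 h2].
  by split; lra.
elim: ps => [_ _ q r k q0 _|p ps IH /= /andP[/andP[pp p4] aps] /andP[np ups] q r k q0 /andP[cqp cps]].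
  by have [h1 h2] := base q r q0; rewrite /= mulr1.
case: k => [|k].
  split=> // _; rewrite mulr1; apply: le_trans (base q r q0).1.
  by rewrite ler_nat scount_sub.
have qp0 : (0 < q * p)%N by rewrite muln_gt0 q0 prime_gt0.
have cqps : all (coprime (q * p)) ps.
  apply/allP => p' hp'; rewrite coprimeMl (allP cps _ hp') /=.
  have /andP[pp' _] := allP aps _ hp'.
  rewrite prime_coprime // dvdn_prime2 //; apply/negP => /eqP e; by rewrite e hp' in np.
have [u1 u2] := IH aps ups q r k.+1 q0 cps.
have hk e := IH aps ups (q * p)%N (chinese q p r e) k qp0 cqps.
have := scount_cons N r ps pp p4 cqp; rewrite !big_cons big_nil addn0.
move=> /(congr1 (fun n => n%:R : R)); rewrite !natrD => es.
have p0 : 0 < p%:R :> R by rewrite ltr0n prime_gt0.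
have q0' : 0 < q%:R :> R by rewrite ltr0n.
have eV : N%:R / (q * p)%N%:R * brunV R ps k *+ 3 = N%:R / q%:R * (3 / p%:R * brunV R ps k).
  by rewrite natrM; field; rewrite !gt_eqF.
split=> ok /=.
  have {u1}hu := u1 ok; move: (ok); rewrite /= negbK => ok'.
  have := (hk 0%N).2 ok'; have := (hk 2%N).2 ok'; have := (hk (p - 2)%N).2 ok'.
  move: es hu eV; rewrite /= mulrBr => es hu eV h1 h2 h3; lra.
have {u2}hu := u2 ok; have ok' : ~~ odd k by [].
have := (hk 0%N).1 ok'; have := (hk 2%N).1 ok'; have := (hk (p - 2)%N).1 ok'.
move: es hu eV; rewrite /= mulrBr => es hu eV h1 h2 h3; lra.
Qed.

(** Splitting off p lowers k by one in the second term. The factor 2 lost there doubles 3 / p,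
    whence 6 / p. *)
Lemma brunV_close (R : realType) ps k : all (fun p => prime p && (4 < p)%N) ps ->
  `|brunV R ps k - \prod_(p <- ps) (1 - 3 / p%:R)| <= 2^-1 ^+ k * \prod_(p <- ps) (1 + 6 / p%:R).
Proof.
move=> aps; have G1 s : 1 <= \prod_(p <- s) (1 + 6 / p%:R) :> R.
  elim: s => [|p s IH]; first by rewrite big_nil.
  by rewrite big_cons mulr_ege1 // lerDl divr_ge0.
have G2 s : all (fun p => prime p && (4 < p)%N) s ->
    0 <= \prod_(p <- s) (1 - 3 / p%:R) :> R /\ \prod_(p <- s) (1 - 3 / p%:R) <= 1 :> R.
  elim: s => [|p s IH /= /andP[/andP[pp p4] /IH[h1 h2]]]; first by rewrite big_nil.
  have p0 : 0 < p%:R :> R by rewrite ltr0n prime_gt0.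
  have t0 : 0 <= 3 / p%:R :> R by rewrite divr_ge0.
  have t1 : 3 / p%:R <= 1 :> R by rewrite ler_pdivrMr // mul1r ler_nat; lia.
  by rewrite big_cons; split; [apply: mulr_ge0 => //; lra | apply: mulr_ile1 => //; lra].
elim: ps aps k => [_ k|p ps IH /= /andP[/andP[pp p4] aps] [|k]].
- by rewrite !big_nil subrr normr0 mulr1 exprn_ge0.
- rewrite expr0 mul1r; apply: le_trans (G1 (p :: ps)).
  have aps' : all (fun p => prime p && (4 < p)%N) (p :: ps) by rewrite /= pp p4.
  have [h1 h2] := G2 (p :: ps) aps'.
  by rewrite ger0_norm ?subr_ge0 // lerBlDr lerDl.
rewrite !big_cons; set W := \prod_(j <- ps) _; set G := \prod_(j <- ps) _.
have -> : brunV R ps k.+1 - 3 / p%:R * brunV R ps k - (1 - 3 / p%:R) * W =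
   (brunV R ps k.+1 - W) - 3 / p%:R * (brunV R ps k - W) by ring.
apply: le_trans (ler_normB _ _) _; rewrite normrM [`|3 / _|]ger0_norm ?divr_ge0 //.
have h1 := IH aps k.+1; have h2 := IH aps k.
have t0 : 0 <= 3 / p%:R :> R by rewrite divr_ge0.
apply: le_trans (lerD h1 (ler_wpM2l t0 h2)) _.
rewrite -/G le_eqVlt; apply/orP; left; apply/eqP; rewrite exprS.
by field; rewrite pnatr_eq0 -lt0n prime_gt0.
Qed.

(** A set of i <= k primes is given the weight Z^(k - i) >= 1; the sum over all sets is then a
    product. *)
Lemma brunE_le (R : realType) ps k (Z : R) : 1 <= Z -> brunE R ps k <= Z ^+ k * (1 + 3 / Z) ^+ size ps.
Proof.
move=> Z1; have Z0 : 0 < Z by lra.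
have g1 : 1 <= 1 + 3 / Z by rewrite lerDl divr_ge0 // ltW.
elim: ps k => [k|p ps IH [|k]] /=; first by rewrite mulr1 exprn_ege1.
  by rewrite expr0 mul1r exprn_ege1.
apply: le_trans (lerD (IH k.+1) (ler_wpM2l _ (IH k))) _ => //.
rewrite le_eqVlt; apply/orP; left; apply/eqP; rewrite !exprS.
by field; rewrite gt_eqF.
Qed.

Lemma sum_inv_pr_ge0 (R : realType) (ps : seq nat) : 0 <= \sum_(p <- ps) p%:R^-1 :> R.
Proof. by apply: sumr_ge0 => p _; rewrite invr_ge0. Qed.

Definition sieve_primes (z q : nat) := [seq p <- pr z | (4 < p)%N && coprime q p].

Lemma brun_sieve (R : realType) N q r z k : (0 < q)%N -> ~~ odd k ->
  (scount N q r (sieve_primes z q))%:R <=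
    N%:R / q%:R * (expR (- 3 * \sum_(p <- sieve_primes z q) p%:R^-1)
        + 2^-1 ^+ k * expR (6 * \sum_(p <- pr z) p%:R^-1))
    + expR 3 * z.+1%:R ^+ k :> R.
Proof.
move=> q0 ok; set ps := sieve_primes z q.
have aps : all (fun p => prime p && (4 < p)%N) ps.
  by apply/allP => p; rewrite mem_filter mem_pr => /andP[/andP[-> _] /andP[-> _]].
have ups : uniq ps by rewrite filter_uniq // pr_uniq.
have cps : all (coprime q) ps by apply/allP => p; rewrite mem_filter => /andP[/andP[]].
have [/(_ ok) h _] := brun_bounds R N aps ups r k q0 cps.
apply: le_trans h _; apply: lerD.
  apply: ler_wpM2l; first by rewrite divr_ge0.
  have := brunV_close R k aps; rewrite ler_norml => /andP[_].
  rewrite lerBlDl => h; apply: le_trans h _; apply: lerD.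
    rewrite mulr_sumr expR_sum !big_seq; apply: ler_prod => p hp.
    have /andP[pp p4] := allP aps _ hp.
    have p0 : 0 < p%:R :> R by rewrite ltr0n prime_gt0.
    rewrite subr_ge0 ler_pdivrMr // mul1r ler_nat; apply/andP; split; first by lia.
    by apply: le_trans (expR_ge1Dx _); rewrite mulNr.
  rewrite ler_wpM2l ?exprn_ge0 ?invr_ge0 //.
  apply: le_trans (prod_1D_le_exp _ _) _; first by move=> p; rewrite divr_ge0.
  rewrite ler_expR mulr_sumr [X in _ <= X](bigID (fun p => (4 < p)%N && coprime q p)) /=.
  rewrite big_filter; apply: ler_wpDr => //; apply: sumr_ge0 => p _.
  by rewrite mulr_ge0 ?invr_ge0.
have Z0 : 0 < z.+1%:R :> R by [].
(* Z = z + 1 is at least the number of sieving primes, so (1 + 3 / Z)^size is at most e^3. *)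
apply: le_trans (@brunE_le R ps k z.+1%:R _) _; first by rewrite ler1n.
rewrite mulrC ler_wpM2r ?exprn_ge0 //.
have sz : (size ps <= z.+1)%N.
  rewrite size_filter; apply: leq_trans (count_size _ _) _.
  by rewrite size_filter; apply: leq_trans (count_size _ _) _; rewrite size_iota.
apply: (@le_trans _ _ (expR (3 / z.+1%:R) ^+ size ps)).
  by apply: lerXn2r; rewrite ?nnegrE ?expR_ge0 ?addr_ge0 ?divr_ge0 // expR_ge1Dx.
rewrite -expRM_natl ler_expR mulrA ler_pdivrMr // mulrC ler_pM2l ?ltr0n // ler_nat.
exact: sz.
Qed.

(** * The multiplicative functions c_k *)

Lemma polar (R : realType) (x y : R) : exists t : R,
  x = Num.sqrt (x ^+ 2 + y ^+ 2) * cos t /\ y = Num.sqrt (x ^+ 2 + y ^+ 2) * sin t.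
Proof.
set r := Num.sqrt _; have s0 : 0 <= x ^+ 2 + y ^+ 2 by rewrite addr_ge0 ?sqr_ge0.
have r2 : r ^+ 2 = x ^+ 2 + y ^+ 2 by rewrite sqr_sqrtr.
have r0 : 0 <= r by rewrite sqrtr_ge0.
case: (eqVneq r 0) => [rz|rn].
  exists 0; move: r2; rewrite rz !mul0r expr0n /= => /esym/eqP.
  by rewrite paddr_eq0 ?sqr_ge0 // !sqrf_eq0 => /andP[/eqP -> /eqP ->].
have rp : 0 < r by rewrite lt_def rn.
have u1 : -1 <= x / r <= 1.
  have x2 : x ^+ 2 <= r ^+ 2 by rewrite r2 lerDl sqr_ge0.
  have : `|x| <= r by rewrite -(ger0_norm r0) -ler_sqr ?nnegrE ?normr_ge0 // !real_normK ?num_real.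
  rewrite ler_norml => /andP[h1 h2]; rewrite ler_pdivlMr // ler_pdivrMr //.
  by rewrite mulN1r mul1r h1 h2.
have [_ ca] := acos_def u1; have sa := sin_acos u1.
have e : Num.sqrt (1 - (x / r) ^+ 2) = `|y| / r.
  have -> : 1 - (x / r) ^+ 2 = (`|y| / r) ^+ 2.
    rewrite !expr_div_n real_normK ?num_real //.
    have -> : y ^+ 2 = r ^+ 2 - x ^+ 2 by rewrite r2; ring.
    by field.
  by rewrite sqrtr_sqr ger0_norm // divr_ge0.
case: (leP 0 y) => y0.
  exists (acos (x / r)); rewrite ca sa e ger0_norm //; split; field; exact: rn.
exists (- acos (x / r)); rewrite cosN sinN ca sa e ltr0_norm //; split; field; exact: rn.
Qed.

Lemma cos_sin_muln (R : realType) (a b : R) : cos a = cos b -> sin a = sin b ->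
  forall k, cos (a *+ k) = cos (b *+ k) /\ sin (a *+ k) = sin (b *+ k).
Proof.
move=> hc hs; elim=> [|k [h1 h2]]; first by rewrite !mulr0n.
by rewrite !mulrS !cosD !sinD hc hs h1 h2.
Qed.

Section Arg.
Variable R : realType.
Implicit Types (z w x y : gauss) (n k : nat).

Definition rho z : R := Num.sqrt (gnorm z)%:R.

Lemma gnorm_intr z : (gnorm z)%:R = z.1%:~R ^+ 2 + z.2%:~R ^+ 2 :> R.
Proof. by rewrite -!rmorphXn -rmorphD /= -gnormE pmulrn. Qed.

Lemma rho_polar z : exists t : R, z.1%:~R = rho z * cos t /\ z.2%:~R = rho z * sin t.
Proof. by have [t ht] := polar (z.1%:~R : R) z.2%:~R; exists t; rewrite /rho gnorm_intr. Qed.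

(** One of the arguments of z, fixed by choice. Only cosines and sines of its integer multiples are
    used, so the branch is immaterial ([garg_char]). *)
Definition garg z : R := sval (cid (rho_polar z)).

Lemma rho_cos z : rho z * cos (garg z) = z.1%:~R.
Proof. by rewrite /garg; case: cid => t [/= -> _]. Qed.
Lemma rho_sin z : rho z * sin (garg z) = z.2%:~R.
Proof. by rewrite /garg; case: cid => t [/= _ ->]. Qed.
Lemma rho_ge0 z : 0 <= rho z. Proof. exact: sqrtr_ge0. Qed.
Lemma rho_sq z : rho z ^+ 2 = (gnorm z)%:R. Proof. by rewrite sqr_sqrtr. Qed.
Lemma rhoM z w : rho (gmul z w) = rho z * rho w.
Proof. by rewrite /rho gnormM natrM sqrtrM. Qed.
Lemma rho_gt0 z : (0 < gnorm z)%N -> 0 < rho z.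
Proof. by move=> h; rewrite sqrtr_gt0 ltr0n. Qed.

Lemma garg_char z t k : (0 < gnorm z)%N -> rho z * cos t = z.1%:~R -> rho z * sin t = z.2%:~R ->
  cos (garg z *+ k) = cos (t *+ k) /\ sin (garg z *+ k) = sin (t *+ k).
Proof.
move=> /rho_gt0 n0 hc hs; apply: cos_sin_muln; apply: (mulfI (lt0r_neq0 n0)).
  by rewrite rho_cos hc.
by rewrite rho_sin hs.
Qed.

Lemma gargM z w k : (0 < gnorm z)%N -> (0 < gnorm w)%N ->
  cos (garg (gmul z w) *+ k) = cos ((garg z + garg w) *+ k) /\
  sin (garg (gmul z w) *+ k) = sin ((garg z + garg w) *+ k).
Proof.
move=> z0 w0; apply: garg_char; first by rewrite gnormM muln_gt0 z0.
  rewrite rhoM cosD /gmul /= rmorphB !rmorphM /= -!rho_cos -!rho_sin; ring.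
rewrite rhoM sinD /gmul /= rmorphD !rmorphM /= -!rho_cos -!rho_sin; ring.
Qed.

Lemma garg_conj z k : (0 < gnorm z)%N ->
  cos (garg (gconj z) *+ k) = cos (garg z *+ k) /\ sin (garg (gconj z) *+ k) = - sin (garg z *+ k).
Proof.
move=> z0; have e : rho (gconj z) = rho z by rewrite /rho gnorm_conj.
have [|||-> ->] := @garg_char (gconj z) (- garg z) k.
- by rewrite gnorm_conj.
- by rewrite e cosN rho_cos.
- by rewrite e sinN mulrN rho_sin /= rmorphN.
by rewrite mulNrn cosN sinN.
Qed.

Lemma garg_opp z k : (0 < gnorm z)%N ->
  cos (garg (gopp z) *+ k) = (-1) ^+ k * cos (garg z *+ k) /\
  sin (garg (gopp z) *+ k) = (-1) ^+ k * sin (garg z *+ k).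
Proof.
move=> z0; have e : rho (gopp z) = rho z by rewrite /rho gnorm_opp.
have [|||-> ->] := @garg_char (gopp z) (garg z + pi) k.
- by rewrite gnorm_opp.
- by rewrite e cosDpi mulrN rho_cos /= rmorphN.
- by rewrite e sinDpi mulrN rho_sin /= rmorphN.
move: (cosDpi (garg z)) (sinDpi (garg z)); move: (garg z + pi) => t ct st.
elim: k => [|k [h1 h2]]; first by rewrite !mulr0n expr0 !mul1r cos0.
by rewrite !mulrS !cosD !sinD h1 h2 exprS ct st; split; ring.
Qed.

Definition cc k n : R := 2^-1 * \sum_(z <- gset n) cos (garg z *+ k.*2).

Lemma gset_gt0 n z : z \in gset n -> (0 < gnorm z)%N.
Proof.
rewrite mem_gset => /andP[/andP[oz _] _]; rewrite lt0n gnorm_eq0.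
by apply/eqP => e; rewrite e in oz.
Qed.

Lemma sum_sin_gset k n : \sum_(z <- gset n) sin (garg z *+ k) = 0.
Proof.
have : \sum_(z <- gset n) sin (garg (gconj z) *+ k) = - \sum_(z <- gset n) sin (garg z *+ k).
  rewrite -sumrN !big_seq; apply: eq_bigr => z /gset_gt0 z0.
  by rewrite (garg_conj k z0).2.
by rewrite (big_gset_conj n (fun z => sin (garg z *+ k))) => h; lra.
Qed.

Lemma sum_cos_gset_odd k n : odd k -> \sum_(z <- gset n) cos (garg z *+ k) = 0.
Proof.
move=> ok; have : \sum_(z <- gset n) cos (garg (gopp z) *+ k) = - \sum_(z <- gset n) cos (garg z *+ k).
  rewrite -sumrN !big_seq; apply: eq_bigr => z /gset_gt0 z0.
  by rewrite (garg_opp k z0).1 -signr_odd ok expr1 mulN1r.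
by rewrite (big_gset_opp n (fun z => cos (garg z *+ k))) => h; lra.
Qed.

Lemma cc1 k : cc k 1 = 1.
Proof.
rewrite /cc (perm_big _ gset1) /= !big_cons big_nil addr0.
have -> : gint (-1) = gopp (gint 1) by [].
rewrite (garg_opp _ _).1 // -signr_odd odd_double expr0 mul1r.
have r1 : rho (gint 1) = 1 by rewrite /rho gnorm_int sqrtr1.
have [|||-> _] := @garg_char (gint 1) 0 k.*2 => //.
- by rewrite r1 cos0 mulr1.
- by rewrite sin0 mulr0.
by rewrite mul0rn cos0; lra.
Qed.

Lemma cc_even k n : ~~ odd n -> cc k n = 0.
Proof. by move=> h; rewrite /cc gset_even // big_nil mulr0. Qed.

(** The addition formula applied to [big_gsetM]: the sine sums vanish by conjugation, and the
    multiplicity 2 is absorbed by the factor 1/2 in [cc]. *)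
Lemma cc_multf k : multf (cc k).
Proof.
split; first exact: cc1.
move=> a b cab a0 b0.
case: (boolP (odd a)) => oa; last by rewrite (cc_even k oa) mul0r cc_even // oddM negb_and oa.
case: (boolP (odd b)) => ob; last by rewrite (cc_even k ob) mulr0 cc_even // oddM negb_and ob orbT.
have := @big_gsetM R a b (fun z => cos (garg z *+ k.*2)) cab oa ob.
have -> : \sum_(x <- gset a) \sum_(y <- gset b) cos (garg (gmul x y) *+ k.*2) =
    \sum_(x <- gset a) (cos (garg x *+ k.*2) * \sum_(y <- gset b) cos (garg y *+ k.*2)
        - sin (garg x *+ k.*2) * \sum_(y <- gset b) sin (garg y *+ k.*2)).
  rewrite !big_seq; apply: eq_bigr => x /gset_gt0 x0.
  rewrite !mulr_sumr -sumrB !big_seq; apply: eq_bigr => y /gset_gt0 y0.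
  by rewrite (gargM _ x0 y0).1 mulrnDl cosD.
rewrite sum_sin_gset; under eq_bigr do rewrite mulr0 subr0.
rewrite -mulr_suml sumrMnl /cc => h.
set A := \sum_(x <- gset a) _ in h *; set B := \sum_(y <- gset b) _ in h *.
set C := \sum_(z <- gset (a * b)) _ in h *.
have -> : C = 2^-1 * (A * B) by rewrite h -[C *+ 2]mulr_natl; field.
by field.
Qed.

Lemma cc0E n : cc 0 n = (size (gset n))%:R / 2.
Proof.
rewrite /cc; under eq_bigr do rewrite mulr0n cos0.
by rewrite big_const_seq count_predT iter_addr addr0 mulrC.
Qed.
Lemma cc0_ge0 n : 0 <= cc 0 n. Proof. by rewrite cc0E divr_ge0. Qed.

Lemma cc_le_cc0 k n : `|cc k n| <= cc 0 n.
Proof.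
rewrite /cc normrM ger0_norm // ler_wpM2l //.
apply: le_trans (ler_norm_sum _ _ _) _; apply: ler_sum => z _.
by rewrite mulr0n cos0 ler_norml cos_le1 cos_geN1.
Qed.

(* From (|cos t| - 1)^2 >= 0. *)
Lemma cc_le_mix k n : `|cc k n| <= 3 / 4 * cc 0 n + 1 / 4 * cc k.*2 n.
Proof.
have -> : 3 / 4 * cc 0 n + 1 / 4 * cc k.*2 n =
    2^-1 * \sum_(z <- gset n) (3 / 4 * cos (garg z *+ 0.*2) + 1 / 4 * cos (garg z *+ k.*2.*2)).
  by rewrite /cc big_split /= -!mulr_sumr; ring.
rewrite /cc normrM ger0_norm // ler_wpM2l //.
apply: le_trans (ler_norm_sum _ _ _) _; apply: ler_sum => z _.
rewrite mulr0n cos0; have := cos2Dsin2 (garg z *+ k.*2).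
have -> : k.*2.*2 = (k.*2 + k.*2)%N by rewrite addnn.
rewrite mulrnDr cosD; set c := cos _; set s := sin _ => h.
have := sqr_ge0 (`|c| - 1); rewrite sqrrB1 real_normK ?num_real //.
have : s * s = 1 - c ^+ 2 by rewrite -h; ring.
by rewrite -!expr2 => ->; move: (c ^+ 2) => c2; rewrite mulr2n; lra.
Qed.

Lemma cc0_pow p j : prime p -> cc 0 (p ^ j)%N <= j.+1%:R.
Proof.
by move=> pp; rewrite cc0E ler_pdivrMr // -natrM ler_nat mulnC size_gset_pow.
Qed.

Lemma cc_mod4 k n : (n %% 4 != 1)%N -> cc k n = 0.
Proof. by move=> h; rewrite /cc gset_mod4 // big_nil mulr0. Qed.
End Arg.

(** * Dirichlet series of c_k *)

(** The power n^(-s) for n > 0; at n = 0 the convention ln 0 = 0 makes it 1. *)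
Definition nw (R : realType) (s : R) (n : nat) : R := expR (- s * ln n%:R).

Lemma nw_gt0 (R : realType) (s : R) n : 0 < nw s n. Proof. exact: expR_gt0. Qed.
Lemma nw_ge0 (R : realType) (s : R) n : 0 <= nw s n. Proof. exact: expR_ge0. Qed.
Lemma nw1 (R : realType) (s : R) : nw s 1 = 1. Proof. by rewrite /nw ln1 mulr0 expR0. Qed.
Lemma nwM (R : realType) (s : R) a b : (0 < a)%N -> (0 < b)%N -> nw s (a * b) = nw s a * nw s b.
Proof. by move=> a0 b0; rewrite /nw natrM lnM ?posrE ?ltr0n // mulrDr expRD. Qed.
Lemma nwX (R : realType) (s : R) a j : (0 < a)%N -> nw s (a ^ j) = nw s a ^+ j.
Proof.
move=> a0; elim: j => [|j IH]; first by rewrite expn0 nw1.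
by rewrite expnS nwM ?expn_gt0 ?a0 // IH exprS.
Qed.
Lemma nwD (R : realType) (s t : R) n : nw (s + t) n = nw s n * nw t n.
Proof. by rewrite /nw -expRD; congr expR; ring. Qed.
Lemma nw1E (R : realType) n : (0 < n)%N -> nw 1 n = n%:R^-1 :> R.
Proof. by move=> n0; rewrite /nw mulN1r expRN lnK ?posrE ?ltr0n. Qed.
Lemma nw_multf (R : realType) (s : R) : multf (nw s).
Proof. by split=> [|a b _ a0 b0]; rewrite ?nw1 ?nwM. Qed.
Lemma nw_le (R : realType) (s t : R) n : s <= t -> nw t n <= nw s n.
Proof.
move=> st; rewrite ler_expR; case: n => [|n]; first by rewrite ln0 // !mulr0.
by rewrite ler_wpM2r ?lerN2 // ln_ge0 // ler1n.
Qed.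
Lemma nw_anti (R : realType) (s : R) m n : 0 <= s -> (0 < m)%N -> (m <= n)%N -> nw s n <= nw s m.
Proof.
move=> s0 m0 mn; rewrite ler_expR ler_wnM2l ?oppr_le0 // ler_ln ?posrE ?ltr0n ?ler_nat //.
exact: leq_trans mn.
Qed.

(** Integral comparison in telescoped form: n^(-1-t) is at most ((n - 1)^(-t) - n^(-t)) / t, because
    ln n - ln (n - 1) >= 1 / n. *)
Lemma zeta_partial (R : realType) (t : R) M : 0 < t ->
  \sum_(1 <= m < M.+1) nw (1 + t) m <= 1 + t^-1.
Proof.
move=> t0; suff h n : \sum_(1 <= m < n.+2) nw (1 + t) m <= 1 + (1 - nw t n.+1) / t.
  case: M => [|M]; first by rewrite big_geq // addr_ge0 // invr_ge0 ltW.
  apply: le_trans (h M) _; rewrite lerD2l ler_pdivrMr // mulVf ?gt_eqF //.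
  by rewrite lerBlDr lerDl nw_ge0.
elim: n => [|n IH]; first by rewrite big_nat1 !nw1 subrr mul0r addr0.
rewrite big_nat_recr //=; apply: le_trans (lerD IH (lexx _)) _.
rewrite nwD nw1E // -addrA lerD2l -lerBrDl -mulrBl ler_pdivlMr //.
have -> : 1 - nw t n.+2 - (1 - nw t n.+1) = nw t n.+1 - nw t n.+2 by ring.
have e : nw t n.+1 = nw t n.+2 * expR (t * (ln n.+2%:R - ln n.+1%:R)).
  by rewrite /nw -expRD; congr expR; ring.
rewrite e -[X in _ <= _ - X]mulr1 -mulrBr mulrAC [X in X <= _]mulrC.
have le1 : n.+2%:R^-1 <= ln n.+2%:R - ln n.+1%:R :> R.
  rewrite -[X in _ <= X]opprB lerNr -ln_div ?posrE //.
  have -> : n.+1%:R / n.+2%:R = 1 + - n.+2%:R^-1 :> R.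
    rewrite -[n.+2]addn1 natrD; have a0 : 0 < n.+1%:R :> R by [].
    by move: (n.+1%:R : R) a0 => a a0; field; rewrite gt_eqF //; lra.
  by apply: le_ln1Dx; rewrite ltrN2 invf_lt1 ?ltr1n.
rewrite ler_pM2l ?nw_gt0 // lerBrDl; apply: le_trans (expR_ge1Dx _).
by rewrite lerD2l mulrC ler_pM2l.
Qed.

(** * Lattice sums over Gaussian integers of odd type *)

Section Disc.
Variable R : realType.
Implicit Types (z w x y : gauss) (n k M X : nat).

Definition disc X : seq gauss :=
  [seq z <- [seq (u, v) | u : int <- zbox X, v : int <- zbox X] | godd z && (gnorm z <= X)%N].

Lemma disc_uniq X : uniq (disc X).
Proof.
by apply: filter_uniq; apply: allpairs_uniq; rewrite ?zbox_uniq // => -[? ?] [? ?].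
Qed.

Lemma mem_disc X z : (z \in disc X) = godd z && (gnorm z <= X)%N.
Proof.
rewrite mem_filter andb_idr // => /andP[_ nz]; case: z nz => a b nz.
by apply/allpairsP; exists (a, b); rewrite /= !mem_zbox; move: nz; rewrite /gnorm /=; split=> //; nia.
Qed.

Lemma big_disc (F : gauss -> R) X :
  \sum_(z <- disc X) F z = \sum_(0 <= n < X.+1) \sum_(z <- gset n) F z.
Proof.
transitivity (\sum_(z <- disc X) \sum_(0 <= n < X.+1 | n == gnorm z) F z).
  rewrite !big_seq; apply: eq_bigr => z; rewrite mem_disc => /andP[_ hz].
  by rewrite big_nat1_eq /= ltnS hz.
rewrite (exchange_big_dep xpredT) //=; apply: eq_big_nat => n /andP[_ hn].
rewrite -big_filter; apply/perm_big/uniq_perm.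
- by apply: filter_uniq; exact: disc_uniq.
- exact: gset_uniq.
move=> z; rewrite mem_filter mem_disc mem_gset eq_sym.
by case: eqVneq => [->|]; rewrite ?andbF // andbT /=; rewrite -ltnS hn andbT.
Qed.

Lemma size_zbox n : size (zbox n) = n.*2.+1.
Proof. by rewrite size_map size_iota. Qed.

Lemma count_zbox k M : (count (fun m : int => `|m| <= k)%N (zbox M) <= k.*2.+1)%N.
Proof.
rewrite -size_filter -size_zbox; apply: uniq_leq_size.
  by apply: filter_uniq; exact: zbox_uniq.
by move=> m; rewrite mem_filter !mem_zbox => /andP[].
Qed.

Lemma big_zbox (f : nat -> R) M :
  \sum_(a <- zbox M | a != 0) f `|a|%N = 2 * \sum_(1 <= m < M.+1) f m.
Proof.
elim: M => [|M IH]; first by rewrite big_geq // mulr0 /zbox /= big_cons big_nil.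
have -> : \sum_(a <- zbox M.+1 | a != 0) f `|a|%N =
   \sum_(a <- [:: M.+1%:Z, - M.+1%:Z & zbox M] | a != 0) f `|a|%N.
  apply/perm_big/uniq_perm; first exact: zbox_uniq.
    rewrite cons_uniq cons_uniq zbox_uniq inE !mem_zbox; lia.
  by move=> a; rewrite mem_zbox in_cons in_cons mem_zbox; lia.
rewrite big_cons big_cons IH [in RHS]big_nat_recr //=; ring.
Qed.

(** With m the larger of |u| and |v|, the norm is at least m^2. For each of the two coordinates and
    each sign there are at most 2 m + 1 <= 3 m points, so the sum is at most 4 * 3 times the sum of
    m^(1 - 2 s), and 2 s - 1 = 1 + 2 (s - 1). *)
Lemma lattice_sum (s : R) M : 1 < s ->
  \sum_(z <- disc (M ^ 2)) nw s (gnorm z) <= 12 * (1 + (2 * (s - 1))^-1).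
Proof.
move=> s1; have s0 : 0 <= s by lra.
pose box := [seq (u, v) | u : int <- zbox M, v : int <- zbox M].
pose F (m : nat) : R := nw (2 * s) m.
pose G (u v : int) : R := (if (u != 0) && (`|v| <= `|u|)%N then F `|u|%N else 0)
                      + (if (v != 0) && (`|u| <= `|v|)%N then F `|v|%N else 0).
have F0 m : 0 <= F m by exact: nw_ge0.
have G0 u v : 0 <= G u v by rewrite addr_ge0 //; case: ifP.
have Fsq m : (0 < m)%N -> nw s (m ^ 2) = F m.
  by move=> m0; rewrite nwX // expr2 -nwD /F mulr_natl mulr2n.
apply: (@le_trans _ _ (\sum_(z <- disc (M ^ 2)) G z.1 z.2)).
  rewrite !big_seq; apply: ler_sum => -[u v]; rewrite mem_disc => /andP[/andP[ou _] _] /=.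
  have u0 : u != 0 by apply: contraTneq ou => /= ->.
  rewrite /G u0 /=; case: (leqP `|v| `|u|) => h.
    apply: ler_wpDr; first by case: ifP.
    rewrite -Fsq; last by lia.
    by apply: nw_anti => //; rewrite ?expn_gt0 /gnorm /= ?leq_addr //; lia.
  have v0 : v != 0 by lia.
  rewrite v0 (ltnW h) /= add0r -Fsq; last by lia.
  by apply: nw_anti => //; rewrite ?expn_gt0 /gnorm /= ?leq_addl //; lia.
apply: (@le_trans _ _ (\sum_(z <- box) G z.1 z.2)).
  rewrite [X in _ <= X](bigID (fun z => z \in disc (M ^ 2))) /= -[X in _ <= X + _]big_filter.
  apply: ler_wpDr; first exact: sumr_ge0.
  rewrite le_eqVlt; apply/orP; left; apply/eqP/perm_big/uniq_perm.
  - exact: disc_uniq.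
  - by rewrite filter_uniq //; apply: allpairs_uniq; rewrite ?zbox_uniq // => -[? ?] [? ?].
  move=> -[u v]; rewrite [RHS]mem_filter andb_idr // mem_disc => /andP[_ hn].
  apply/allpairsP; exists (u, v); rewrite /= !mem_zbox; move: hn; rewrite /gnorm /= => hn.
  have hu : (`|u| ^ 2 <= M ^ 2)%N by apply: leq_trans hn; rewrite leq_addr.
  have hv : (`|v| ^ 2 <= M ^ 2)%N by apply: leq_trans hn; rewrite leq_addl.
  by split=> //; rewrite -leq_sqr.
rewrite big_allpairs /= /G.
pose Q := \sum_(u <- zbox M | u != 0) (`|u|.*2.+1)%:R * F `|u|%N.
have half : \sum_(u <- zbox M) \sum_(v <- zbox M) (if (u != 0) && (`|v| <= `|u|)%N then F `|u|%N else 0) <= Q.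
  rewrite /Q [X in _ <= X]big_mkcond; apply: ler_sum => u _; case: eqVneq => [_|u0] /=.
    by rewrite big1.
  rewrite -big_mkcond big_const_seq iter_addr addr0 -[X in X <= _]mulr_natl ler_wpM2r // ler_nat.
  exact: count_zbox.
have -> : \sum_(x <- zbox M) \sum_(y <- zbox M)
   ((if (x != 0) && (`|y| <= `|x|)%N then F `|x|%N else 0) +
    (if (y != 0) && (`|x| <= `|y|)%N then F `|y|%N else 0)) =
   \sum_(u <- zbox M) \sum_(v <- zbox M) (if (u != 0) && (`|v| <= `|u|)%N then F `|u|%N else 0) +
   \sum_(u <- zbox M) \sum_(v <- zbox M) (if (u != 0) && (`|v| <= `|u|)%N then F `|u|%N else 0).
  rewrite [in X in _ = _ + X]exchange_big /= -big_split /=; apply: eq_bigr => u _.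
  by rewrite -big_split.
apply: le_trans (lerD half half) _.
rewrite /Q (big_zbox (fun m => (m.*2.+1)%:R * F m)).
have := @zeta_partial R (2 * (s - 1)) M.
suff : \sum_(1 <= m < M.+1) (m.*2.+1)%:R * F m <= 3 * \sum_(1 <= m < M.+1) nw (1 + 2 * (s - 1)) m.
  move: (\sum_(_ <= _ < _) _) (\sum_(_ <= _ < _) _) => S T h1 h2; have : 0 < 2 * (s - 1) by lra.
  by move/h2 => h3; lra.
rewrite mulr_sumr !big_nat; apply: ler_sum => m /andP[m0 _].
have -> : F m = m%:R^-1 * nw (1 + 2 * (s - 1)) m by rewrite -nw1E // -nwD /F; have -> : 2 * s = 1 + (1 + 2 * (s - 1)) by ring.
rewrite mulrA ler_wpM2r ?nw_ge0 // ler_pdivrMr ?ltr0n // -natrM ler_nat; lia.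
Qed.
End Disc.

(** The inequality |z^k - w^k| <= k |z - w| for complex numbers of modulus 1, in real
    coordinates. *)
Lemma sin_muln_lip (R : realType) (a b : R) k :
  `|cos (a *+ k) - cos (b *+ k)| <= k%:R * (`|cos a - cos b| + `|sin a - sin b|) /\
  `|sin (a *+ k) - sin (b *+ k)| <= k%:R * (`|cos a - cos b| + `|sin a - sin b|).
Proof.
suff : exists e : R * R, [/\ cos (a *+ k) - cos (b *+ k) = e.1, sin (a *+ k) - sin (b *+ k) = e.2 &
    e.1 ^+ 2 + e.2 ^+ 2 <= (k%:R * (`|cos a - cos b| + `|sin a - sin b|)) ^+ 2].
  move=> [[u v] /= [-> ->]]; set D := `|_| + _ => h.
  have D0 : 0 <= k%:R * D by rewrite mulr_ge0 ?addr_ge0.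
  have l (x y : R) : x ^+ 2 + y ^+ 2 <= (k%:R * D) ^+ 2 -> `|x| <= k%:R * D.
    move=> hxy.
    rewrite -ler_sqr ?nnegrE // real_normK ?num_real //; apply: le_trans hxy.
    by rewrite lerDl sqr_ge0.
  by split; [apply: (l u v) | apply: (l v u); rewrite addrC].
exists (cos (a *+ k) - cos (b *+ k), sin (a *+ k) - sin (b *+ k)); split=> //=.
set D := `|_| + _; have D0 : 0 <= D by rewrite addr_ge0.
have hD : (cos a - cos b) ^+ 2 + (sin a - sin b) ^+ 2 <= D ^+ 2.
  rewrite -[X in X + _]real_normK ?num_real // -[X in _ + X]real_normK ?num_real // /D sqrrD.
  by rewrite lerD2r lerDl mulrn_wge0 // mulr_ge0.
elim: k => [|k IH]; first by rewrite !mulr0n !subrr mul0r expr0n /= addr0.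
rewrite !mulrS !cosD !sinD mulrDl mul1r.
have ha := cos2Dsin2 a; have hb := cos2Dsin2 (b *+ k).
move: IH hb; set ck := cos (a *+ k); set sk := sin (a *+ k); set ck' := cos (b *+ k); set sk' := sin (b *+ k).
move: hD ha; set c := cos a; set s := sin a; set c' := cos b; set s' := sin b => hD ha IH hb.
(* z^(k+1) - w^(k+1) = z (z^k - w^k) + (z - w) w^k: (X, Y) is the first term and (U, W) the second,
   and the cross term is bounded by Cauchy-Schwarz. *)
pose X := c * (ck - ck') - s * (sk - sk'); pose Y := c * (sk - sk') + s * (ck - ck').
pose U := (c - c') * ck' - (s - s') * sk'; pose W := (c - c') * sk' + (s - s') * ck'.
have -> : c * ck - s * sk - (c' * ck' - s' * sk') = X + U by rewrite /X /U; ring.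
have -> : s * ck + c * sk - (s' * ck' + c' * sk') = Y + W by rewrite /Y /W; ring.
have hXY : X ^+ 2 + Y ^+ 2 <= (k%:R * D) ^+ 2.
  have -> : X ^+ 2 + Y ^+ 2 = (c ^+ 2 + s ^+ 2) * ((ck - ck') ^+ 2 + (sk - sk') ^+ 2) by rewrite /X /Y; ring.
  by rewrite ha mul1r.
have hUW : U ^+ 2 + W ^+ 2 <= D ^+ 2.
  have -> : U ^+ 2 + W ^+ 2 = (ck' ^+ 2 + sk' ^+ 2) * ((c - c') ^+ 2 + (s - s') ^+ 2) by rewrite /U /W; ring.
  by rewrite hb mul1r.
have kD0 : 0 <= k%:R * D by rewrite mulr_ge0.
have cs : X * U + Y * W <= k%:R * D * D.
  rewrite -(ger0_norm (mulr_ge0 kD0 D0)); apply: le_trans (ler_norm _) _.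
  rewrite -ler_sqr ?nnegrE // !real_normK ?num_real // [X in _ <= X]exprMn.
  apply: (@le_trans _ _ ((X ^+ 2 + Y ^+ 2) * (U ^+ 2 + W ^+ 2))); last first.
    by apply: ler_pM; rewrite ?addr_ge0 ?sqr_ge0.
  rewrite -subr_ge0; have -> : (X ^+ 2 + Y ^+ 2) * (U ^+ 2 + W ^+ 2) - (X * U + Y * W) ^+ 2 = (X * W - Y * U) ^+ 2 by ring.
  exact: sqr_ge0.
have -> : (X + U) ^+ 2 + (Y + W) ^+ 2 = (X ^+ 2 + Y ^+ 2) + (U ^+ 2 + W ^+ 2) + 2 * (X * U + Y * W) by ring.
have -> : (D + k%:R * D) ^+ 2 = (k%:R * D) ^+ 2 + D ^+ 2 + 2 * (k%:R * D * D) by ring.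
lra.
Qed.

(* Modulo 5 the powers of 1+2i are non-zero multiples of 1+2i. *)
Lemma sin_arg_1D2i (R : realType) k : sin (garg R (1, 2) *+ k.+1) != 0.
Proof.
set t := garg R (1, 2); set r := rho R (1, 2).
have rc : r * cos t = 1 by rewrite rho_cos.
have rs : r * sin t = 2 by rewrite rho_sin.
have [u [v [_ hv [u5 v5]]]] : exists u v : int, [/\ r ^+ k.+1 * cos (t *+ k.+1) = u%:~R,
    r ^+ k.+1 * sin (t *+ k.+1) = v%:~R & (u = 2 ^+ k %[mod 5])%Z /\ (v = 2 ^+ k.+1 %[mod 5])%Z].
  elim: k => [|k [u [v [hu hv [u5 v5]]]]].
    by exists 1, 2; rewrite !mulr1n !expr1 rc rs.
  exists (u - 2 * v), (2 * u + v); split.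
  - rewrite mulrS cosD exprS rmorphB rmorphM /= -hu -hv.
    have -> : r * r ^+ k.+1 * (cos t * cos (t *+ k.+1) - sin t * sin (t *+ k.+1)) =
      (r * cos t) * (r ^+ k.+1 * cos (t *+ k.+1)) - (r * sin t) * (r ^+ k.+1 * sin (t *+ k.+1)) by ring.
    by rewrite rc rs mul1r.
  - rewrite mulrS sinD exprS rmorphD rmorphM /= -hu -hv.
    have -> : r * r ^+ k.+1 * (sin t * cos (t *+ k.+1) + cos t * sin (t *+ k.+1)) =
      (r * sin t) * (r ^+ k.+1 * cos (t *+ k.+1)) + (r * cos t) * (r ^+ k.+1 * sin (t *+ k.+1)) by ring.
    by rewrite rc rs mul1r.
  by move: u5 v5; rewrite !exprS; lia.
have v0 : v != 0.
  apply/eqP => vz; move: v5; rewrite vz => h.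
  have : (5%:Z %| 2 ^+ k.+1)%Z by apply/dvdz_mod0P; rewrite -h mod0z.
  by rewrite dvdzE abszX /= Euclid_dvdX.
apply: contra_neq v0 => sz; move: hv; rewrite sz mulr0 => /esym/eqP.
by rewrite intr_eq0 => /eqP.
Qed.

(** * Bounded Dirichlet series from the residue classes modulo 1 + 2i *)

Section LBound.
Variable R : realType.
Implicit Types (z w x y : gauss) (n k M X : nat) (s : R).

Definition twist s k z : R := sin (garg R z *+ k) * nw s (gnorm z).

Lemma rho_nw z : (0 < gnorm z)%N -> (rho R z)^-1 = nw (1 / 2) (gnorm z).
Proof.
move=> z0; have r0 := rho_gt0 R z0.
rewrite /nw -rho_sq lnXn //; have -> : - (1 / 2) * (ln (rho R z) *+ 2) = - ln (rho R z) by field.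
by rewrite expRN lnK ?posrE.
Qed.

Lemma abs_fst_le_rho z : `|z.1%:~R| <= rho R z.
Proof.
rewrite -(ger0_norm (rho_ge0 R z)) -ler_sqr ?nnegrE // !real_normK ?num_real //.
by rewrite rho_sq gnorm_intr lerDl sqr_ge0.
Qed.

(** A horizontal move of length at most 4 changes direction and modulus of z by a relative amount
    O(1 / |z|), so a twist of size N(z)^(-s) moves by O(N(z)^(-3/2)), uniformly in s. The large
    constant is hidden in the lower bound on A. *)
Lemma twist_near (A : R) s k z w : 0 <= A -> 625 * 624 <= A -> (0 < gnorm z)%N -> (0 < gnorm w)%N -> 1 < s -> s <= 2 ->
  z.2 = w.2 -> `|w.1 - z.1| <= 4 ->
  `|twist s k z - twist s k w| <= (12 * k%:R + A) * nw (3 / 2) (gnorm z).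
Proof.
move=> A0 hA z0 w0 s1 s2 e2 e1.
have r0 := rho_gt0 R z0; have r'0 := rho_gt0 R w0.
have r1 : 1 <= rho R z by rewrite -sqrtr1 ler_wsqrtr // ler1n.
have r'1 : 1 <= rho R w by rewrite -sqrtr1 ler_wsqrtr // ler1n.
have hcz := rho_cos R z; have hsz := rho_sin R z; have hcw := rho_cos R w; have hsw := rho_sin R w.
have az := abs_fst_le_rho z; have aw := abs_fst_le_rho w.
have d4 : `|w.1%:~R - z.1%:~R| <= 4 :> R by rewrite -rmorphB /= -intr_norm -[4]/(4%:~R) ler_int.
have Nz := rho_sq R z; have Nw := rho_sq R w.
have nz := gnorm_intr R z; have nw' := gnorm_intr R w.
have dr : `|rho R w - rho R z| <= 4.
  have s0 : 0 < rho R w + rho R z by lra.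
  rewrite -(ler_pM2r s0) -{1}(gtr0_norm s0) -normrM -subr_sqr Nz Nw nz nw' e2.
  have -> : w.1%:~R ^+ 2 + w.2%:~R ^+ 2 - (z.1%:~R ^+ 2 + w.2%:~R ^+ 2) =
     (w.1%:~R - z.1%:~R) * (w.1%:~R + z.1%:~R) :> R by ring.
  rewrite normrM; apply: ler_pM => //; apply: le_trans (ler_normD _ _) _; exact: lerD.
have hc : `|cos (garg R z) - cos (garg R w)| <= 8 / rho R z.
  rewrite ler_pdivlMr // -{1}(gtr0_norm r0) -normrM mulrBl.
  have -> : cos (garg R z) * rho R z - cos (garg R w) * rho R z =
    - (w.1%:~R - z.1%:~R) + (rho R w - rho R z) * cos (garg R w) by rewrite -hcz -hcw; ring.
  apply: le_trans (ler_normD _ _) _; rewrite normrN normrM.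
  have : `|rho R w - rho R z| * `|cos (garg R w)| <= 4 * 1.
    by apply: ler_pM => //; rewrite ler_norml cos_le1 cos_geN1.
  by move: d4; lra.
have hs : `|sin (garg R z) - sin (garg R w)| <= 4 / rho R z.
  rewrite ler_pdivlMr // -{1}(gtr0_norm r0) -normrM mulrBl.
  have -> : sin (garg R z) * rho R z - sin (garg R w) * rho R z =
    (rho R w - rho R z) * sin (garg R w).
    by rewrite [sin (garg R z) * _]mulrC hsz e2 -hsw; ring.
  rewrite normrM -[4]mulr1.
  by apply: ler_pM => //; rewrite ler_norml sin_le1 sin_geN1.
have [_ hK] := sin_muln_lip (garg R z) (garg R w) k.
set r := rho R z in r0 r1 hcz hsz az Nz dr hc hs *; set r' := rho R w in r'0 r'1 hcw hsw aw Nw dr *.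
have rr' : r' <= 5 * r by move: dr; rewrite ler_norml => /andP[]; lra.
have r'r : r <= 5 * r' by move: dr; rewrite ler_norml => /andP[]; lra.
have lnN : ln (gnorm z)%:R = ln r *+ 2 by rewrite -Nz lnXn.
have lnN' : ln (gnorm w)%:R = ln r' *+ 2 by rewrite -Nw lnXn.
(* As 2 s <= 4, the ratio of the norms to the power s is controlled by (r' / r)^4. Since r and r'
   differ by at most 4 and are at least 1, each is at most 5 times the other: this gives 625 = 5^4
   and |(r' / r)^4 - 1| <= 4 * 6 * 26 / r = 624 / r. *)
have hu : `|nw s (gnorm z) - nw s (gnorm w)| <= A * (nw s (gnorm z) / r).
  pose t := ln r' - ln r.
  have eu : nw s (gnorm w) = nw s (gnorm z) * expR (- s * (t *+ 2)).
    by rewrite /nw lnN lnN' -expRD /t; congr expR; ring.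
  have eu' : nw s (gnorm z) = nw s (gnorm w) * expR (s * (t *+ 2)).
    by rewrite /nw lnN lnN' -expRD /t; congr expR; ring.
  have et : expR t = r' / r by rewrite /t expRD expRN !lnK ?posrE.
  have h625 : nw s (gnorm w) <= 625 * nw s (gnorm z).
    rewrite eu mulrC ler_wpM2r ?nw_ge0 //.
    have t5 : - t <= ln 5.
      by rewrite -ler_expR expRN et lnK ?posrE // invf_div ler_pdivrMr.
    have -> : 625 = expR (4 * ln 5) :> R by rewrite expRM_natl lnK ?posrE //; ring.
    rewrite ler_expR -mulr_natl; have : 0 <= ln 5 :> R by rewrite ln_ge0 // ler1n.
    case: (leP 0 t) => t0 l0; nra.
  have habs : `|expR (s * (t *+ 2)) - 1| <= `|expR t ^+ 4 - 1|.
    rewrite -expRM_natl; case: (leP 0 t) => t0.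
      have a1 : 1 <= expR (s * (t *+ 2)) by rewrite -expR0 ler_expR mulr_ge0 ?mulrn_wge0 //; lra.
      have a2 : expR (s * (t *+ 2)) <= expR (4 * t) by rewrite ler_expR -mulr_natl; nra.
      by rewrite !ger0_norm ?subr_ge0 ?lerD2r //; apply: le_trans a2.
    have a1 : expR (s * (t *+ 2)) <= 1 by rewrite -expR0 ler_expR -mulr_natl; nra.
    have a2 : expR (4 * t) <= expR (s * (t *+ 2)) by rewrite ler_expR -mulr_natl; nra.
    rewrite ![`|_ - 1|]distrC !ger0_norm ?subr_ge0 ?lerD2l ?lerN2 //; exact: le_trans a1.
  have h4 : `|expR t ^+ 4 - 1| <= 624 / r.
    rewrite et ler_pdivlMr //.
    have -> : (r' / r) ^+ 4 - 1 = (r' - r) * ((r' + r) * (r' ^+ 2 + r ^+ 2)) / r ^+ 4 by field; rewrite gt_eqF.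
    rewrite normrM normrM normfV [`|r ^+ 4|]ger0_norm ?exprn_ge0 ?(ltW r0) //.
    rewrite [`|(r' + r) * _|]ger0_norm; last first.
      by rewrite mulr_ge0 ?addr_ge0 ?sqr_ge0 // ltW.
    have b1 : (r' + r) * (r' ^+ 2 + r ^+ 2) <= (6 * r) * (26 * r ^+ 2).
      apply: ler_pM; rewrite ?addr_ge0 ?sqr_ge0 ?(ltW r0) ?(ltW r'0) //; first by lra.
      have : r' ^+ 2 <= (5 * r) ^+ 2 by apply: lerXn2r; rewrite ?nnegrE ?mulr_ge0 // ltW.
      by rewrite exprMn; move: (r ^+ 2) (r' ^+ 2) => P Q; lra.
    have b2 : `|r' - r| * ((r' + r) * (r' ^+ 2 + r ^+ 2)) <= 4 * ((6 * r) * (26 * r ^+ 2)).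
      by apply: ler_pM => //; rewrite mulr_ge0 ?addr_ge0 ?sqr_ge0 // ltW.
    rewrite mulrAC ler_pdivrMr ?exprn_gt0 //.
    apply: le_trans (ler_wpM2r (ltW r0) b2) _.
    by rewrite le_eqVlt; apply/orP; left; apply/eqP; ring.
  have -> : nw s (gnorm z) - nw s (gnorm w) = nw s (gnorm w) * (expR (s * (t *+ 2)) - 1).
    by rewrite {1}eu'; ring.
  rewrite normrM ger0_norm ?nw_ge0 //.
  apply: le_trans (ler_pM (nw_ge0 _ _) (normr_ge0 _) h625 (le_trans habs h4)) _.
  by rewrite mulrACA; apply: ler_wpM2r; rewrite // divr_ge0 ?nw_ge0 ?(ltW r0).
have -> : twist s k z - twist s k w = (sin (garg R z *+ k) - sin (garg R w *+ k)) * nw s (gnorm z)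
   + sin (garg R w *+ k) * (nw s (gnorm z) - nw s (gnorm w)) by rewrite /twist; ring.
apply: le_trans (ler_normD _ _) _; rewrite !normrM.
have u0 := nw_ge0 s (gnorm z).
have hf : nw s (gnorm z) / r <= nw (3 / 2) (gnorm z).
  rewrite rho_nw //; have -> : 3 / 2 = 1 + 1 / 2 :> R by field.
  by rewrite nwD ler_wpM2r ?nw_ge0 // nw_le // ltW.
apply: (@le_trans _ _ ((12 * k%:R + A) * (nw s (gnorm z) / r))); last first.
  by apply: ler_wpM2l => //; apply: addr_ge0 => //; apply: mulr_ge0.
rewrite mulrDl; apply: lerD.
  rewrite [`|nw _ _|]ger0_norm // [nw s _ / r]mulrC mulrA ler_wpM2r //.
  apply: le_trans hK _; rewrite [12 * _]mulrC -mulrA ler_wpM2l //.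
  by move: hc hs; lra.
apply: le_trans hu; rewrite ler_piMl ?normr_ge0 //.
by rewrite ler_norml sin_le1 sin_geN1.
Qed.

(** The even integers 2 j with |j| <= 2 represent the five classes modulo 1 + 2i, and adding them
    preserves odd type. So each z of odd type is (1 + 2i) y + 2 j for exactly one pair (y, j). *)
Definition shift5 (M : nat) : seq gauss :=
  [seq gadd (gmul (1, 2) p.1) (2 * p.2, 0) |
     p <- [seq (y, j) | y <- disc (M ^ 2), j <- [:: -2; -1; 0; 1; 2] : seq int]].

Lemma shift5_uniq M : uniq (shift5 M).
Proof.
rewrite map_inj_in_uniq.
  by apply: allpairs_uniq; rewrite ?disc_uniq // => -[? ?] [? ?].
have small p : p \in [seq (y, j) | y <- disc (M ^ 2), j <- [:: -2; -1; 0; 1; 2] : seq int] ->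
    `|p.2| <= 2.
  by move=> /allpairsP [[y j]] /= [_ hj ->]; move: hj; rewrite !inE /=; lia.
move=> [[a b] j] [[a' b'] j'] /small /= hj /small /= hj'.
rewrite /gadd /gmul /= => -[h1 h2].
have e : j = j' by lia.
by rewrite e in h1 *; congr (_, _, _); lia.
Qed.

Lemma small_shift (j : int) : j \in [:: -2; -1; 0; 1; 2] -> `|2 * j| <= 4.
Proof. by rewrite !inE; lia. Qed.

Lemma godd_shift z (j : int) : godd z -> godd (gadd z (2 * j, 0)).
Proof. by case: z => a b; rewrite /godd /gadd /=; lia. Qed.

Lemma shift5_godd M z : z \in shift5 M -> godd z.
Proof.
case/mapP => [[y j]] /allpairsP [[y' j']] /= [hy _ [-> ->]] ->.
move: hy; rewrite mem_disc => /andP[oy _]; by apply: godd_shift; apply: goddM.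
Qed.

Lemma disc_sub_shift5 M : (4 <= M)%N -> {subset disc (M ^ 2) <= shift5 M}.
Proof.
move=> M4 [a b]; rewrite mem_disc => /andP[oz nz].
(* This puts y in the disc: 5 N(y) = N(z - 2 j) <= M^2 + 8 M + 16 <= 5 M^2, true from M = 4 on. *)
have hMM : 8 * M%:Z + 16 <= 4 * M%:Z ^+ 2 by clear -M4; rewrite expr2; nia.
(* The condition is 2 j = a + 2 b modulo 5, and 3 is the inverse of 2; the shift by 2 centres the
   residue. *)
pose j : int := (((3 * (a + 2 * b) + 2) %% 5)%Z - 2).
have hj : `|j| <= 2 by rewrite /j; lia.
have d1 : (5 %| a - 2 * j + 2 * b)%Z by rewrite /j; lia.
have d2 : (5 %| b - 2 * (a - 2 * j))%Z by rewrite /j; lia.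
case/dvdzP: d1 => u hu; case/dvdzP: d2 => v hv.
apply/mapP; exists ((u, v), j); last first.
  by rewrite /gadd /gmul /=; congr pair; lia.
apply/allpairsP; exists ((u, v), j) => /=; split=> //; last first.
  by rewrite !inE; lia.
rewrite mem_disc; apply/andP; split.
  by move: oz; rewrite /godd /=; lia.
have Nz := gnormE (a, b); rewrite /= in Nz.
have e : (5 * (gnorm (u, v))%:Z) = (gnorm (a, b))%:Z - 4 * (j * a) + 4 * j ^+ 2.
  have := gnormM (1, 2) (u, v).
  have -> : gmul (1, 2) (u, v) = (a - 2 * j, b) by rewrite /gmul /=; congr pair; lia.
  move=> /(congr1 Posz); rewrite PoszM gnormE /= => <-; rewrite Nz; ring.
have hM : (gnorm (a, b))%:Z <= M%:Z ^+ 2 by rewrite -[M%:Z ^+ 2]/((M ^ 2)%N%:Z) in nz *; lia.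
have ha : `|a| <= M%:Z.
  have : a ^+ 2 <= M%:Z ^+ 2 by apply: le_trans hM; rewrite Nz lerDl sqr_ge0.
  by rewrite -(@ler_sqr _ `|a|) ?nnegrE // real_normK ?num_real.
have hja : `|j * a| <= 2 * M%:Z by rewrite normrM; apply: ler_pM.
have hj2 : j ^+ 2 <= 4.
  rewrite -subr_ge0; have -> : 4 - j ^+ 2 = (2 - j) * (2 + j) by ring.
  by apply: mulr_ge0; lia.
have : 5 * (gnorm (u, v))%:Z <= 5 * M%:Z ^+ 2.
  rewrite e; clear -hMM hja hj2 hM; move: hMM hja hj2 hM; move: (j * a) (j ^+ 2) (M%:Z ^+ 2) => U V W; lia.
by rewrite ler_pM2l // -[M%:Z ^+ 2]/((M ^ 2)%N%:Z) lez_nat.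
Qed.

Lemma size_disc M : (size (disc (M ^ 2)) <= (M.*2.+1) ^ 2)%N.
Proof.
have -> : ((M.*2.+1) ^ 2 = size [seq (u, v) | u : int <- zbox M, v : int <- zbox M])%N.
  by rewrite size_allpairs size_zbox mulnn.
apply: uniq_leq_size; first exact: disc_uniq.
move=> [u v]; rewrite mem_disc => /andP[_ hn].
apply/allpairsP; exists (u, v); rewrite /= !mem_zbox; move: hn; rewrite /gnorm /= => hn.
have hu : (`|u| ^ 2 <= M ^ 2)%N by apply: leq_trans hn; rewrite leq_addr.
have hv : (`|v| ^ 2 <= M ^ 2)%N by apply: leq_trans hn; rewrite leq_addl.
by split=> //; rewrite -leq_sqr.
Qed.

Lemma sum_twist_disc s k X : \sum_(z <- disc X) twist s k z = 0.
Proof.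
rewrite big_disc big1 // => n _; rewrite /twist.
transitivity (\sum_(z <- gset n) sin (garg R z *+ k) * nw s n).
  by rewrite !big_seq; apply: eq_bigr => z; rewrite mem_gset => /andP[_ /eqP ->].
by rewrite -mulr_suml sum_sin_gset mul0r.
Qed.

Lemma twist_le s k z : `|twist s k z| <= nw s (gnorm z).
Proof.
rewrite normrM [`|nw _ _|]ger0_norm ?nw_ge0 // ler_piMl ?nw_ge0 //.
by rewrite ler_norml sin_le1 sin_geN1.
Qed.

(** The points inside the disc are all of it and sum to 0. Those outside number at most 5 (2 M +
    1)^2 <= 45 M^2, each contributing at most M^(-2). *)
Lemma sum_twist_shift5 s k M : 1 < s -> (4 <= M)%N -> `|\sum_(z <- shift5 M) twist s k z| <= 45.
Proof.
move=> s1 M4; rewrite (bigID (fun z => z \in disc (M ^ 2))) /=.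
have -> : \sum_(z <- shift5 M | z \in disc (M ^ 2)) twist s k z = 0.
  transitivity (\sum_(z <- disc (M ^ 2)) twist s k z); last exact: sum_twist_disc.
  rewrite -[LHS]big_filter; apply/perm_big/uniq_perm.
  - by apply: filter_uniq; exact: shift5_uniq.
  - exact: disc_uniq.
  by move=> z; rewrite mem_filter andb_idr //; apply: disc_sub_shift5.
rewrite add0r; apply: le_trans (ler_norm_sum _ _ _) _.
have M0 : (0 < M)%N by lia.
have M2 : (0 < M ^ 2)%N by rewrite expn_gt0 M0.
apply: (@le_trans _ _ (\sum_(z <- shift5 M) ((M ^ 2)%:R^-1 : R))).
  rewrite big_mkcond !big_seq; apply: ler_sum => z hz; case: ifP => hd; last by rewrite invr_ge0.
  apply: le_trans (twist_le s k z) _.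
  move: hd; rewrite mem_disc (shift5_godd hz) /= -ltnNge => hd.
  apply: le_trans (nw_anti _ M2 (ltnW hd)) _; first by lra.
  by rewrite -nw1E // nw_le // ltW.
rewrite big_const_seq count_predT iter_addr addr0 -[X in X <= _]mulr_natl ler_pdivrMr ?ltr0n // -natrM ler_nat.
rewrite size_map size_allpairs /=; have := size_disc M; nia.
Qed.

(** The sine twists over [shift5] have bounded sum. Dropping the shifts 2 j costs a convergent sum
    of N(y)^(-3/2), so five times the sum of the twists of (1 + 2i) y is bounded. By the addition
    formula the latter sum is sin (2k arg (1 + 2i)) 5^(-s) times the cosine sum, and the sine is
    non-zero by [sin_arg_1D2i]. *)
Lemma lbound k : (0 < k)%N -> exists2 C : R, 0 <= C & forall s M, 1 < s -> s <= 2 -> (4 <= M)%N ->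
  `|\sum_(0 <= n < (M ^ 2).+1) cc R k n * nw s n| <= C.
Proof.
move=> k0; pose K := k.*2; pose th := garg R (1, 2).
have sn0 : sin (th *+ K) != 0.
  by rewrite /th /K; case: (k) k0 => // k' _; exact: sin_arg_1D2i.
have [A A0 hA] : exists2 A : R, 0 <= A & 625 * 624 <= A.
  by exists (625 * 624); [apply: mulr_ge0; exact: ler0n | exact: lexx].
pose B := (12 * K%:R + A : R); have B0 : 0 <= B by apply: addr_ge0 => //; apply: mulr_ge0.
(* 45 is the boundary term, 5 the number of shifts, B the constant of [twist_near], and 24 the bound
   of [lattice_sum] at s = 3/2. *)
pose E := 45 + 5 * (B * 24); have E0 : 0 <= E by rewrite /E; lra.
exists (5 * E / `|sin (th *+ K)|); first by rewrite divr_ge0 // mulr_ge0.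
move=> s M s1 s2 M4.
set L := \sum_(_ <= _ < _) _.
pose Sc := \sum_(y <- disc (M ^ 2)) cos (garg R y *+ K) * nw s (gnorm y).
have eSc : Sc = 2 * L.
  rewrite /Sc big_disc /L mulr_sumr; apply: eq_bigr => n _; rewrite /cc.
  rewrite mulrA mulrA divff // mul1r mulr_suml !big_seq; apply: eq_bigr => z.
  by rewrite mem_gset => /andP[_ /eqP ->].
have eT : \sum_(y <- disc (M ^ 2)) twist s K (gmul (1, 2) y) = sin (th *+ K) * nw s 5 * Sc.
  have -> : \sum_(y <- disc (M ^ 2)) twist s K (gmul (1, 2) y) =
    \sum_(y <- disc (M ^ 2)) (sin (th *+ K) * nw s 5 * (cos (garg R y *+ K) * nw s (gnorm y))
        + cos (th *+ K) * nw s 5 * twist s K y).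
    rewrite !big_seq; apply: eq_bigr => y; rewrite mem_disc => /andP[oy _].
    have y0 : (0 < gnorm y)%N.
      by rewrite lt0n gnorm_eq0; apply/eqP => e; rewrite e in oy.
    rewrite /twist (gargM R K _ y0).2 // gnormM nwM // mulrnDl sinD.
    have -> : gnorm (1, 2) = 5%N by [].
    by rewrite -/th; ring.
  by rewrite big_split /= -!mulr_sumr sum_twist_disc mulr0 addr0.
have hT : `|5 * (sin (th *+ K) * nw s 5 * Sc)| <= E.
  rewrite -eT.
  have -> : 5 * \sum_(y <- disc (M ^ 2)) twist s K (gmul (1, 2) y) =
     \sum_(z <- shift5 M) twist s K z -
     \sum_(y <- disc (M ^ 2)) \sum_(j <- [:: -2; -1; 0; 1; 2] : seq int)
        (twist s K (gadd (gmul (1, 2) y) (2 * j, 0)) - twist s K (gmul (1, 2) y)).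
    rewrite /shift5 big_map big_allpairs /= -sumrB mulr_sumr; apply: eq_bigr => y _.
    by rewrite sumrB opprB addrC subrK !big_cons big_nil; ring.
  apply: le_trans (ler_normB _ _) _; apply: lerD; first exact: sum_twist_shift5.
  apply: le_trans (ler_norm_sum _ _ _) _.
  apply: (@le_trans _ _ (\sum_(y <- disc (M ^ 2)) 5 * (B * nw (3 / 2) (gnorm y)))).
    rewrite !big_seq; apply: ler_sum => y; rewrite mem_disc => /andP[oy _].
    apply: le_trans (ler_norm_sum _ _ _) _.
    apply: (@le_trans _ _ (\sum_(j <- [:: -2; -1; 0; 1; 2] : seq int) B * nw (3 / 2) (gnorm y))); last first.
      by rewrite !big_cons big_nil; lra.
    rewrite !big_seq; apply: ler_sum => j hj; rewrite distrC.
    have y0 : (0 < gnorm y)%N.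
      by rewrite lt0n gnorm_eq0; apply/eqP => e; rewrite e in oy.
    have oo : godd (gmul (1, 2) y) by apply: goddM.
    have og : godd (gadd (gmul (1, 2) y) (2 * j, 0)).
      exact: godd_shift.
    have pos z : godd z -> (0 < gnorm z)%N.
      by move=> oz; rewrite lt0n gnorm_eq0; apply/eqP => e; rewrite e in oz.
    apply: le_trans (twist_near K A0 hA (pos _ oo) (pos _ og) s1 s2 _ _) _.
    - by rewrite /gadd /= addr0.
    - by rewrite /gadd /= addrAC subrr add0r; exact: small_shift.
    rewrite -/B ler_wpM2l // gnormM; apply: nw_anti; rewrite ?leq_pmull //.
  rewrite -!mulr_sumr ler_pM2l // ler_wpM2l //.
  have := @lattice_sum R (3 / 2) M; have -> : 12 * (1 + (2 * (3 / 2 - 1))^-1) = 24 :> R by field.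
  by apply; lra.
rewrite ler_pdivlMr ?normr_gt0 //.
have n5 : 25^-1 <= nw s 5 :> R.
  have -> : 25^-1 = nw 2 5 :> R.
    have -> : 2 = 1 + 1 :> R by [].
    by rewrite nwD nw1E // -invfM -natrM.
  exact: nw_le.
move: hT; rewrite eSc !normrM [`|nw s 5|]ger0_norm ?nw_ge0 // ![`|_%:R|]ger0_norm //.
have p0 : 0 <= `|L| * `|sin (th *+ K)| by rewrite mulr_ge0.
have -> : 5 * (`|sin (th *+ K)| * nw s 5 * (2 * `|L|)) = (10 * nw s 5) * (`|L| * `|sin (th *+ K)|) by ring.
move: p0; move: (`|L| * _) => P p0 h.
have : 10 / 25 * P <= 10 * nw s 5 * P by rewrite ler_wpM2r //; lra.
lra.
Qed.

Lemma lbound0 s M : 1 < s -> s <= 2 -> `|\sum_(0 <= n < (M ^ 2).+1) cc R 0 n * nw s n| <= 12 / (s - 1).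
Proof.
move=> s1 s2.
have e : \sum_(0 <= n < (M ^ 2).+1) cc R 0 n * nw s n = 2^-1 * \sum_(z <- disc (M ^ 2)) nw s (gnorm z).
  rewrite big_disc mulr_sumr; apply: eq_bigr => n _; rewrite /cc -mulrA mulr_suml; congr (_ * _).
  rewrite !big_seq; apply: eq_bigr => z; rewrite mem_gset => /andP[_ /eqP ->].
  by rewrite mulr0n cos0 mul1r.
rewrite e ger0_norm; last by rewrite mulr_ge0 // sumr_ge0 // => z _; exact: nw_ge0.
have := @lattice_sum R s M s1; set S := \sum_(_ <- _) _ => h.
have d0 : 0 < s - 1 by lra.
have di : 1 <= (s - 1)^-1 by rewrite invf_ge1 //; lra.
by move: h; rewrite invfM; move: ((s - 1)^-1) di => t t1 h; lra.
Qed.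
End LBound.

(** * From Dirichlet series to sums over primes *)

Lemma weighted_geometric_tail (R : realType) (x : R) N : 0 <= x -> x <= 1 / 3 ->
  \sum_(2 <= j < N) j.+1%:R * x ^+ j <= 21 / 4 * x ^+ 2.
Proof.
move=> x0 x1.
have key n : (1 - x) ^+ 2 * \sum_(2 <= j < n.+2) j.+1%:R * x ^+ j =
    x ^+ 2 * (3 - 2 * x) - x ^+ n.+2 * (n.+3%:R - n.+2%:R * x).
  elim: n => [|n IH]; first by rewrite big_geq //; ring.
  rewrite big_nat_recr //= mulrDr IH.
  have -> : n.+4%:R = n%:R + 4 :> R by rewrite -[n.+4]addn4 natrD.
  have -> : n.+3%:R = n%:R + 3 :> R by rewrite -[n.+3]addn3 natrD.
  have -> : n.+2%:R = n%:R + 2 :> R by rewrite -[n.+2]addn2 natrD.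
  rewrite !exprS; ring.
have h0 : 0 <= 21 / 4 * x ^+ 2 by rewrite mulr_ge0 ?exprn_ge0 // divr_ge0.
case: N => [|[|n]]; [by rewrite big_geq|by rewrite big_geq|].
have p1 : 0 < (1 - x) ^+ 2 by rewrite exprn_gt0 //; lra.
rewrite -(ler_pM2l p1) key.
have t0 : 0 <= x ^+ n.+2 * (n.+3%:R - n.+2%:R * x).
  rewrite mulr_ge0 ?exprn_ge0 // subr_ge0 -[n.+3]addn1 natrD.
  have : n.+2%:R * x <= n.+2%:R * 1 by rewrite ler_wpM2l //; lra.
  lra.
apply: le_trans (_ : x ^+ 2 * (3 - 2 * x) <= _); first by rewrite lerBlDr lerDl.
(* 21/4 is the value of (3 - 2 x) / (1 - x)^2 at x = 1/3. *)
have -> : (1 - x) ^+ 2 * (21 / 4 * x ^+ 2) = x ^+ 2 * (21 / 4 * (1 - x) ^+ 2) by ring.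
rewrite ler_wpM2l ?exprn_ge0 //; nra.
Qed.

Lemma exp_le_1D (R : realType) (t : R) : - (3 / 4) <= t -> expR (t - 4 * t ^+ 2) <= 1 + t.
Proof.
move=> ht; have t1 : 0 < 1 + t by lra.
rewrite -[t - _]opprB expRN -[1 + t]invrK lef_pV2 ?posrE ?invr_gt0 ?expR_gt0 //.
apply: le_trans (expR_ge1Dx _).
rewrite -(ler_pM2l t1) mulfV ?gt_eqF //.
have -> : (1 + t) * (1 + (4 * t ^+ 2 - t)) = 1 + t ^+ 2 * (3 + 4 * t) by ring.
by rewrite lerDl mulr_ge0 ?sqr_ge0 //; lra.
Qed.

Lemma succ_le_exp32 (R : realType) j : j.+1%:R <= 2 * (3 / 2) ^+ j :> R.
Proof.
elim: j => [|[|j] IH]; rewrite ?expr0 ?expr1; [lra|lra|].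
rewrite exprS; move: IH; set e := (3 / 2) ^+ j.+1.
have -> : j.+3%:R = j%:R + 3 :> R by rewrite -[j.+3]addn3 natrD.
have -> : j.+2%:R = j%:R + 2 :> R by rewrite -[j.+2]addn2 natrD.
have : 0 <= j%:R :> R by [].
by move: (j%:R : R) => t; lra.
Qed.

Lemma abs_multf (R : realType) (u : nat -> R) : multf u -> multf (fun n => `|u n|).
Proof. by move=> [u1 uM]; split=> [|a b cab a0 b0]; rewrite ?u1 ?normr1 // uM // normrM. Qed.
Lemma mul_multf (R : realType) (u v : nat -> R) : multf u -> multf v -> multf (fun n => u n * v n).
Proof.
by move=> [u1 uM] [v1 vM]; split=> [|a b cab a0 b0]; rewrite ?u1 ?v1 ?mulr1 // uM // vM // mulrACA.
Qed.

Lemma nw_pow_le1 (R : realType) (s : R) n : 0 <= s -> nw s n <= 1.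
Proof.
move=> s0; case: n => [|n]; first by rewrite /nw ln0 // mulr0 expR0.
by rewrite -(nw1 s); apply: nw_anti.
Qed.

(** The factor is 1 + t, and [exp_le_1D] needs t >= -3/4. For p >= 5 one has |t| <= 2/5 + 21/100; at
    3 this requires u(3) = 0, and at 2 the factor is 1. The constant 70 covers 21/4 from the higher
    powers and 4 * 16 from 4 t^2 with |t| <= 4 / p. *)
Lemma euler_factor_ge (R : realType) (u : nat -> R) (s : R) p J : prime p ->
  (forall j, `|u (p ^ j)%N| <= j.+1%:R) -> u 1%N = 1 ->
  (p = 2%N -> forall j, u (p ^ j.+1)%N = 0) -> (p = 3%N -> u p = 0) -> 1 < s -> (0 < J)%N ->
  expR (u p * nw s p - 70 / p%:R ^+ 2) <= \sum_(0 <= j < J.+1) u (p ^ j)%N * nw s (p ^ j)%N.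
Proof.
move=> pp ub u1 u2 u3 s1 J0; have p0 := prime_gt0 pp.
rewrite big_ltn // expn0 u1 nw1 mul1r.
case: (eqVneq p 2%N) => [e2|ne2].
  rewrite big_nat big1 ?addr0; last first.
    by case=> [//|j] _; rewrite u2 ?mul0r.
  have -> : u p = 0 by rewrite -[p]expn1 u2.
  by rewrite mul0r sub0r -expR0 ler_expR oppr_le0 divr_ge0 // exprn_ge0.
have p3 : (3 <= p)%N by have := prime_gt1 pp; case: (p) ne2 => [|[|[|?]]].
rewrite big_ltn // expn1; set rest := \sum_(2 <= j < J.+1) _.
pose x := p%:R^-1 : R.
have pR : 0 < p%:R :> R by rewrite ltr0n.
have x0 : 0 < x by rewrite invr_gt0.
have x1 : x <= 1 / 3 by rewrite /x -div1r ler_pdivrMr // mulrC mulrA ler_pdivlMr // !mul1r mulr1 ler_nat.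
have wx : nw s p <= x by rewrite /x -nw1E // nw_le // ltW.
have hrest : `|rest| <= 21 / 4 * x ^+ 2.
  apply: le_trans (ler_norm_sum _ _ _) _.
  apply: le_trans (weighted_geometric_tail J.+1 (ltW x0) x1).
  apply: ler_sum => j _; rewrite normrM [`|nw _ _|]ger0_norm ?nw_ge0 // nwX //.
  by apply: ler_pM; rewrite ?exprn_ge0 ?nw_ge0 // lerXn2r ?nnegrE ?nw_ge0 // ltW.
have hup : `|u p * nw s p| <= 2 * x.
  rewrite normrM [`|nw _ _|]ger0_norm ?nw_ge0 //; apply: ler_pM; rewrite ?nw_ge0 //.
  by have := ub 1%N; rewrite expn1.
set t := u p * nw s p + rest.
have x2 : x ^+ 2 <= 1 / 3 * x by rewrite expr2 ler_pM2r.
have ht34 : - (3 / 4) <= t.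
  move: hrest hup; rewrite /t !ler_norml => /andP[r1 r2] /andP[v1 v2].
  case: (eqVneq p 3%N) => [e3|ne3].
    have -> : u p = 0 by apply: u3.
    by rewrite mul0r add0r; lra.
  case: (ltnP p 5) => p5.
    have e4 : p = 4%N by clear -ne3 p3 p5; move/eqP: ne3; lia.
    by rewrite e4 in pp.
  have x5 : x <= 1 / 5 by rewrite /x -div1r ler_pdivrMr // mulrC mulrA ler_pdivlMr // !mul1r mulr1 ler_nat.
  have : x ^+ 2 <= 1 / 5 * x by rewrite expr2 ler_pM2r.
  lra.
apply: le_trans (exp_le_1D ht34); rewrite ler_expR.
have tt : `|t| <= 4 * x by apply: le_trans (ler_normD _ _) _; lra.
have t2 : t ^+ 2 <= (4 * x) ^+ 2 by rewrite -(real_normK (num_real t)) lerXn2r ?nnegrE // mulr_ge0 // ltW.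
have -> : 70 / p%:R ^+ 2 = 70 * x ^+ 2 by rewrite /x exprVn.
move: hrest t2; rewrite ler_norml /t exprMn => /andP[r1 r2] t2.
have : 0 <= x ^+ 2 by rewrite exprn_ge0 // ltW.
lra.
Qed.

(** The Euler product over p <= y = M^2 is a sum over y-smooth n. The terms with n <= y form the
    partial sum bounded by B; the rest are at most 1 for large M, because half of s - 1 is set aside
    as a factor y^(-eta). Taking logarithms in [euler_factor_ge] concludes. The threshold Y depends
    on s, the constant 70 does not. *)
Lemma euler_upper (R : realType) (u : nat -> R) (B s : R) : multf u -> u 0%N = 0 ->
  (forall p j, prime p -> `|u (p ^ j)%N| <= j.+1%:R) ->
  (forall j, u (2 ^ j.+1)%N = 0) -> u 3%N = 0 -> 1 < s -> 0 <= B ->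
  (forall M, (4 <= M)%N -> `|\sum_(0 <= n < (M ^ 2).+1) u n * nw s n| <= B) ->
  exists Y, forall M, (Y <= M)%N -> \sum_(p <- pr (M ^ 2)) u p * nw s p <= 70 + ln (B + 1).
Proof.
move=> mu u0 ub u2 u3 s1 B0 hB.
pose eta := (s - 1) / 2; have eta0 : 0 < eta by rewrite divr_gt0 // subr_gt0.
(* 18 = 9 * 2 comes from [smooths_mean] with j + 1 <= 2 (3/2)^j, and the second factor from |u(p)|
   <= 2 and [zeta_partial]. *)
pose K := expR 18 * expR (2 * (1 + eta^-1)) : R.
have K0 : 0 < K by rewrite mulr_gt0 ?expR_gt0.
exists (maxn 4 (Num.truncn (expR (ln K / eta))).+1) => M; rewrite geq_max => /andP[M4 MK].
have M0 : (0 < M)%N by lia.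
pose y := (M ^ 2)%N; have y0 : (0 < y)%N by rewrite expn_gt0 M0.
pose F n := u n * nw s n.
have mF : multf F by apply: mul_multf => //; exact: nw_multf.
have My : (M <= y)%N by rewrite /y -mulnn leq_pmulr.
have hy : nw eta y * K <= 1.
  have hM : expR (ln K / eta) <= M%:R.
    by apply: le_trans (ltW (truncnS_gt _)) _; rewrite ler_nat.
  rewrite /nw -{1}(lnK (_ : K \is Num.pos)) ?posrE // -expRD -[X in _ <= X]expR0 ler_expR.
  have : ln K / eta <= ln y%:R.
    rewrite -(expRK (ln K / eta)) ler_ln ?posrE ?expR_gt0 ?ltr0n //.
    by apply: le_trans hM _; rewrite ler_nat.
  rewrite ler_pdivrMr //; lra.
have split_sum : \sum_(n <- smooths y (pr y)) F n =
    \sum_(0 <= n < y.+1) F n + \sum_(n <- smooths y (pr y) | (y < n)%N) F n.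
  rewrite (bigID (fun n => (n <= y)%N)) /=; congr (_ + _); last by apply: eq_bigl => n; rewrite ltnNge.
  rewrite big_ltn // {2}/F u0 mul0r add0r -big_filter; apply/perm_big/uniq_perm.
  - by rewrite filter_uniq // smooths_uniq ?pr_prime ?pr_uniq.
  - exact: iota_uniq.
  move=> n; rewrite mem_filter mem_index_iota ltnS.
  apply/andP/andP => [[ny hn]|[n0 ny]].
    by have [n0 _] := smooths_spec (pr_prime y) hn.
  split=> //; apply: smooth_mem_smooths => //; apply/allP => p.
  rewrite mem_primes => /and3P[_ _ pn]; exact: leq_trans (dvdn_leq n0 pn) ny.
pose v n := `|u n| * nw eta n.
have mv : multf v by apply: mul_multf (abs_multf mu) (nw_multf _).
have v0 n : 0 <= v n by rewrite mulr_ge0 ?nw_ge0.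
have vD p j : prime p -> (1 < j)%N -> v (p ^ j)%N <= 2 * (3 / 2) ^+ j.
  move=> pp _; apply: le_trans (succ_le_exp32 _ _); rewrite -[X in _ <= X]mulr1.
  by apply: ler_pM; rewrite ?nw_ge0 ?ub // nw_pow_le1 // ltW.
have hv : \sum_(n <- smooths y (pr y)) v n / n%:R <= K.
  apply: le_trans (smooths_mean mv v0 vD _ y y) _ => //.
  have -> : 9 * 2 = 18 :> R by ring.
  rewrite ler_wpM2l ?expR_ge0 // ler_expR.
  apply: (@le_trans _ _ (2 * \sum_(1 <= m < y.+1) nw (1 + eta) m)); last first.
    by rewrite ler_pM2l // zeta_partial.
  rewrite mulr_sumr big_filter -[iota 0 y.+1]/(0%N :: iota 1 y) big_cons /=.
  rewrite /index_iota subn1 /= big_mkcond /= !big_seq; apply: ler_sum => p.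
  rewrite mem_iota => /andP[p0 _]; case: ifP => pp; last by rewrite mulr_ge0 ?nw_ge0.
  rewrite /v nwD nw1E // [_^-1 * _]mulrC mulrA ler_wpM2r ?invr_ge0 // ler_wpM2r ?nw_ge0 //.
  by have := ub p 1%N pp; rewrite expn1.
have htail : `|\sum_(n <- smooths y (pr y) | (y < n)%N) F n| <= 1.
  apply: le_trans hy; apply: le_trans (ler_norm_sum _ _ _) _.
  apply: le_trans (ler_wpM2l (nw_ge0 _ _) hv).
  rewrite mulr_sumr big_mkcond /= !big_seq; apply: ler_sum => n hn.
  have [n0 _] := smooths_spec (pr_prime y) hn.
  case: ifP => yn; last by rewrite mulr_ge0 ?nw_ge0 // divr_ge0.
  rewrite /F normrM [`|nw _ _|]ger0_norm ?nw_ge0 // /v.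
  have -> : nw s n = nw eta n * (nw eta n / n%:R).
    rewrite -nw1E // -!nwD; have -> : eta + (eta + 1) = s by rewrite /eta; field.
    by [].
  rewrite mulrCA ler_pM ?mulr_ge0 ?nw_ge0 ?divr_ge0 //; last by rewrite mulrA.
  by apply: nw_anti => //; [exact: ltW | exact: ltnW].
have hprod : \prod_(p <- pr y) expR (F p - 70 / p%:R ^+ 2) <= \sum_(n <- smooths y (pr y)) F n.
  rewrite (sum_smooths y mF (pr_prime y) (pr_uniq y)) !big_seq; apply: ler_prod => p.
  rewrite mem_pr expR_ge0 /= => /andP[pp _]; apply: euler_factor_ge => //.
  - by move=> j; exact: ub.
  - exact: mu.1.
  - by move=> -> j; rewrite u2.
  - by move=> ->.
have hS : \sum_(n <- smooths y (pr y)) F n <= B + 1.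
  rewrite split_sum; apply: lerD; last by apply: le_trans htail; exact: ler_norm.
  by apply: le_trans (hB M M4); exact: ler_norm.
have := le_trans hprod hS; rewrite -expR_sum sumrB => h.
have B1 : 0 < B + 1 by lra.
have : \sum_(p <- pr y) F p - \sum_(p <- pr y) 70 / p%:R ^+ 2 <= ln (B + 1).
  by rewrite -(expRK (_ - _)) ler_ln ?posrE ?expR_gt0.
have : \sum_(p <- pr y) 70 / p%:R ^+ 2 <= 70 :> R.
  by rewrite -mulr_sumr -[X in _ <= X]mulr1 ler_pM2l // sum_inv_sq.
lra.
Qed.

(** For p <= x, replacing 1 / p by p^(-1 - 1/L) loses at most a proportion ln p / L; by
    [chebyshev_upper] the total loss is at most (2 / L) * 2 L = 4. *)
Lemma prime_sum_shift (R : realType) (f : nat -> R) x : (forall n, 0 <= f n) ->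
  (forall p, prime p -> f p <= 2) -> 1 <= ln x%:R :> R ->
  \sum_(p <- pr x) f p / p%:R <= 4 + \sum_(p <- pr x) f p * nw (1 + (ln x%:R)^-1) p.
Proof.
move=> f0 f2 L1; set L := ln x%:R in L1 *.
have L0 : 0 < L by lra.
apply: (@le_trans _ _ (\sum_(p <- pr x) (2 / L * (ln p%:R / p%:R) + f p * nw (1 + L^-1) p))).
  rewrite !big_seq; apply: ler_sum => p; rewrite mem_pr => /andP[pp _].
  have p0 := prime_gt0 pp; have p1 : 0 <= p%:R^-1 :> R by rewrite invr_ge0.
  have l0 : 0 <= ln p%:R / L by rewrite divr_ge0 ?(ltW L0) // ln_ge0 // ler1n.
  rewrite -lerBlDr nwD nw1E //.
  have -> : f p / p%:R - f p * (p%:R^-1 * nw L^-1 p) = f p * (p%:R^-1 * (1 - nw L^-1 p)) by ring.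
  have -> : 2 / L * (ln p%:R / p%:R) = 2 * (p%:R^-1 * (ln p%:R / L)) by ring.
  have h1 : 1 - nw L^-1 p <= ln p%:R / L.
    have := expR_ge1Dx (- L^-1 * ln p%:R); rewrite -/(nw L^-1 p); lra.
  have h0 : 0 <= 1 - nw L^-1 p by rewrite subr_ge0 nw_pow_le1 // invr_ge0 ltW.
  by apply: ler_pM; rewrite ?f0 ?f2 ?mulr_ge0 // ler_wpM2l.
rewrite big_split /= lerD2r -mulr_sumr.
apply: le_trans (ler_wpM2l _ (chebyshev_upper R x)) _; first by rewrite divr_ge0 // ltW.
by rewrite -/L le_eqVlt; apply/orP; left; apply/eqP; field; rewrite gt_eqF.
Qed.

Lemma pr_extend (R : realType) (f : nat -> R) x y : (x <= y)%N -> (forall n, 0 <= f n) ->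
  \sum_(p <- pr x) f p <= \sum_(p <- pr y) f p.
Proof.
move=> xy f0; rewrite [X in _ <= X](bigID (fun p => p \in pr x)) /= -[X in _ <= X + _]big_filter.
apply: ler_wpDr; first exact: sumr_ge0.
rewrite le_eqVlt; apply/orP; left; apply/eqP/perm_big/uniq_perm.
- exact: pr_uniq.
- by apply: filter_uniq; exact: pr_uniq.
move=> p; rewrite [RHS]mem_filter andb_idr // !mem_pr => /andP[-> px]; exact: leq_trans px xy.
Qed.

Lemma ln_ge1 (R : realType) x : (4 <= x)%N -> 1 <= ln x%:R :> R.
Proof.
move=> x4; have x0 : (0 < x)%N by lia.
rewrite -[X in X <= _](expRK (1 : R)) ler_ln ?posrE ?expR_gt0 ?ltr0n //.
apply: (@le_trans _ _ 4); last by rewrite ler_nat.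
have h : expR (1 / 2) <= 2 :> R.
  have := expR_ge1Dx (- (1 / 2) : R); rewrite expRN => h.
  have e2 : 1 - 1 / 2 = 2^-1 :> R by field.
  by move: h; rewrite e2 lef_pV2 ?posrE ?expR_gt0.
rewrite [X in expR X](_ : 1 = 1 / 2 + 1 / 2); last by field.
rewrite expRD; have -> : 4 = 2 * 2 :> R by rewrite -natrM.
by apply: ler_pM; rewrite ?expR_ge0.
Qed.

Lemma ln_affine_le (R : realType) (C L : R) : 0 <= C -> 1 <= L -> ln (C * L + 1) <= ln L + ln (C + 1).
Proof.
move=> C0 L1; have L0 : 0 < L by lra.
rewrite -lnM ?posrE //; last by lra.
rewrite ler_ln ?posrE ?mulr_gt0 //; last 1 first.
  by lra.
  nra.
by have := mulr_ge0 C0 (ltW L0); lra.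
Qed.

(** The upper Mertens bound, by [euler_upper] at s = 1 + 1 / ln x. The indicator of integers prime
    to 6 meets its conditions at 2 and 3; those two primes are added back at the end. *)
Lemma prime_inv_sum (R : realType) : exists C : R, 0 <= C /\ forall x, (4 <= x)%N ->
  \sum_(p <- pr x) p%:R^-1 <= ln (ln x%:R) + C.
Proof.
pose u (n : nat) : R := (coprime 6 n)%:R.
have mu : multf u.
  by split=> // a b _ _ _; rewrite /u coprimeMr -natrM mulnb.
have ub p j : `|u (p ^ j)%N| <= j.+1%:R by rewrite normr_nat ler_nat /u; case: coprime.
have u2 j : u (2 ^ j.+1)%N = 0 by rewrite /u expnS coprimeMr.
exists (70 + ln (2 + 1) + 4 + 1 + 1); split; first by rewrite !addr_ge0 // ln_ge0 //; lra.
move=> x x4; have L1 := ln_ge1 R x4; set L := ln x%:R in L1 *.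
have L0 : 0 < L by lra.
have s1 : 1 < 1 + L^-1 by rewrite ltrDl invr_gt0.
have B0 : 0 <= 1 + L by lra.
have [|||Y hY] := @euler_upper R u (1 + L) (1 + L^-1) mu _ (fun p j _ => ub p j) u2 _ s1 B0 _ => //.
  move=> M _; rewrite big_ltn // {1}/u mul0r add0r ger0_norm; last first.
    by apply: sumr_ge0 => n _; rewrite mulr_ge0 ?nw_ge0.
  have := @zeta_partial R L^-1 (M ^ 2); rewrite invrK invr_gt0 => /(_ L0); apply: le_trans.
  by apply: ler_sum => n _; rewrite ler_piMl ?nw_ge0 // /u lern1; case: coprime.
pose M := maxn x Y; have := hY M (leq_maxr _ _) => h.
have hx : (x <= M ^ 2)%N by apply: leq_trans (leq_maxl x Y) _; rewrite -/M -mulnn; nia.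
have u0 n : 0 <= u n by [].
have hs := @prime_sum_shift R u x u0 _ L1; rewrite -/L in hs.
have he := @pr_extend R (fun p => u p * nw (1 + L^-1) p) _ _ hx (fun n => mulr_ge0 (u0 n) (nw_ge0 _ _)).
have hu : \sum_(p <- pr x) p%:R^-1 <= \sum_(p <- pr x) u p / p%:R + 2.
  rewrite (bigID (coprime 6)) /=; apply: lerD.
    rewrite big_mkcond /=; apply: ler_sum => p _; rewrite /u; case: coprime => /=.
      by rewrite mul1r.
    by rewrite mul0r.
  rewrite -big_filter.
  apply: (@le_trans _ _ (\sum_(p <- [:: 2; 3]%N) (p%:R^-1 : R))); last by rewrite !big_cons big_nil; lra.
  rewrite [X in _ <= X](bigID (fun p => p \in [seq i <- pr x | ~~ coprime 6 i])) /= -[X in _ <= X + _]big_filter.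
  apply: ler_wpDr; first by apply: sumr_ge0 => p _; rewrite invr_ge0.
  rewrite le_eqVlt; apply/orP; left; apply/eqP/perm_big/uniq_perm.
  - by apply: filter_uniq; exact: pr_uniq.
  - exact: filter_uniq.
  move=> p; rewrite [RHS]mem_filter andb_idr // mem_filter mem_pr => /and3P[np pp _].
  move: np; rewrite coprime_sym prime_coprime // negbK -[6%N]/(2 * 3)%N Euclid_dvdM // !dvdn_prime2 //.
  by rewrite !inE.
have hln := @ln_affine_le R 2 L _ L1.
have : ln (1 + L + 1) <= ln (2 * L + 1) by rewrite ler_ln ?posrE; lra.
have ule p : prime p -> u p <= 2 by move=> _; rewrite /u ler_nat; case: coprime.
have := hs ule; have := hln (ler0n R 2); lra.
Qed.

Definition cc_slope (R : realType) k : R := if k == 0%N then 1 else 3 / 4.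

(** Everything is evaluated at s = 1 + 1 / ln x, where the series of c_0 is at most 12 ln x. *)
Lemma cc_prime_sum (R : realType) k : exists C : R, 0 <= C /\ forall x, (4 <= x)%N ->
  \sum_(p <- pr x) `|cc R k p| / p%:R <= cc_slope R k * ln (ln x%:R) + C.
Proof.
have cc0v j : cc R j 0%N = 0 by exact: cc_even.
have ccb j p i : prime p -> `|cc R j (p ^ i)%N| <= i.+1%:R.
  by move=> pp; apply: le_trans (cc_le_cc0 R j _) _; exact: cc0_pow.
have cc2 j i : cc R j (2 ^ i.+1)%N = 0 by apply: cc_even; rewrite oddX.
have cc3 j : cc R j 3%N = 0 by apply: cc_mod4.
have upper j (B s : R) : 1 < s -> 0 <= B ->
    (forall M, (4 <= M)%N -> `|\sum_(0 <= n < (M ^ 2).+1) cc R j n * nw s n| <= B) ->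
    exists Y, forall M, (Y <= M)%N -> \sum_(p <- pr (M ^ 2)) cc R j p * nw s p <= 70 + ln (B + 1).
  by move=> s1 B0 h; apply: (euler_upper (cc_multf R j)) => // p i pp; exact: ccb.
have p2 j p : prime p -> `|cc R j p| <= 2 by move=> pp; have := ccb j p 1%N pp; rewrite expn1.
case: (eqVneq k 0%N) => [->|k0].
  exists (4 + (70 + ln (12 + 1))); split; first by rewrite !addr_ge0 // ln_ge0 //; lra.
  move=> x x4; have L1 := ln_ge1 R x4; set L := ln x%:R in L1 *.
  have L0 : 0 < L by lra.
  have s1 : 1 < 1 + L^-1 by rewrite ltrDl invr_gt0.
  have s2 : 1 + L^-1 <= 2 by have : L^-1 <= 1 by [rewrite invf_le1]; lra.
  have [||Y hY] := upper 0%N (12 * L) (1 + L^-1) s1; first by rewrite mulr_ge0 // ltW.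
    move=> M M4; apply: le_trans (lbound0 M s1 s2) _.
    by rewrite (_ : 1 + L^-1 - 1 = L^-1) ?invrK //; ring.
  pose M := maxn x Y; have h := hY M (leq_maxr _ _).
  have hx : (x <= M ^ 2)%N by apply: leq_trans (leq_maxl x Y) _; rewrite -/M -mulnn; nia.
  have hs := @prime_sum_shift R (fun p => `|cc R 0 p|) x (fun n => normr_ge0 _) (p2 0%N) L1.
  rewrite -/L in hs; apply: le_trans hs _.
  have he := @pr_extend R (fun p => `|cc R 0 p| * nw (1 + L^-1) p) _ _ hx
    (fun n => mulr_ge0 (normr_ge0 _) (nw_ge0 _ _)).
  have e0 : \sum_(p <- pr (M ^ 2)) `|cc R 0 p| * nw (1 + L^-1) p = \sum_(p <- pr (M ^ 2)) cc R 0 p * nw (1 + L^-1) p.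
    by apply: eq_bigr => p _; rewrite ger0_norm // cc0_ge0.
  have hln := @ln_affine_le R 12 L (ler0n R 12) L1.
  by rewrite e0 in he; rewrite /cc_slope eqxx mul1r; lra.
have k20 : (0 < k.*2)%N by rewrite double_gt0 lt0n.
have [Ck Ck0 hCk] := lbound R k20.
exists (4 + (3 / 4 * (70 + ln (12 + 1)) + 1 / 4 * (70 + ln (Ck + 1)))); split.
  have h1 : 0 <= ln (12 + 1) :> R by rewrite ln_ge0 //; lra.
  have h2 : 0 <= ln (Ck + 1) :> R by rewrite ln_ge0 //; lra.
  lra.
move=> x x4; have L1 := ln_ge1 R x4; set L := ln x%:R in L1 *.
have L0 : 0 < L by lra.
have s1 : 1 < 1 + L^-1 by rewrite ltrDl invr_gt0.
have s2 : 1 + L^-1 <= 2 by have : L^-1 <= 1 by [rewrite invf_le1]; lra.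
have [||Y hY] := upper 0%N (12 * L) (1 + L^-1) s1; first by rewrite mulr_ge0 // ltW.
  move=> M M4; apply: le_trans (lbound0 M s1 s2) _.
  by rewrite (_ : 1 + L^-1 - 1 = L^-1) ?invrK //; ring.
have [|Y' hY'] := upper k.*2 Ck (1 + L^-1) s1 Ck0; first by move=> M; exact: hCk.
pose M := maxn x (maxn Y Y').
have h := hY M (leq_trans (leq_maxl Y Y') (leq_maxr _ _)).
have h' := hY' M (leq_trans (leq_maxr Y Y') (leq_maxr _ _)).
have hx : (x <= M ^ 2)%N by apply: leq_trans (leq_maxl x (maxn Y Y')) _; rewrite -/M -mulnn; nia.
have hs := @prime_sum_shift R (fun p => `|cc R k p|) x (fun n => normr_ge0 _) (p2 k) L1.
rewrite -/L in hs; apply: le_trans hs _.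
have he := @pr_extend R (fun p => `|cc R k p| * nw (1 + L^-1) p) _ _ hx
  (fun n => mulr_ge0 (normr_ge0 _) (nw_ge0 _ _)).
have e0 : \sum_(p <- pr (M ^ 2)) `|cc R k p| * nw (1 + L^-1) p <=
   3 / 4 * (\sum_(p <- pr (M ^ 2)) cc R 0 p * nw (1 + L^-1) p) +
   1 / 4 * (\sum_(p <- pr (M ^ 2)) cc R k.*2 p * nw (1 + L^-1) p).
  rewrite !mulr_sumr -big_split /=; apply: ler_sum => p _.
  apply: le_trans (ler_wpM2r (nw_ge0 _ p) (cc_le_mix R k p)) _; rewrite mulrDl -!mulrA.
  by move: (cc R 0 p) (cc R k.*2 p) => a b; rewrite le_eqVlt; apply/orP; left; apply/eqP; ring.
have hln := @ln_affine_le R 12 L (ler0n R 12) L1.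
by rewrite /cc_slope (negbTE k0); lra.
Qed.

(** * Correlations of c_k along shifted primes *)

Definition upto (y : nat) : nat_pred := [pred p : nat | (p <= y)%N].

Lemma smooth_part y n : smooth y n`_(upto y)%N.
Proof. by apply/allP => p; rewrite primes_part mem_filter => /andP[]. Qed.

Lemma rough_part_gt y n q : prime q -> (q %| n`_(negn (upto y)))%N -> (y < q)%N.
Proof.
move=> pq hq; have : q \in primes n`_(negn (upto y))%N by rewrite mem_primes pq part_gt0.
by rewrite primes_part mem_filter => /andP[]; rewrite !inE -ltnNge.
Qed.

Lemma dvdn_smooth_part y n q : prime q -> (0 < n)%N -> (q %| n)%N -> (q <= y)%N ->
  (q %| n`_(upto y))%N.
Proof.
move=> pq n0 qn qy; have : q \in primes n`_(upto y)%N.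
  by rewrite primes_part mem_filter mem_primes pq n0 qn !inE qy.
by rewrite mem_primes => /and3P[].
Qed.

(** As j + 1 <= 2^j, F(n) is at most 2 to the number of prime factors of n with multiplicity, and
    there are at most ln n / ln y of them. *)
Lemma rough_le (R : realType) (F : nat -> R) (y : nat) : multf F -> (forall n, 0 <= F n) ->
  (forall p j, prime p -> F (p ^ j)%N <= j.+1%:R) -> (1 < y)%N ->
  forall n, (0 < n)%N -> (forall q, prime q -> (q %| n)%N -> (y <= q)%N) ->
  F n <= expR (ln 2 / ln y%:R * ln n%:R).
Proof.
move=> mF F0 FB y1; have ly : 0 < ln y%:R :> R by rewrite ln_gt0 // ltr1n.
have l2 : 0 <= ln 2 :> R by rewrite ln_ge0 // ler1n.
elim/ltn_ind => n IH n0 hn.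
case: (ltnP 1 n) => [n1|]; last first.
  by case: n n0 {IH hn} => [|[|n]] // _ _; rewrite mF.1 ln1 mulr0 expR0.
set p := pdiv n; have pp : prime p := pdiv_prime n1.
have [m cpm en] := pfactor_coprime pp n0; set j := logn p n in en.
have m0 : (0 < m)%N by case: m en n0 {cpm} => [->|].
have j0 : (0 < j)%N by rewrite /j logn_gt0 mem_primes pp n0 pdiv_dvd.
have pj1 : (1 < p ^ j)%N by rewrite -(expn0 p) ltn_exp2l ?prime_gt1.
have mn : (m < n)%N by rewrite en -[X in (X < _)%N]muln1 ltn_pmul2l.
have hm := IH m mn m0 (fun q pq qm => hn q pq (dvdn_trans qm (eq_ind_r (dvdn m) (dvdn_mulr _ (dvdnn m)) en))).
have -> : F n = F m * F (p ^ j)%N.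
  have c : coprime m (p ^ j) by rewrite coprimeXr // coprime_sym.
  by have := mF.2 m (p ^ j)%N c m0 (ltnW pj1); rewrite -en.
have -> : ln n%:R = ln m%:R + ln (p ^ j)%N%:R :> R.
  by rewrite {1}en natrM lnM ?posrE ?ltr0n // expn_gt0 prime_gt0.
rewrite mulrDr expRD; apply: ler_pM => //.
apply: le_trans (FB p j pp) _.
apply: (@le_trans _ _ (expR (ln 2 *+ j))).
  have -> : ln 2 *+ j = j%:R * ln 2 :> R by rewrite mulr_natl.
  by rewrite expRM_natl lnK ?posrE // -natrX ler_nat ltn_expl.
rewrite ler_expR natrX lnXn ?ltr0n ?prime_gt0 // mulrnAr lerMn2r; apply/orP; right.
rewrite mulrAC ler_pdivlMr // ler_wpM2l // ler_ln ?posrE.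
- by rewrite ler_nat; apply: hn => //; exact: pdiv_dvd.
- by rewrite ltr0n; lia.
by rewrite ltr0n prime_gt0.
Qed.

(** What the sieve loses at the primes dividing n, which are left out of it. *)
Definition hfun (R : realType) (n : nat) : R := expR (3 * \sum_(p <- primes n) p%:R^-1).

Lemma hfun_ge1 (R : realType) n : 1 <= hfun R n.
Proof. by rewrite -[X in X <= _]expR0 ler_expR mulr_ge0 // sum_inv_pr_ge0. Qed.

Lemma hfun_multf (R : realType) : multf (hfun R).
Proof.
split=> [|a b cab a0 b0]; first by rewrite /hfun big_nil mulr0 expR0.
rewrite /hfun -expRD -mulrDr -big_cat; congr expR; congr (_ * _); apply: perm_big.
apply: uniq_perm; first exact: primes_uniq.
  by rewrite cat_uniq !primes_uniq andbT -coprime_has_primes.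
by move=> p; rewrite mem_cat primesM.
Qed.

Lemma hfun_pow (R : realType) p j : prime p -> (0 < j)%N -> hfun R (p ^ j) = expR (3 / p%:R).
Proof. by move=> pp j0; rewrite /hfun primesX // primes_prime // big_seq1. Qed.

Lemma ccabs_pow (R : realType) k p j : prime p -> `|cc R k (p ^ j)%N| <= j.+1%:R.
Proof. by move=> pp; apply: le_trans (cc_le_cc0 R k _) _; exact: cc0_pow. Qed.

Lemma expR_sub1_le (R : realType) (v : R) : expR v - 1 <= v * expR v.
Proof.
have := expR_ge1Dx (- v); rewrite expRN => h.
have e0 := expR_gt0 v; rewrite -(ler_pM2r e0) mulVf ?gt_eqF // in h; lra.
Qed.

(** The weight [hfun] costs a constant only: hfun(p) - 1 is at most (3 / p) e^(3/2), so it adds O(1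
    / p^2) at each prime. *)
Lemma smooth_cc_mean (R : realType) k : exists K : R, 0 < K /\ forall X y, (4 <= y)%N ->
  \sum_(1 <= a < X.+1 | smooth y a) `|cc R k a| * hfun R a / a%:R
    <= K * expR (cc_slope R k * ln (ln y%:R)).
Proof.
have [C [C0 hC]] := cc_prime_sum R k.
pose D := 2 * expR (3 / 2) : R; have D0 : 0 <= D by rewrite mulr_ge0 ?expR_ge0.
exists (expR (9 * D) * expR (6 * expR (3 / 2) + C)); split; first by rewrite mulr_gt0 ?expR_gt0.
move=> X y y4.
have e32 p : prime p -> expR (3 / p%:R) <= expR (3 / 2) :> R.
  move=> pp; rewrite ler_expR ler_pM2l // lef_pV2 ?posrE ?ltr0n ?prime_gt0 //.
  by rewrite ler_nat prime_gt1.
have mv := mul_multf (abs_multf (cc_multf R k)) (hfun_multf R).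
have v0 n : 0 <= `|cc R k n| * hfun R n by rewrite mulr_ge0 ?expR_ge0.
apply: le_trans (smooth_mean mv v0 _ D0 X y) _.
  move=> p j pp j1; rewrite hfun_pow ?(ltnW j1) // /D.
  have -> : 2 * expR (3 / 2) * (3 / 2) ^+ j = 2 * (3 / 2) ^+ j * expR (3 / 2) :> R by ring.
  apply: ler_pM; rewrite ?expR_ge0 ?e32 //.
  by apply: le_trans (ccabs_pow R k j pp) (succ_le_exp32 R j).
rewrite -mulrA ler_wpM2l ?expR_ge0 // -expRD ler_expR.
apply: (@le_trans _ _ (6 * expR (3 / 2) * (\sum_(p <- pr y) (p%:R ^+ 2)^-1) + \sum_(p <- pr y) `|cc R k p| / p%:R)); last first.
  have := hC y y4; have : 6 * expR (3 / 2) * (\sum_(p <- pr y) (p%:R ^+ 2)^-1) <= 6 * expR (3 / 2) * 1 :> R.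
    by rewrite ler_wpM2l ?sum_inv_sq // mulr_ge0 ?expR_ge0.
  lra.
rewrite mulr_sumr -big_split /= !big_seq; apply: ler_sum => p; rewrite mem_pr => /andP[pp _].
have p0 : 0 < p%:R :> R by rewrite ltr0n prime_gt0.
rewrite -lerBlDr -{1}[p in hfun R p]expn1 hfun_pow //.
have c2 : `|cc R k p| <= 2 by have := ccabs_pow R k 1 pp; rewrite expn1.
have -> : `|cc R k p| * expR (3 / p%:R) / p%:R - `|cc R k p| / p%:R =
   `|cc R k p| * (p%:R^-1 * (expR (3 / p%:R) - 1)) by ring.
have e1 : 0 <= expR (3 / p%:R) - 1 :> R by rewrite subr_ge0 -[X in X <= _]expR0 ler_expR divr_ge0 // ltW.
have -> : 6 * expR (3 / 2) / p%:R ^+ 2 = 2 * (p%:R^-1 * (3 / p%:R * expR (3 / 2))) :> R.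
  by field; rewrite gt_eqF.
apply: ler_pM; rewrite ?mulr_ge0 ?invr_ge0 ?(ltW p0) //.
rewrite ler_wpM2l ?invr_ge0 ?(ltW p0) //; apply: le_trans (expR_sub1_le _) _.
by rewrite ler_wpM2l ?e32 // divr_ge0 // ltW.
Qed.

(** The exponent 16 is the bound 2^4 for c_0(p)^4. *)
Lemma fourth_moment (R : realType) : exists K : R, 0 < K /\ forall X, (4 <= X)%N ->
  \sum_(1 <= m < X.+1) cc R 0 m ^+ 4 <= K * X%:R * expR (16 * ln (ln X%:R)).
Proof.
have [C [C0 hC]] := prime_inv_sum R.
(* j + 1 <= 10 (11/10)^j, and (11/10)^4 < 3/2. *)
have [D D0 hD] : exists2 D : R, 0 <= D & forall j, j.+1%:R ^+ 4 <= D * (3 / 2) ^+ j.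
  exists (10 ^+ 4); first by apply: exprn_ge0; exact: ler0n.
  move=> j; have lin : j.+1%:R <= 10 * (11 / 10) ^+ j :> R.
    case: (leqP j 9) => [j9|].
      apply: (@le_trans _ _ (10 * 1)); first by rewrite mulr1 ler_nat.
      by rewrite ler_pM2l // exprn_ege1 //; lra.
    elim: j => [//|j IH] j9; have [j10|j10] := ltnP 9 j; last first.
      have -> : j = 9%N by lia.
      rewrite [10.+1]lock -lock; apply: (@le_trans _ _ (10 * (11 / 10) ^+ 1)).
        by rewrite expr1 mulrA mulrAC divff // mul1r.
      rewrite ler_pM2l // ler_eXn2l //; lra.
    have := IH j10; rewrite exprS; set e := (11 / 10) ^+ j => h.
    have -> : j.+2%:R = j.+1%:R + 1 :> R by rewrite -natr1.
    have : 10 <= j.+1%:R :> R by rewrite ler_nat; lia.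
    move: (j.+1%:R : R) h => t; lra.
  apply: (@le_trans _ _ ((10 * (11 / 10) ^+ j) ^+ 4)).
    by apply: lerXn2r; rewrite ?nnegrE ?mulr_ge0 ?exprn_ge0 // divr_ge0.
  rewrite exprMn -exprM mulnC exprM; apply: ler_wpM2l; first by apply: exprn_ge0; exact: ler0n.
  by apply: lerXn2r; rewrite ?nnegrE ?exprn_ge0 ?divr_ge0 //; lra.
exists (expR (9 * D) * expR (16 * C)); split; first by rewrite mulr_gt0 ?expR_gt0.
move=> X X4; pose v n := cc R 0 n ^+ 4.
have mv : multf v.
  have [u1 uM] := cc_multf R 0.
  by split=> [|a b cab a0 b0]; rewrite /v ?u1 ?expr1n // uM // exprMn.
have v0 n : 0 <= v n by rewrite exprn_ge0 ?cc0_ge0.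
have vD p j : prime p -> (1 < j)%N -> v (p ^ j)%N <= D * (3 / 2) ^+ j.
  move=> pp _; apply: le_trans (hD j).
  by apply: lerXn2r; rewrite ?nnegrE ?cc0_ge0 ?cc0_pow.
apply: (@le_trans _ _ (X%:R * \sum_(1 <= m < X.+1 | smooth X m) v m / m%:R)).
  rewrite mulr_sumr [X in _ <= X]big_mkcond /= !big_nat; apply: ler_sum => m /andP[m0 mX].
  have -> : smooth X m.
    by apply/allP => p; rewrite mem_primes => /and3P[_ _ pm]; apply: leq_trans (dvdn_leq m0 pm) _.
  rewrite mulrCA ler_peMr ?v0 // ler_pdivlMr ?ltr0n // mul1r ler_nat -ltnS //.
apply: le_trans (ler_wpM2l _ (smooth_mean mv v0 vD D0 X X)) _ => //.
have hp : \sum_(p <- pr X) v p / p%:R <= 16 * (ln (ln X%:R) + C).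
  apply: le_trans (ler_wpM2l _ (hC X X4)) => //; rewrite mulr_sumr !big_seq; apply: ler_sum => p.
  rewrite mem_pr => /andP[pp _]; rewrite ler_wpM2r ?invr_ge0 //.
  have -> : 16 = 2 ^+ 4 :> R by rewrite -natrX.
  apply: lerXn2r; rewrite ?nnegrE ?cc0_ge0 //.
  by have := @cc0_pow R p 1 pp; rewrite expn1.
have -> : expR (9 * D) * expR (16 * C) * X%:R * expR (16 * ln (ln X%:R)) =
   X%:R * (expR (9 * D) * expR (16 * (ln (ln X%:R) + C))).
  by rewrite mulrDr expRD; ring.
by rewrite ler_wpM2l // ler_wpM2l ?expR_ge0 // ler_expR.
Qed.

(** For a > B, 1 / a <= a^(e - 1) (B + 1)^(-e). Each Euler factor is at most 1 + 4 p^(e - 1), as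
    p^(e - 1) <= 3/4 when e <= 1/2. Replacing p^(e - 1) by 1 / p costs e e^(A0) ln p / p, which sums
    to a constant by [chebyshev_upper] as e ln y <= A0. *)
Lemma rankin_smooth (R : realType) (A0 : R) : 0 <= A0 -> exists K : R, 0 < K /\
  forall X y B (e : R), (4 <= y)%N -> 0 <= e -> e <= 1 / 2 -> e * ln y%:R <= A0 ->
  \sum_(1 <= a < X.+1 | smooth y a && (B < a)%N) a%:R^-1
    <= K * expR (4 * ln (ln y%:R)) * expR (- e * ln B.+1%:R).
Proof.
move=> A00; have [C [C0 hC]] := prime_inv_sum R.
exists (expR (4 * (C + expR A0 * (2 * A0)))); split; first exact: expR_gt0.
move=> X y B e y4 e0 e12 eA; pose v := @nw R (1 - e).
have v0 n : 0 <= v n by exact: nw_ge0.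
apply: (@le_trans _ _ ((\sum_(1 <= a < X.+1 | smooth y a) v a) * nw e B.+1)).
  rewrite mulr_suml big_mkcond [X in _ <= X]big_mkcond /= !big_nat; apply: ler_sum => a /andP[a0 _].
  case: smooth => //=; case: ltnP => h /=; last by rewrite mulr_ge0 ?nw_ge0.
  rewrite -nw1E //; have -> : 1 = (1 - e) + e by ring.
  by rewrite nwD ler_wpM2l // nw_anti.
rewrite -/(nw e B.+1) ler_wpM2r ?nw_ge0 //.
apply: le_trans (sum_smooth_le X y (nw_multf _) v0) _.
apply: le_trans (prod_1D_le_exp _ _) _; first by move=> p; apply: sumr_ge0.
rewrite -expRD ler_expR.
apply: (@le_trans _ _ (\sum_(p <- pr y) 4 * v p)).
  rewrite !big_seq; apply: ler_sum => p; rewrite mem_pr => /andP[pp _].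
  have x34 : v p <= 3 / 4.
    have h2 : v 2%N ^+ 2 <= 1 / 2.
      rewrite /v expr2 -nwD; apply: (@le_trans _ _ (nw 1 2)); last by rewrite nw1E // div1r.
      by apply: nw_le; lra.
    apply: le_trans (nw_anti _ _ (prime_gt1 pp)) _ => //; first by lra.
    rewrite -/(v 2%N); have := v0 2%N; move: (v 2%N) h2 => t h2 t0; nra.
  case: X => [|X]; first by rewrite big_geq // mulr_ge0.
  have e1 : \sum_(1 <= j < X.+2) v (p ^ j)%N = v p * \sum_(0 <= j < X.+1) v p ^+ j.
    rewrite big_add1 /= mulr_sumr; apply: eq_bigr => j _.
    by rewrite /v nwX ?prime_gt0 // exprS.
  rewrite e1 mulrC ler_wpM2r //.
  have key n : (1 - v p) * \sum_(0 <= j < n) v p ^+ j = 1 - v p ^+ n.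
    elim: n => [|n IH]; first by rewrite big_geq // expr0; ring.
    by rewrite big_nat_recr //= mulrDr IH exprS; ring.
  have := key X.+1; have : 0 <= v p ^+ X.+1 by rewrite exprn_ge0.
  have : 0 <= \sum_(0 <= j < X.+1) v p ^+ j by apply: sumr_ge0 => j _; rewrite exprn_ge0.
  move: (\sum_(_ <= _ < _) _) (v p ^+ X.+1) => S T S0 T0 h; nra.
rewrite -mulr_sumr -mulrDr ler_pM2l //.
apply: (@le_trans _ _ (\sum_(p <- pr y) (p%:R^-1 + expR A0 * e * (ln p%:R / p%:R)))).
  rewrite !big_seq; apply: ler_sum => p; rewrite mem_pr => /andP[pp py].
  have p0 := prime_gt0 pp.
  have -> : v p = p%:R^-1 * expR (e * ln p%:R) by rewrite -nw1E // /v /nw -expRD; congr expR; ring.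
  have l0 : 0 <= ln p%:R :> R by rewrite ln_ge0 // ler1n.
  have lA : e * ln p%:R <= A0.
    by apply: le_trans eA; rewrite ler_wpM2l // ler_ln ?posrE ?ltr0n ?ler_nat //; lia.
  have h := expR_sub1_le (e * ln p%:R).
  have h2 : e * ln p%:R * expR (e * ln p%:R) <= e * ln p%:R * expR A0.
    by rewrite ler_wpM2l ?mulr_ge0 // ler_expR.
  have -> : p%:R^-1 + expR A0 * e * (ln p%:R / p%:R) = p%:R^-1 * (1 + e * ln p%:R * expR A0) by ring.
  by rewrite ler_wpM2l ?invr_ge0 //; lra.
rewrite big_split /= -mulr_sumr; have h1 := hC y y4.
have h2 : expR A0 * e * (\sum_(p <- pr y) ln p%:R / p%:R) <= expR A0 * (2 * A0).
  apply: le_trans (ler_wpM2l _ (chebyshev_upper R y)) _; first by rewrite mulr_ge0 ?expR_ge0.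
  have -> : expR A0 * e * (2 * ln y%:R) = expR A0 * (2 * (e * ln y%:R)) by ring.
  by rewrite ler_wpM2l ?expR_ge0 // ler_pM2l.
lra.
Qed.

(* The sieve factor of the theorem: at each prime p > 3 dividing neither a nor c the three
   residue classes 0, 2, -2 are removed. *)
Lemma sieve_factor (R : realType) z a c : (0 < z)%N -> (0 < a)%N -> (0 < c)%N ->
  expR (- 3 * \sum_(p <- sieve_primes z (a * c)) p%:R^-1)
   <= expR 30 * (ln z.+1%:R) ^- 3 * (hfun R a * hfun R c) :> R.
Proof.
move=> z0 a0 c0; set S := \sum_(p <- _) _.
pose T := \sum_(p <- pr z) p%:R^-1 : R.
(* 5/6 accounts for the primes 2 and 3. In the final constant, 30 is 27 from the cube of
   [mertens_lower] plus 3 >= 3 * 5/6. *)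
have hT : T <= S + 5 / 6 + (\sum_(p <- primes a) p%:R^-1 + \sum_(p <- primes c) p%:R^-1).
  rewrite -big_cat /= /T /S.
  have -> : 5 / 6 = \sum_(p <- [:: 2; 3]%N) (p%:R^-1 : R) by rewrite !big_cons big_nil; field.
  rewrite -!big_cat /=; set s := _ ++ _.
  apply: (@le_trans _ _ (\sum_(p <- undup s) p%:R^-1)).
    rewrite [X in _ <= X](bigID (fun p => p \in pr z)) /= -[X in _ <= X + _]big_filter.
    apply: ler_wpDr; first by apply: sumr_ge0 => p _; rewrite invr_ge0.
    rewrite le_eqVlt; apply/orP; left; apply/eqP/perm_big/uniq_perm.
    - exact: pr_uniq.
    - by apply: filter_uniq; exact: undup_uniq.
    move=> p; rewrite [RHS]mem_filter andb_idr // => hp; have := hp; rewrite mem_pr => /andP[pp pz].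
    rewrite mem_undup /s !mem_cat !inE mem_filter hp andbT !mem_primes pp a0 c0 /=.
    rewrite coprime_sym prime_coprime // Euclid_dvdM //.
    case: (p %| a)%N; rewrite ?orbT //; case: (p %| c)%N; rewrite ?orbT //= ?andbT !orbF.
    have p1 := prime_gt1 pp; case: (ltnP 4 p) => //= p4.
    case: (eqVneq p 2%N) => //= p2; case: (eqVneq p 3%N) => //= p3.
    have e4 : p = 4%N by clear -p1 p4 p2 p3; move/eqP: p2; move/eqP: p3; lia.
    by rewrite e4 in pp.
  elim: (s) => [|p s' IH]; first by rewrite big_nil.
  rewrite /= big_cons; case: ifP => _; first by apply: le_trans IH _; rewrite lerDr invr_ge0.
  by rewrite big_cons lerD2l.
have hm := mertens_lower R z; rewrite -/T in hm.
have l0 : 0 < ln z.+1%:R :> R by rewrite ln_gt0 // ltr1n.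
have hT3 : expR (- T) <= expR 9 / ln z.+1%:R.
  by rewrite expRN ler_pdivlMr // mulrC ler_pdivrMr ?expR_gt0.
have h3 : expR (- T) ^+ 3 <= (expR 9 / ln z.+1%:R) ^+ 3.
  by apply: lerXn2r; rewrite ?nnegrE ?divr_ge0 ?expR_ge0 // ltW.
rewrite expr_div_n -expRM_natl -expRM_natl in h3.
apply: (@le_trans _ _ (expR 3 * (expR (3 * - T) * (hfun R a * hfun R c)))).
  rewrite /hfun -!expRD ler_expR; lra.
have -> : expR 30 = expR 3 * expR (3 * 9) :> R by rewrite -expRD; congr expR; ring.
rewrite -[expR 3 * expR _ / _]mulrA -[X in _ <= X]mulrA; apply: ler_wpM2l; first exact: expR_ge0.
by apply: ler_wpM2r h3; rewrite mulr_ge0 ?expR_ge0.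
Qed.

(** * Pairs n + 2, n - 2 grouped by their smooth parts *)

Definition window N z : seq nat := [seq n <- iota 0 N.+1 | prime n && (z < n)%N].

Lemma window_spec N z n : (1 < z)%N -> n \in window N z -> [/\ prime n, odd n, (z < n)%N & (n <= N)%N].
Proof.
move=> z1; rewrite mem_filter mem_iota ltnS => /andP[/andP[pn zn] /= nN]; split=> //.
by case: (even_prime pn) => // e; rewrite e ltnNge z1 in zn.
Qed.

Lemma count_window N z y a c : (1 < z)%N -> (z <= y)%N -> exists r,
  (count (fun n => ((n + 2)`_(upto y) == a) && ((n - 2)`_(upto y) == c))%N (window N z) <=
   scount N.+1 (a * c) r (sieve_primes z (a * c)))%N.
Proof.
move=> z1 zy; set P := fun n => (_ == a) && _.
case: (boolP (has P (window N z))) => [/hasP[n1 hn1 /andP[/eqP ea1 /eqP ec1]]|]; last first.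
  by rewrite has_count -leqNgt leqn0 => /eqP ->; exists 0%N.
exists n1; rewrite count_filter; apply: sub_count => n /=; rewrite /P.
move=> /andP[/andP[/eqP ea /eqP ec] /andP[pn zn]].
have [pn1 on1 zn1 _] := window_spec z1 hn1.
have on : odd n by case: (even_prime pn) => // e; rewrite e ltnNge z1 in zn.
have n2 : (2 <= n)%N by lia.
have n12 : (2 <= n1)%N by lia.
have da : (a %| n + 2)%N by rewrite -ea dvdn_part.
have da1 : (a %| n1 + 2)%N by rewrite -ea1 dvdn_part.
have dc : (c %| n - 2)%N by rewrite -ec dvdn_part.
have dc1 : (c %| n1 - 2)%N by rewrite -ec1 dvdn_part.
(* The gcd divides (n + 2) - (n - 2) = 4, and a is odd. *)
have cac : coprime a c.
  have oa : odd a by apply: dvdn_odd da _; rewrite oddD on.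
  have : (gcdn a c %| 4)%N.
    have h1 : (gcdn a c %| n + 2)%N by apply: dvdn_trans (dvdn_gcdl _ _) da.
    have h2 : (gcdn a c %| n - 2)%N by apply: dvdn_trans (dvdn_gcdr _ _) dc.
    have -> : (4 = n + 2 - (n - 2))%N by clear -n2; lia.
    exact: dvdn_sub.
  have og : odd (gcdn a c) by apply: dvdn_odd (dvdn_gcdl _ _) oa.
  rewrite -[4%N]/(2 ^ 2)%N => /(dvdn_pfactor _ 2 (isT : prime 2))[[|m] _ e]; first by rewrite /coprime e.
  by rewrite e oddX in og.
apply/andP; split.
  rewrite chinese_remainder //; apply/andP; split.
    by rewrite -(eqn_modDr 2) (eqP da) (eqP da1).
  by rewrite -(subnK n2) -(subnK n12) eqn_modDr (eqP dc) (eqP dc1).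
apply/allP => p; rewrite mem_filter mem_pr => /andP[/andP[p4 cp] /andP[pp pz]].
have py : (p <= y)%N by exact: leq_trans pz zy.
have npac : ~~ (p %| a * c)%N by rewrite -prime_coprime // coprime_sym.
rewrite /bad !negb_or; apply/and3P; split.
- rewrite dvdn_prime2 //; apply/eqP => e; by rewrite e leqNgt zn in pz.
- rewrite -{1}(subnK n2) -[X in (_ == X %[mod _])%N]add0n eqn_modDr mod0n.
  apply: contra npac => h; apply: dvdn_mull; rewrite -ec; apply: dvdn_smooth_part => //.
  by rewrite subn_gt0 (leq_ltn_trans z1 zn).
apply: contra npac => h; apply: dvdn_mulr; rewrite -ea; apply: dvdn_smooth_part => //.
by rewrite addn2.
Qed.

Lemma le_sum_mem (R : numDomainType) (r : seq nat) (P : pred nat) (F : nat -> R) i :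
  (forall j, 0 <= F j) -> i \in r -> P i -> F i <= \sum_(j <- r | P j) F j.
Proof. by move=> F0 hi Pi; rewrite (big_rem i) //= Pi lerDl sumr_ge0. Qed.

Lemma sum_uniq_sub (R : numDomainType) (r s : seq nat) (F : nat -> R) :
  (forall j, 0 <= F j) -> uniq r -> uniq s -> {subset r <= s} ->
  \sum_(j <- r) F j <= \sum_(j <- s) F j.
Proof.
move=> F0 ur us rs; rewrite [X in _ <= X](bigID (fun j => j \in r)) /= -[X in _ <= X + _]big_filter.
apply: ler_wpDr; first exact: sumr_ge0.
rewrite le_eqVlt; apply/orP; left; apply/eqP/perm_big/uniq_perm => //; first exact: filter_uniq.
by move=> j; rewrite mem_filter andb_idr //; exact: rs.
Qed.

Lemma window_uniq N z : uniq (window N z). Proof. exact: filter_uniq (iota_uniq _ _). Qed.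

Lemma cc_le_id (R : realType) k n : (0 < n)%N -> `|cc R k n| <= n%:R.
Proof.
move=> n0; have := @rough_le R _ 2 (abs_multf (cc_multf R k)) (fun _ => normr_ge0 _) (fun p j => @ccabs_pow R k p j) isT n n0.
rewrite divff ?gt_eqF ?ln_gt0 ?ltr1n // mul1r lnK ?posrE ?ltr0n //; apply.
by move=> q pq _; exact: prime_gt1.
Qed.

Definition rough_factor (R : realType) (N y : nat) : R :=
  expR (ln 2 / ln y.+1%:R * ln (N + 2)%:R).

Lemma cc_split_le (R : realType) k N y m : (0 < y)%N -> (0 < m)%N -> (m <= N + 2)%N ->
  `|cc R k m| <= rough_factor R N y * `|cc R k m`_(upto y)%N|.
Proof.
move=> y0 m0 mN; have [_ fM] := abs_multf (cc_multf R k).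
rewrite -{1}(partnC (upto y) m0) fM ?coprime_partC ?part_gt0 // mulrC ler_wpM2r //.
have h := @rough_le R _ y.+1 (abs_multf (cc_multf R k)) (fun _ => normr_ge0 _)
  (fun p j => @ccabs_pow R k p j) _ _ (part_gt0 (negn (upto y)) m) _.
apply: le_trans (h _ _) _ => //; first by move=> q; exact: rough_part_gt.
rewrite ler_expR ler_wpM2l ?divr_ge0 ?ln_ge0 ?ler1n // ler_ln ?posrE ?ltr0n ?part_gt0 ?addn2 //.
by rewrite ler_nat -addn2; apply: leq_trans mN; apply: dvdn_leq m0 (dvdn_part _ _).
Qed.

(** For fixed smooth parts a and c the sieve count carries the factor hfun(a) hfun(c) / (a c), so
    the main term splits into a product of two one-variable sums. Brun's remainder is summed
    trivially with |c_k(a)| <= a, whence A^4. *)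
Lemma good_sum (R : realType) k l N z y A j : (1 < z)%N -> (z <= y)%N -> ~~ odd j ->
  \sum_(n <- window N z | ((n + 2)`_(upto y) <= A)%N && ((n - 2)`_(upto y) <= A)%N)
     `|cc R k (n + 2)| * `|cc R l (n - 2)|
  <= rough_factor R N y ^+ 2 *
   (N.+1%:R * (expR 30 * (ln z.+1%:R) ^- 3 + 2^-1 ^+ j * expR (6 * \sum_(p <- pr z) p%:R^-1))
      * (\sum_(1 <= a < A.+1 | smooth y a) `|cc R k a| * hfun R a / a%:R)
      * (\sum_(1 <= a < A.+1 | smooth y a) `|cc R l a| * hfun R a / a%:R)
    + expR 3 * z.+1%:R ^+ j * A%:R ^+ 4).
Proof.
move=> z1 zy oj; set E := rough_factor R N y.
have E0 : 0 <= E by exact: expR_ge0.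
have y0 : (0 < y)%N by apply: leq_trans zy; exact: ltnW.
set T := expR 30 * _ + _; pose H a : R := hfun R a.
have lz : 0 < ln z.+1%:R :> R by rewrite ln_gt0 // ltr1n ltnS (ltnW z1).
have tau0 : 0 <= 2^-1 ^+ j * expR (6 * \sum_(p <- pr z) p%:R^-1) :> R.
  by rewrite mulr_ge0 ?expR_ge0 ?exprn_ge0 ?invr_ge0.
have m30 : 0 <= expR 30 * (ln z.+1%:R) ^- 3 :> R.
  by rewrite mulr_ge0 ?expR_ge0 // invr_ge0 exprn_ge0 // ltW.
have T0 : 0 <= T by rewrite addr_ge0.
pose sp m := (m`_(upto y))%N.
pose Q a c : R := `|cc R k a| * `|cc R l c|.
have Q0 a c : 0 <= Q a c by rewrite mulr_ge0.
apply: (@le_trans _ _ (E ^+ 2 * \sum_(n <- window N z | (sp (n + 2)%N <= A)%N && (sp (n - 2)%N <= A)%N) Q (sp (n + 2)%N) (sp (n - 2)%N))).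
  rewrite mulr_sumr big_seq_cond [X in _ <= X]big_seq_cond; apply: ler_sum => n /andP[hn _].
  have [pn on zn nN] := window_spec z1 hn.
  have n1 : (0 < n - 2)%N by rewrite subn_gt0 (leq_ltn_trans z1 zn).
  have n2 : (n - 2 <= N + 2)%N by apply: leq_trans (leq_subr _ _) _; apply: leq_trans nN (leq_addr _ _).
  have n3 : (n + 2 <= N + 2)%N by rewrite leq_add2r.
  have n4 : (0 < n + 2)%N by rewrite addn2.
  rewrite expr2 /Q -[E * E * _]mulrACA.
  by apply: ler_pM; rewrite ?normr_ge0 ?cc_split_le.
rewrite ler_wpM2l ?exprn_ge0 //.
pose cnt a c := count (fun n => ((n + 2)`_(upto y) == a) && ((n - 2)`_(upto y) == c))%N (window N z).
apply: (@le_trans _ _ (\sum_(1 <= a < A.+1 | smooth y a) \sum_(1 <= c < A.+1 | smooth y c) Q a c * (cnt a c)%:R)).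
  apply: (@le_trans _ _ (\sum_(n <- window N z) \sum_(1 <= a < A.+1 | smooth y a)
     \sum_(1 <= c < A.+1 | smooth y c) Q a c * ((sp (n + 2)%N == a) && (sp (n - 2)%N == c))%N%:R)).
    rewrite big_mkcond /=; apply: ler_sum => n _.
    have G0 a c : 0 <= Q a c * ((sp (n + 2)%N == a) && (sp (n - 2)%N == c))%N%:R by rewrite mulr_ge0.
    case: ifP => [/andP[hA hC]|_]; last by apply: sumr_ge0 => a _; apply: sumr_ge0.
    apply: (@le_trans _ _ (Q (sp (n + 2)%N) (sp (n - 2)%N) *
       ((sp (n + 2)%N == sp (n + 2)%N) && (sp (n - 2)%N == sp (n - 2)%N))%N%:R)); first by rewrite !eqxx mulr1.
    apply: le_trans (@le_sum_mem _ (index_iota 1 A.+1) (smooth y) (fun c => Q (sp (n + 2)%N) c * ((sp (n + 2)%N == sp (n + 2)%N) && (sp (n - 2)%N == c))%N%:R) _ _ _ _) _.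
    - by move=> c; exact: G0.
    - by rewrite mem_index_iota part_gt0 ltnS.
    - exact: smooth_part.
    apply: (@le_sum_mem _ _ (smooth y) (fun a => \sum_(1 <= c < A.+1 | smooth y c) Q a c * ((sp (n + 2)%N == a) && (sp (n - 2)%N == c))%N%:R)).
    - by move=> a; apply: sumr_ge0.
    - by rewrite mem_index_iota part_gt0 ltnS.
    - exact: smooth_part.
  rewrite exchange_big /= le_eqVlt; apply/orP; left; apply/eqP; apply: eq_bigr => a _.
  rewrite exchange_big /=; apply: eq_bigr => c _.
  rewrite -mulr_sumr; congr (_ * _); rewrite /cnt -sum1_count natr_sum [RHS]big_mkcond /=.
  by apply: eq_bigr => n _; rewrite /sp; case: ifP.
set B := expR 3 * z.+1%:R ^+ j.
have B0 : 0 <= B by rewrite mulr_ge0 ?expR_ge0 ?exprn_ge0.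
have hcnt a c : (0 < a)%N -> (0 < c)%N -> (cnt a c)%:R <= N.+1%:R * T * (H a / a%:R) * (H c / c%:R) + B.
  move=> a0 c0; have [r hr] := count_window N a c z1 zy.
  apply: (@le_trans _ _ (scount N.+1 (a * c) r (sieve_primes z (a * c)))%:R); first by rewrite ler_nat.
  apply: le_trans (brun_sieve _ _ _ _ _ oj) _; first by rewrite muln_gt0 a0.
  rewrite lerD2r natrM.
  have -> : N.+1%:R * T * (H a / a%:R) * (H c / c%:R) = N.+1%:R / (a%:R * c%:R) * (T * (H a * H c)).
    by field; rewrite !pnatr_eq0 -!lt0n a0 c0.
  apply: ler_wpM2l; first by rewrite divr_ge0 ?mulr_ge0.
  rewrite /T [X in _ <= X]mulrDl; apply: lerD.
    by apply: sieve_factor => //; exact: ltnW.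
  by rewrite ler_peMr // mulr_ege1 // hfun_ge1.
pose Sk kk := \sum_(1 <= a < A.+1 | smooth y a) `|cc R kk a| * H a / a%:R.
apply: (@le_trans _ _ (\sum_(1 <= a < A.+1 | smooth y a) \sum_(1 <= c < A.+1 | smooth y c)
   (N.+1%:R * T * (`|cc R k a| * H a / a%:R) * (`|cc R l c| * H c / c%:R) + B * (`|cc R k a| * `|cc R l c|)))).
  rewrite big_nat_cond [X in _ <= X]big_nat_cond; apply: ler_sum => a /andP[/andP[a0 _] _].
  rewrite big_nat_cond [X in _ <= X]big_nat_cond; apply: ler_sum => c /andP[/andP[c0 _] _].
  apply: le_trans (ler_wpM2l (Q0 a c) (hcnt a c a0 c0)) _.
  by rewrite /Q le_eqVlt; apply/orP; left; apply/eqP; ring.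
have e1 : \sum_(1 <= a < A.+1 | smooth y a) \sum_(1 <= c < A.+1 | smooth y c)
   (N.+1%:R * T * (`|cc R k a| * H a / a%:R) * (`|cc R l c| * H c / c%:R) + B * (`|cc R k a| * `|cc R l c|)) =
   N.+1%:R * T * Sk k * Sk l + B * ((\sum_(1 <= a < A.+1 | smooth y a) `|cc R k a|) * \sum_(1 <= c < A.+1 | smooth y c) `|cc R l c|).
  under eq_bigr do rewrite big_split /= -!mulr_sumr.
  by rewrite big_split /= -mulr_suml -!mulr_sumr -mulr_suml.
rewrite e1 lerD2l ler_wpM2l //.
have hs kk : \sum_(1 <= a < A.+1 | smooth y a) `|cc R kk a| <= A%:R ^+ 2.
  apply: (@le_trans _ _ (\sum_(1 <= a < A.+1) A%:R)).
    rewrite big_mkcond /= !big_nat; apply: ler_sum => a /andP[a0 aA]; case: ifP => // _.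
    by apply: le_trans (cc_le_id R kk a0) _; rewrite ler_nat -ltnS.
  by rewrite big_const_nat iter_addr addr0 subn1 /= -[X in X <= _]mulr_natl expr2.
have -> : A%:R ^+ 4 = A%:R ^+ 2 * A%:R ^+ 2 :> R by rewrite -exprD.
by apply: ler_pM => //; apply: sumr_ge0.
Qed.

(** Each such m is charged to its own smooth part, a divisor greater than A. *)
Lemma count_bad_le (R : realType) X y A :
  \sum_(1 <= m < X.+1 | (A < m`_(upto y))%N) 1 <=
  X%:R * \sum_(1 <= a < X.+1 | smooth y a && (A < a)%N) a%:R^-1 :> R.
Proof.
apply: (@le_trans _ _ (\sum_(1 <= m < X.+1) \sum_(1 <= a < X.+1 | smooth y a && (A < a)%N) (a %| m)%N%:R)).
  rewrite big_mkcond /= !big_nat; apply: ler_sum => m /andP[m0 mX].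
  case: ifP => h; last by apply: sumr_ge0.
  have e : 1 = (m`_(upto y) %| m)%N%:R :> R by rewrite dvdn_part.
  rewrite [X in X <= _]e; apply: (@le_sum_mem R _ (fun a => smooth y a && (A < a)%N) (fun a => (a %| m)%N%:R)).
  - by [].
  - by rewrite mem_index_iota part_gt0 /=; apply: leq_ltn_trans (dvdn_leq m0 (dvdn_part _ _)) mX.
  - by rewrite smooth_part.
rewrite exchange_big /= mulr_sumr big_nat_cond [X in _ <= X]big_nat_cond; apply: ler_sum => a /andP[/andP[a0 _] _].
rewrite -natr_sum -divn_count_dvd ler_pdivlMr ?ltr0n // -natrM ler_nat leq_trunc_div //.
Qed.

Lemma mul_le_fourth_powers (R : realFieldType) (a b T : R) : 0 < T ->
  a * b <= T + (a ^+ 4 + b ^+ 4) / T.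
Proof.
move=> T0; rewrite -(ler_pM2r T0) mulrDl divfK ?gt_eqF // -expr2.
have e4 (x : R) : x ^+ 4 = (x ^+ 2) ^+ 2 by rewrite -exprM.
have h1 := sqr_ge0 (a ^+ 2 - b ^+ 2); have h2 := sqr_ge0 (a * b - T).
have h3 := sqr_ge0 T; have h4 := sqr_ge0 (a * b).
rewrite !e4; rewrite sqrrB in h1; rewrite sqrrB in h2.
have h5 : (a * b) ^+ 2 = a ^+ 2 * b ^+ 2 by rewrite exprMn.
move: h1 h2 h3 h4 h5; move: (T ^+ 2) ((a * b) ^+ 2) ((a ^+ 2) ^+ 2) ((b ^+ 2) ^+ 2) (a ^+ 2 * b ^+ 2) => ? ? ? ? ?.
by rewrite !mulr2n; move: (a * b * T) => ?; lra.
Qed.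

(** By [mul_le_fourth_powers] each term costs T plus fourth powers divided by T. One of n + 2, n - 2
    has a large smooth part, and both maps are injective on the window, so the sums extend to all m
    <= N + 2. *)
Lemma bad_sum (R : realType) k l N z y A (T : R) : (1 < z)%N -> 0 < T ->
  \sum_(n <- window N z | ~~ (((n + 2)`_(upto y) <= A)%N && ((n - 2)`_(upto y) <= A)%N))
     `|cc R k (n + 2)| * `|cc R l (n - 2)|
  <= 2 * T * ((N + 2)%:R * \sum_(1 <= a < (N + 2).+1 | smooth y a && (A < a)%N) a%:R^-1)
   + 2 / T * \sum_(1 <= m < (N + 2).+1) cc R 0 m ^+ 4.
Proof.
move=> z1 T0.
pose ind m : R := (A < m`_(upto y))%N%:R.
pose q m : R := cc R 0 m ^+ 4.
have q0 m : 0 <= q m by rewrite exprn_ge0 ?cc0_ge0.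
apply: (@le_trans _ _ (\sum_(n <- window N z) ((T * ind (n + 2)%N + q (n + 2)%N / T) + (T * ind (n - 2)%N + q (n - 2)%N / T)))).
  rewrite big_mkcond /=; apply: ler_sum => n _.
  have i0 m : 0 <= ind m by [].
  have p0 m : 0 <= T * ind m + q m / T.
    exact: addr_ge0 (mulr_ge0 (ltW T0) (i0 m)) (divr_ge0 (q0 m) (ltW T0)).
  case: ifP => hb; last by rewrite addr_ge0 ?p0.
  have i1 : 1 <= ind (n + 2)%N + ind (n - 2)%N.
    rewrite /ind -natrD ler1n; move: hb; rewrite negb_and -!ltnNge.
    by case: (A < _)%N => //=; case: (A < _)%N.
  have ha : `|cc R k (n + 2)| ^+ 4 <= q (n + 2)%N.
    by apply: lerXn2r; rewrite ?nnegrE ?cc0_ge0 ?normr_ge0 ?cc_le_cc0.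
  have hb' : `|cc R l (n - 2)| ^+ 4 <= q (n - 2)%N.
    by apply: lerXn2r; rewrite ?nnegrE ?cc0_ge0 ?normr_ge0 ?cc_le_cc0.
  apply: le_trans (mul_le_fourth_powers _ _ T0) _.
  have := ler_wpM2r (ltW (_ : 0 < T^-1)) (lerD ha hb'); rewrite invr_gt0 => /(_ T0).
  have : T <= T * (ind (n + 2)%N + ind (n - 2)%N) by rewrite ler_peMr // ltW.
  rewrite !mulrDl mulrDr; lra.
have shift (F : nat -> R) (s : nat -> nat) : (forall m, 0 <= F m) ->
    {in window N z &, injective s} -> (forall n, n \in window N z -> (0 < s n <= N + 2)%N) ->
    \sum_(n <- window N z) F (s n) <= \sum_(1 <= m < (N + 2).+1) F m.
  move=> F0 injs hs; rewrite -(big_map s xpredT F); apply: sum_uniq_sub => //.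
  - by rewrite map_inj_in_uniq // window_uniq.
  - exact: iota_uniq.
  by move=> m /mapP[n hn ->]; rewrite mem_index_iota ltnS; exact: hs.
have n3 n : n \in window N z -> (2 < n <= N)%N.
  by move=> /(window_spec z1)[_ _ zn ->]; rewrite (leq_ltn_trans z1 zn).
pose F m : R := T * ind m + q m / T.
have F0 m : 0 <= F m by exact: addr_ge0 (mulr_ge0 (ltW T0) (ler0n _ _)) (divr_ge0 (q0 m) (ltW T0)).
have h1 := @shift F (fun n => (n + 2)%N) F0 (fun n m _ _ => @addIn 2 n m) _.
have h2 := @shift F (fun n => (n - 2)%N) F0 _ _.
rewrite big_split /=; apply: le_trans (lerD (h1 _) (h2 _ _)) _.
- by move=> n /n3; lia.
- by move=> n m /n3 hn /n3 hm; lia.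
- by move=> n /n3; lia.
rewrite /F big_split /= -mulr_sumr -mulr_suml.
have e : \sum_(1 <= m < (N + 2).+1) ind m = \sum_(1 <= m < (N + 2).+1 | (A < m`_(upto y))%N) 1.
  by rewrite [RHS]big_mkcond; apply: eq_bigr => m _; rewrite /ind; case: ifP.
rewrite e; have := ler_wpM2l (ltW T0) (@count_bad_le R (N + 2) y A).
move: (\sum_(1 <= m < _ | _) 1) (_%:R * \sum_(1 <= a < _ | _) _) (\sum_(1 <= m < _) q m) => u v w; lra.
Qed.

(** * Choice of the sieve parameters *)

Lemma expR_half_le2 (R : realType) : expR (1 / 2) <= 2 :> R.
Proof.
have := expR_ge1Dx (- (1 / 2) : R); rewrite expRN.
have -> : 1 + - (1 / 2) = 2^-1 :> R by field.
by rewrite lef_pV2 ?posrE ?expR_gt0.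
Qed.

Lemma ln2_le1 (R : realType) : ln 2 <= 1 :> R.
Proof.
rewrite -[X in _ <= X](expRK (1 : R)) ler_ln ?posrE ?expR_gt0 //.
by have := expR_ge1Dx (1 : R).
Qed.

Lemma pow_inv2_le (R : realType) j : 2^-1 ^+ j <= expR (- (j%:R / 2)) :> R.
Proof.
have -> : - (j%:R / 2) = j%:R * - (1 / 2) :> R by field.
rewrite expRM_natl; apply: lerXn2r; rewrite ?nnegrE ?expR_ge0 ?invr_ge0 //.
by rewrite expRN lef_pV2 ?posrE ?expR_gt0 // expR_half_le2.
Qed.

Lemma truncn_exp (R : realType) (t : R) : 0 <= t ->
  [/\ (Num.truncn (expR t))%:R <= expR t, t < ln (Num.truncn (expR t)).+1%:R,
      ln (Num.truncn (expR t))%:R <= t & (0 < Num.truncn (expR t))%N].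
Proof.
move=> t0; have h1 : (Num.truncn (expR t))%:R <= expR t by rewrite truncn_le ?expR_ge0.
have h2 : expR t < (Num.truncn (expR t)).+1%:R by exact: truncnS_gt.
have h3 : (0 < Num.truncn (expR t))%N.
  have : 1 <= expR t by rewrite -[X in X <= _]expR0 ler_expR.
  by rewrite truncn_gt0.
split=> //; first by rewrite -{1}(expRK t) ltr_ln ?posrE ?expR_gt0 // ltr0n.
by rewrite -{2}(expRK t) ler_ln ?posrE ?expR_gt0 // ltr0n.
Qed.

(** Absorbs the cube of ln ln N, lost in passing from ln N to ln z, into (ln N)^(1/20). *)
Lemma cube_le_exp (R : realType) (x : R) : 0 <= x -> x ^+ 3 <= 60 ^+ 3 * expR (x / 20).
Proof.
move=> x0; have h : x <= 60 * expR (x / 60).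
  have := expR_ge1Dx (x / 60); have : 60 * (x / 60) = x by field.
  lra.
apply: (@le_trans _ _ ((60 * expR (x / 60)) ^+ 3)).
  by apply: lerXn2r; rewrite ?nnegrE ?mulr_ge0 ?expR_ge0.
by rewrite exprMn -expRM_natl; have -> : 3%:R * (x / 60) = x / 20 by field.
Qed.

Lemma slope_le (R : realType) k l : (k != 0%N) || (l != 0%N) ->
  cc_slope R k + cc_slope R l <= 7 / 4.
Proof. by rewrite /cc_slope; case: eqVneq => _; case: eqVneq => _ //= _; lra. Qed.

(* Throughout, e = ln ln N and L = ln N; the sieve removes primes up to [slevel], the smooth
   parts are taken with respect to [ylevel], and j is the truncation level of Brun's sieve. *)
Definition slevel (R : realType) (e : R) := Num.truncn (expR (expR e / (100 * e))).
Definition ylevel (R : realType) (e : R) := Num.truncn (expR (40 * expR e / e)).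
Definition alevel (R : realType) (e : R) := Num.truncn (expR (expR e / 8)).
Definition jlevel (R : realType) (e : R) := (Num.truncn (9 * e)).+1.*2.

Lemma exp_ge_500 (R : realType) (e : R) : 1000 <= e -> 500 * e <= expR e.
Proof.
move=> he; have e0 : 0 < e by lra.
apply: le_trans (expR_ge1Dxn 1 (ltW e0)).
have -> : (1.+1)`!%:R = 2 :> R by [].
have : 1000 * e <= e ^+ 2 by rewrite expr2 ler_pM2r.
by move: (e ^+ 2) => t; lra.
Qed.

Lemma tz_bounds (R : realType) (e : R) : 1000 <= e ->
  5 <= expR e / (100 * e) /\ expR e / (100 * e) <= expR e / 100.
Proof.
move=> he; have hL := exp_ge_500 he; have e100 : 0 < 100 * e by lra.
split; first by rewrite ler_pdivlMr //; lra.
rewrite ler_wpM2l ?expR_ge0 // lef_pV2 ?posrE //; lra.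
Qed.

Lemma ty_bounds (R : realType) (e : R) : 1000 <= e ->
  expR e / (100 * e) <= 40 * expR e / e /\ 40 * expR e / e <= expR e.
Proof.
move=> he; have L0 := expR_gt0 e; have e0 : 0 < e by lra.
split.
  have -> : 40 * expR e / e = (40 * 100) * (expR e / (100 * e)) by field; rewrite gt_eqF.
  by rewrite ler_peMl ?divr_ge0 ?mulr_ge0 ?ltW //; lra.
by rewrite ler_pdivrMr // mulrC ler_pM2l //; lra.
Qed.

Lemma level_facts (R : realType) (e : R) : 1000 <= e ->
  [/\ (4 <= slevel e)%N, (slevel e <= ylevel e)%N, ln (slevel e)%:R <= expR e,
      ln (ylevel e)%:R <= expR e & expR e / (100 * e) <= ln (slevel e).+1%:R].
Proof.
move=> he; have [t5 tL] := tz_bounds he; have [tzy tyL] := ty_bounds he.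
have L0 := expR_gt0 e.
have tz0 : 0 <= expR e / (100 * e) by lra.
have ty0 : 0 <= 40 * expR e / e by lra.
have [a1 a2 a3 a4] := truncn_exp tz0; have [b1 b2 b3 b4] := truncn_exp ty0.
split; rewrite /slevel /ylevel.
- rewrite -ltnS -(ltr_nat R); apply: lt_trans (truncnS_gt _).
  by have := expR_ge1Dx (expR e / (100 * e)); lra.
- by rewrite le_truncn // ler_expR.
- by apply: le_trans a3 _; lra.
- exact: le_trans b3 tyL.
- exact: ltW.
Qed.

(** Exponents of ln N: the main term has -3 + 1/20 = -59/20 by [cube_le_exp]; in the truncation
    error j >= 18 e gives 2^(-j) <= exp(-9 e), against +6 from the product, hence -3. *)
Lemma sieve_density (R : realType) : exists K : R, 0 < K /\ forall e : R, 1000 <= e ->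
  expR 30 * (ln (slevel e).+1%:R) ^- 3 + 2^-1 ^+ jlevel e * expR (6 * \sum_(p <- pr (slevel e)) p%:R^-1)
  <= K * expR (- (59 / 20) * e).
Proof.
have [C [C0 hC]] := prime_inv_sum R.
pose K1 := expR 30 * (100 * 60) ^+ 3 : R.
have K10 : 0 < K1 by apply: mulr_gt0; [exact: expR_gt0 | apply: exprn_gt0; apply: mulr_gt0; exact: ltr0n].
exists (K1 + expR (6 * C)); split; first by apply: addr_gt0 K10 (expR_gt0 _).
move=> e he; have e0 : 0 < e by lra.
have [z4 zy lz ly lz1] := level_facts he; have [t5 tL] := tz_bounds he.
have L0 := expR_gt0 e.
rewrite [X in _ <= X]mulrDl; apply: lerD.
  rewrite /K1 -mulrA ler_wpM2l ?expR_ge0 //.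
  have tz0 : 0 < expR e / (100 * e) by lra.
  apply: (@le_trans _ _ ((expR e / (100 * e)) ^- 3)).
    rewrite lef_pV2 ?posrE ?exprn_gt0 //; last exact: lt_le_trans lz1.
    by apply: lerXn2r; rewrite ?nnegrE ?(ltW tz0) // (le_trans (ltW tz0)).
  have -> : (expR e / (100 * e)) ^- 3 = 100 ^+ 3 * (e ^+ 3 / expR e ^+ 3).
    by rewrite -exprVn invf_div expr_div_n exprMn mulrA.
  have -> : (100 * 60) ^+ 3 * expR (- (59 / 20) * e) = 100 ^+ 3 * (60 ^+ 3 * expR (e / 20) / expR e ^+ 3) :> R.
    rewrite exprMn -[LHS]mulrA -[X in _ = _ * X]mulrA; congr (_ * (_ * _)).
    by rewrite -expRM_natl -expRN -expRD; congr expR; field.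
  rewrite ler_wpM2l ?exprn_ge0 // ler_wpM2r ?invr_ge0 ?exprn_ge0 ?(ltW L0) //.
  exact: cube_le_exp (ltW e0).
apply: (@le_trans _ _ (expR (- (9 * e)) * expR (6 * (e + C)))).
  apply: ler_pM; rewrite ?expR_ge0 ?exprn_ge0 ?invr_ge0 //.
    apply: le_trans (pow_inv2_le R _) _; rewrite ler_expR lerN2 /jlevel.
    by rewrite -mul2n natrM [X in _ <= X]mulrAC divff ?mul1r ?(ltW (truncnS_gt _)).
  rewrite ler_expR ler_pM2l //; apply: le_trans (hC _ z4) _; rewrite lerD2r.
  by rewrite -[X in _ <= X](expRK e) ler_ln ?posrE // ln_gt0 // ltr1n (leq_trans _ z4).
by rewrite -!expRD ler_expR; lra.
Qed.

(** With ln y about 40 ln N / e and ln (N + 2) <= 2 ln N, the exponent is at most 2 e / 40. *)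
Lemma rough_factor_le (R : realType) (e : R) N : 1000 <= e -> N%:R = expR (expR e) ->
  rough_factor R N (ylevel e) <= expR (e / 20).
Proof.
move=> he hN; have L0 := expR_gt0 e; have e0 : 0 < e by lra.
have hL := exp_ge_500 he.
have ty0 : 0 < 40 * expR e / e by rewrite divr_gt0 // mulr_gt0.
have [_ b2 _ _] := truncn_exp (ltW ty0).
have ly0 : 0 < ln (ylevel e).+1%:R :> R by exact: lt_trans b2.
have lN : ln (N + 2)%:R <= 2 * expR e.
  have -> : 2 * expR e = ln (N%:R ^+ 2) by rewrite lnXn ?hN ?expR_gt0 // expRK mulr_natl.
  have N2 : 2 <= N%:R :> R by rewrite hN; have := expR_ge1Dx (expR e); lra.
  rewrite ler_ln ?posrE ?ltr0n ?exprn_gt0 ?addn2 //; last by lra.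
  rewrite -addn2 natrD expr2; have : 2 * N%:R <= N%:R * N%:R :> R by rewrite ler_pM2r //; lra.
  lra.
rewrite /rough_factor ler_expR.
apply: (@le_trans _ _ (1 / ln (ylevel e).+1%:R * (2 * expR e))).
  apply: ler_pM; rewrite ?divr_ge0 ?ln_ge0 ?ler1n ?(ltW ly0) ?addn2 //; last by rewrite -addn2.
  by rewrite ler_wpM2r ?invr_ge0 ?(ltW ly0) ?ln2_le1.
rewrite mul1r mulrC ler_pdivrMr //.
apply: (@le_trans _ _ (e / 20 * (40 * expR e / e))).
  by rewrite le_eqVlt; apply/orP; left; apply/eqP; field; rewrite gt_eqF.
by rewrite ler_wpM2l ?(ltW b2) // divr_ge0 // ltW.
Qed.

(** As j <= 20 e and ln z is about ln N / (100 e), z^j is about N^(1/5), while A^4 <= N^(1/2): a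
    power of N is left over. *)
Lemma brun_error_le (R : realType) (e : R) N : 1000 <= e -> N%:R = expR (expR e) ->
  expR 3 * (slevel e).+1%:R ^+ jlevel e * (alevel e)%:R ^+ 4 <= N%:R * expR (- 2 * e).
Proof.
move=> he hN; have L0 := expR_gt0 e; have e0 : 0 < e by lra.
have hL := exp_ge_500 he; have [t5 tL] := tz_bounds he.
have tz0 : 0 <= expR e / (100 * e) by lra.
have hA : (alevel e)%:R ^+ 4 <= expR (expR e / 2).
  have [a1 _ _ _] := @truncn_exp R (expR e / 8) (divr_ge0 (ltW L0) (ler0n _ _)).
  have -> : expR (expR e / 2) = expR (expR e / 8) ^+ 4 by rewrite -expRM_natl; congr expR; field.
  by apply: lerXn2r; rewrite ?nnegrE ?expR_ge0.
have hz : (slevel e).+1%:R <= expR (expR e / (100 * e) + 1).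
  have [c1 _ _ _] := truncn_exp tz0.
  rewrite -natr1 expRD; have h2 := expR_ge1Dx (1 : R); have h3 := expR_ge1Dx (expR e / (100 * e)).
  move: c1 h2 h3 tz0; rewrite -/(slevel e); move: (expR e / (100 * e)) (slevel e) => t s; clear.
  move: (expR t) (expR 1) => u v h1 h2 h3 t0.
  have : u * 2 <= u * v by rewrite ler_wpM2l //; lra.
  lra.
have hj : (jlevel e)%:R <= 20 * e.
  have h9 : (Num.truncn (9 * e))%:R <= 9 * e by rewrite truncn_le // mulr_ge0 // ltW.
  by rewrite /jlevel -mul2n natrM -natr1; clear -he h9; lra.
have hzj : (slevel e).+1%:R ^+ jlevel e <= expR (expR e / 5 + 20 * e).
  apply: (@le_trans _ _ (expR (expR e / (100 * e) + 1) ^+ jlevel e)).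
    by apply: lerXn2r; rewrite ?nnegrE ?expR_ge0.
  rewrite -expRM_natl ler_expR.
  have -> : expR e / 5 + 20 * e = 20 * e * (expR e / (100 * e) + 1) by field; rewrite gt_eqF.
  by rewrite ler_wpM2r // addr_ge0.
apply: (@le_trans _ _ (expR 3 * expR (expR e / 5 + 20 * e) * expR (expR e / 2))).
  have q0 : 0 <= (slevel e).+1%:R ^+ jlevel e :> R by exact: exprn_ge0 (ler0n _ _).
  have A40 : 0 <= (alevel e)%:R ^+ 4 :> R by exact: exprn_ge0 (ler0n _ _).
  apply: (ler_pM (mulr_ge0 (expR_ge0 3) q0) A40 _ hA).
  exact: ler_wpM2l (expR_ge0 3) _ _ hzj.
by rewrite hN -!expRD ler_expR; clear -he hL; lra.
Qed.

(** Exponents of ln N: -59/20 from the sieve, 1/10 from two rough factors, at most 7/4 from the two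
    mean values; the total -11/10 is below -21/20. *)
Lemma good_pairs (R : realType) k l : (k != 0%N) || (l != 0%N) -> exists K : R, 0 < K /\
  forall (e : R) N, 1000 <= e -> N%:R = expR (expR e) ->
  \sum_(n <- window N (slevel e) | ((n + 2)`_(upto (ylevel e)) <= alevel e)%N
        && ((n - 2)`_(upto (ylevel e)) <= alevel e)%N)
     `|cc R k (n + 2)| * `|cc R l (n - 2)| <= K * N%:R * expR (- (21 / 20) * e).
Proof.
move=> kl; have [K1 [K10 hK1]] := sieve_density R.
have [Kk [Kk0 hKk]] := smooth_cc_mean R k; have [Kl [Kl0 hKl]] := smooth_cc_mean R l.
exists (2 * K1 * Kk * Kl + 1); split; first by rewrite addr_gt0 // !mulr_gt0.
move=> e N he hN; have L0 := expR_gt0 e; have e0 : 0 < e by lra.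
have hL := exp_ge_500 he.
have [z4 zy lz ly lz1] := level_facts he; have [t5 tL] := tz_bounds he.
have oj : ~~ odd (jlevel e) by rewrite /jlevel odd_double.
have z1 : (1 < slevel e)%N by apply: leq_trans z4.
apply: le_trans (good_sum R k l N (alevel e) z1 zy oj) _.
set T := expR 30 * _ + _; set Sk := \sum_(_ <= _ < _ | _) _; set Sl := \sum_(_ <= _ < _ | _) _.
have hT : T <= K1 * expR (- (59 / 20) * e) by exact: hK1.
have T0 : 0 <= T.
  by rewrite addr_ge0 // mulr_ge0 ?expR_ge0 // ?invr_ge0 ?exprn_ge0 ?ln_ge0 ?ler1n ?invr_ge0.
have y4 : (4 <= ylevel e)%N by exact: leq_trans z4 zy.
have lly : ln (ln (ylevel e)%:R) <= e.
  by rewrite -[X in _ <= X](expRK e) ler_ln ?posrE // ln_gt0 // ltr1n; exact: leq_trans y4.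
have S_le kk KK : 0 < KK -> (forall X y, (4 <= y)%N ->
     \sum_(1 <= a < X.+1 | smooth y a) `|cc R kk a| * hfun R a / a%:R <= KK * expR (cc_slope R kk * ln (ln y%:R))) ->
    \sum_(1 <= a < (alevel e).+1 | smooth (ylevel e) a) `|cc R kk a| * hfun R a / a%:R <= KK * expR (cc_slope R kk * e).
  move=> KK0 h; apply: le_trans (h _ _ y4) _; rewrite ler_pM2l // ler_expR ler_wpM2l //.
  by rewrite /cc_slope; case: ifP => _; rewrite ?ler01 // divr_ge0.
have hSk : Sk <= Kk * expR (cc_slope R k * e) by exact: S_le.
have hSl : Sl <= Kl * expR (cc_slope R l * e) by exact: S_le.
have S0 kk : 0 <= \sum_(1 <= a < (alevel e).+1 | smooth (ylevel e) a) `|cc R kk a| * hfun R a / a%:R.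
  by apply: sumr_ge0 => a _; rewrite divr_ge0 // mulr_ge0 ?expR_ge0.
have hE : rough_factor R N (ylevel e) ^+ 2 <= expR (e / 10).
  have -> : expR (e / 10) = expR (e / 20) ^+ 2 by rewrite -expRM_natl; congr expR; field.
  by apply: lerXn2r; rewrite ?nnegrE ?expR_ge0 ?rough_factor_le.
have N1 : 1 <= N%:R :> R by rewrite hN -[X in X <= _]expR0 ler_expR ltW.
have NS : N.+1%:R <= 2 * N%:R :> R by rewrite -natr1; clear -N1; lra.
have part1 : N.+1%:R * T * Sk * Sl <= 2 * N%:R * (K1 * expR (- (59 / 20) * e)) * (Kk * expR (cc_slope R k * e)) * (Kl * expR (cc_slope R l * e)).
  by do 3![apply: ler_pM; rewrite ?mulr_ge0 ?S0 //].
have part2 := brun_error_le he hN.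
apply: (@le_trans _ _ (expR (e / 10) * (2 * N%:R * (K1 * expR (- (59 / 20) * e)) * (Kk * expR (cc_slope R k * e)) * (Kl * expR (cc_slope R l * e)) + N%:R * expR (- 2 * e)))).
  apply: ler_pM => //; first by rewrite exprn_ge0 // expR_ge0.
    by rewrite addr_ge0 // !mulr_ge0 ?S0 ?expR_ge0 ?exprn_ge0.
  exact: lerD.
have -> : expR (e / 10) * (2 * N%:R * (K1 * expR (- (59 / 20) * e)) * (Kk * expR (cc_slope R k * e)) * (Kl * expR (cc_slope R l * e)) + N%:R * expR (- 2 * e))
  = (2 * K1 * Kk * Kl) * N%:R * expR (e / 10 + - (59 / 20) * e + (cc_slope R k + cc_slope R l) * e) + N%:R * expR (e / 10 + - 2 * e).
  have -> : e / 10 + - (59 / 20) * e + (cc_slope R k + cc_slope R l) * e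
    = e / 10 + (- (59 / 20) * e) + (cc_slope R k * e) + (cc_slope R l * e) by ring.
  rewrite !expRD; move: (expR (e / 10)) (expR (- (59 / 20) * e)) (expR (cc_slope R k * e)) => u1 u2 u3.
  by move: (expR (cc_slope R l * e)) (expR (- 2 * e)) => u4 u5; ring.
rewrite [in X in _ <= X * _]mulrDl [in X in _ <= X]mulrDl [in X in _ <= _ + X * _]mul1r; apply: lerD.
  rewrite ler_wpM2l ?mulr_ge0 ?(ltW K10) ?(ltW Kk0) ?(ltW Kl0) // ler_expR.
  have : (cc_slope R k + cc_slope R l) * e <= 7 / 4 * e by rewrite ler_wpM2r ?slope_le // ltW.
  by clear -e0; move: (_ * e) => t; lra.
by rewrite ler_wpM2l // ler_expR; clear -e0; lra.
Qed.

Lemma ln_add2 (R : realType) (e : R) N : 1000 <= e -> N%:R = expR (expR e) ->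
  [/\ (N + 2)%:R <= 2 * N%:R :> R, 0 < ln (ln (N + 2)%:R) :> R & ln (ln (N + 2)%:R) <= e + 1].
Proof.
move=> he hN; have L0 := expR_gt0 e; have hL := exp_ge_500 he.
have N2 : 2 <= N%:R :> R by rewrite hN; have := expR_ge1Dx (expR e); lra.
have h2 : (N + 2)%:R <= 2 * N%:R :> R by rewrite natrD; lra.
have lN : expR e <= ln (N + 2)%:R :> R.
  have N0 : 0 < N%:R :> R by rewrite hN expR_gt0.
  by rewrite -[X in X <= _](expRK (expR e)) -hN ler_ln ?posrE ?N0 ?ltr0n ?addn2 // ler_nat -addn2 leq_addr.
have l0 : 0 < ln (N + 2)%:R :> R by exact: lt_le_trans lN.
split=> //; first by rewrite ln_gt0 //; apply: lt_le_trans lN; lra.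
rewrite -[X in _ <= X](expRK (e + 1)) ler_ln ?posrE ?expR_gt0 //.
apply: (@le_trans _ _ (ln (2 * N%:R))).
  have Np : 0 < (N + 2)%:R :> R by rewrite ltr0n addn2.
  by rewrite ler_ln // posrE ?Np // (lt_le_trans Np h2).
rewrite lnM ?posrE //; last by lra.
rewrite hN expRK expRD; have := ln2_le1 R; have h1 := expR_ge1Dx (1 : R).
have : expR e * 2 <= expR e * expR 1 by rewrite ler_pM2l //; lra.
by move: hL he; clear; move: (expR e * expR 1) => t; lra.
Qed.

(** T = (ln N)^18 balances the terms of [bad_sum]: the count gives 18 + 4 - 24 = -2 by
    [rankin_smooth], the fourth moments 16 - 18 = -2. *)
Lemma bad_pairs (R : realType) : exists K : R, 0 < K /\
  forall k l (e : R) N, 1000 <= e -> N%:R = expR (expR e) ->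
  \sum_(n <- window N (slevel e) | ~~ (((n + 2)`_(upto (ylevel e)) <= alevel e)%N
        && ((n - 2)`_(upto (ylevel e)) <= alevel e)%N))
     `|cc R k (n + 2)| * `|cc R l (n - 2)| <= K * N%:R * expR (- 2 * e).
Proof.
(* With the Rankin exponent ep = A0 e / (40 expR e), the cut-off A = N^(1/8) saves ep ln A = A0 e /
   320 = 24 e, while ep ln y stays below A0. *)
pose A0 := 320 * 24 : R; have A00 : 0 <= A0 by apply: mulr_ge0; exact: ler0n.
have [K1 [K10 hK1]] := rankin_smooth A00; have [K2 [K20 hK2]] := fourth_moment R.
exists (4 * K1 + 4 * K2 * expR 16); split; first by rewrite addr_gt0 // !mulr_gt0 ?expR_gt0.
move=> k l e N he hN; have L0 := expR_gt0 e; have e0 : 0 < e by lra.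
have hL := exp_ge_500 he.
have [z4 zy lz ly lz1] := level_facts he.
have z1 : (1 < slevel e)%N by apply: leq_trans z4.
have y4 : (4 <= ylevel e)%N by exact: leq_trans z4 zy.
have [N2 ll0 llN] := ln_add2 he hN.
have N0 : 0 <= N%:R :> R by [].
apply: le_trans (bad_sum k l N (ylevel e) (alevel e) z1 (expR_gt0 (18 * e))) _.
pose ep := A0 * e / (40 * expR e).
have ep0 : 0 <= ep by exact: divr_ge0 (mulr_ge0 A00 (ltW e0)) (mulr_ge0 (ler0n _ 40) (ltW L0)).
have ep2 : ep <= 1 / 2.
  by rewrite /ep ler_pdivrMr ?mulr_gt0 // /A0; clear -hL e0; lra.
have ty0 : 0 <= 40 * expR e / e by rewrite divr_ge0 ?mulr_ge0 ?ltW.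
have [_ _ b3 _] := truncn_exp ty0.
have epy : ep * ln (ylevel e)%:R <= A0.
  apply: (@le_trans _ _ (ep * (40 * expR e / e))); first by rewrite ler_wpM2l.
  by rewrite le_eqVlt; apply/orP; left; apply/eqP; rewrite /ep; field; rewrite !gt_eqF.
have [_ a2 _ _] := @truncn_exp R (expR e / 8) (divr_ge0 (ltW L0) (ler0n _ _)).
have lly : ln (ln (ylevel e)%:R) <= e.
  by rewrite -[X in _ <= X](expRK e) ler_ln ?posrE // ln_gt0 // ltr1n; exact: leq_trans y4.
have h1 := hK1 (N + 2)%N _ (alevel e) ep y4 ep0 ep2 epy.
have h2 := hK2 (N + 2)%N _.
have epA : 24 * e <= ep * ln (alevel e).+1%:R.
  have -> : 24 * e = ep * (expR e / 8) by rewrite /ep /A0; clear -e0 L0; field; rewrite !gt_eqF.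
  by rewrite ler_wpM2l // ltW.
have -> : (4 * K1 + 4 * K2 * expR 16) * N%:R * expR (- 2 * e) = 4 * K1 * N%:R * expR (- 2 * e) + 4 * K2 * expR 16 * N%:R * expR (- 2 * e).
  by move: (expR 16) (expR (- 2 * e)) => u1 u2; ring.
apply: lerD.
  apply: (@le_trans _ _ (2 * expR (18 * e) * (2 * N%:R * (K1 * expR (4 * e) * expR (- (24 * e)))))).
    rewrite ler_wpM2l ?mulr_ge0 ?expR_ge0 //; apply: ler_pM => //.
      by apply: sumr_ge0 => a _; rewrite invr_ge0.
    apply: le_trans h1 _; apply: ler_pM; rewrite ?mulr_ge0 ?expR_ge0 ?(ltW K10) //.
      by rewrite ler_pM2l // ler_expR ler_pM2l.
    by rewrite ler_expR mulNr lerN2.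
  have -> : - 2 * e = 18 * e + 4 * e + - (24 * e) by ring.
  rewrite !expRD; move: (expR (18 * e)) (expR (4 * e)) (expR (- (24 * e))) => u1 u2 u3.
  by rewrite le_eqVlt; apply/orP; left; apply/eqP; ring.
have X4 : (4 <= N + 2)%N.
  have : 2 <= N%:R :> R by rewrite hN; have := expR_ge1Dx (expR e); lra.
  by rewrite ler_nat; clear; lia.
apply: (@le_trans _ _ (2 / expR (18 * e) * (K2 * (2 * N%:R) * expR (16 * (e + 1))))).
  rewrite ler_wpM2l ?divr_ge0 ?expR_ge0 //; apply: le_trans (h2 X4) _.
  apply: ler_pM; rewrite ?mulr_ge0 ?expR_ge0 ?(ltW K20) //; first by rewrite ler_wpM2l // ltW.
  by rewrite ler_expR ler_pM2l.
rewrite -expRN.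
have -> : 16 * (e + 1) = 16 * e + 16 by ring.
have -> : - 2 * e = - (18 * e) + 16 * e by ring.
rewrite (expRD (16 * e)) (expRD (- (18 * e))); move: (expR (- (18 * e))) (expR (16 * e)) (expR 16) => u1 u2 u3.
by rewrite le_eqVlt; apply/orP; left; apply/eqP; ring.
Qed.

Lemma small_pairs (R : realType) k l (e : R) N : 1000 <= e -> N%:R = expR (expR e) ->
  \sum_(n <- iota 0 N.+1 | [&& prime n, (2 < n)%N & (n <= slevel e)%N])
     `|cc R k (n + 2)| * `|cc R l (n - 2)| <= N%:R * expR (- 2 * e).
Proof.
move=> he hN; have L0 := expR_gt0 e; have e0 : 0 < e by lra.
have hL := exp_ge_500 he; have [t5 tL] := tz_bounds he.
have [z4 _ _ _ _] := level_facts he.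
have tz0 : 0 <= expR e / (100 * e) by lra.
have [c1 _ _ _] := truncn_exp tz0; rewrite -/(slevel e) in c1.
set s := slevel e in z4 c1 *.
apply: (@le_trans _ _ (\sum_(n <- iota 0 s.+1) (2 * s%:R) * (s%:R : R))).
  rewrite -big_filter.
  apply: (@le_trans _ _ (\sum_(n <- [seq n <- iota 0 N.+1 | [&& prime n, (2 < n)%N & (n <= s)%N]]) (2 * s%:R) * (s%:R : R))).
    rewrite big_seq [X in _ <= X]big_seq; apply: ler_sum => n; rewrite mem_filter => /andP[/and3P[_ n2 ns] _].
    apply: ler_pM => //.
      apply: le_trans (cc_le_id _ _ _) _; first by rewrite addn2.
      by rewrite -natrM ler_nat mul2n -addnn leq_add // (leq_trans _ z4).
    apply: le_trans (cc_le_id _ _ _) _; first by rewrite subn_gt0.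
    by rewrite ler_nat (leq_trans (leq_subr _ _)).
  apply: sum_uniq_sub; [by move=> j; rewrite !mulr_ge0 | by apply: filter_uniq; exact: iota_uniq | exact: iota_uniq|].
  by move=> n; rewrite mem_filter !mem_iota !ltnS => /andP[/and3P[_ _ ->]].
rewrite big_const_seq count_predT size_iota iter_addr_0 -[X in X <= _]mulr_natr.
have s1 : s.+1%:R <= 2 * s%:R :> R by rewrite -natrM ler_nat mul2n -addnn -addn1 leq_add2l (leq_trans _ z4).
have s0 : 0 <= s%:R :> R by [].
apply: (@le_trans _ _ ((2 * s%:R * s%:R) * (2 * s%:R))); first by rewrite ler_wpM2l // !mulr_ge0.
have -> : (2 * s%:R * s%:R) * (2 * s%:R) = 4 * s%:R ^+ 3 :> R by ring.
apply: (@le_trans _ _ (expR 4 * expR (expR e / (100 * e)) ^+ 3)).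
  apply: ler_pM; rewrite ?exprn_ge0 //.
    by have := expR_ge1Dx (4 : R); lra.
  by apply: lerXn2r; rewrite ?nnegrE ?expR_ge0.
rewrite hN -expRM_natl -!expRD ler_expR; move: hL he tL; clear.
by move: (expR e / (100 * e)) (expR e) => t L; lra.
Qed.

Lemma pair_sum (R : realType) k l : (k != 0%N) || (l != 0%N) -> exists K : R, 0 < K /\
  forall (e : R) N, 1000 <= e -> N%:R = expR (expR e) ->
  \sum_(n <- iota 0 N.+1 | prime n && (2 < n)%N)
     `|cc R k (n + 2)| * `|cc R l (n - 2)| <= K * N%:R * expR (- (21 / 20) * e).
Proof.
move=> kl; have [K1 [K10 hK1]] := good_pairs R kl; have [K2 [K20 hK2]] := bad_pairs R.
exists (K1 + K2 + 1); split; first by rewrite !addr_gt0.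
move=> e N he hN.
have z4 : (4 <= slevel e)%N by have [] := level_facts he.
have h3 := small_pairs k l he hN; have h1 := hK1 _ _ he hN; have h2 := hK2 k l _ _ he hN.
have e2 : expR (- 2 * e) <= expR (- (21 / 20) * e) by rewrite ler_expR; clear -he; lra.
set I := iota 0 N.+1 in h3 *.
rewrite (bigID (fun n => (n <= slevel e)%N)) /= [X in X <= _]addrC.
have N0 : 0 <= N%:R :> R by [].
have -> : (K1 + K2 + 1) * N%:R * expR (- (21 / 20) * e) = K1 * N%:R * expR (- (21 / 20) * e)
   + K2 * N%:R * expR (- (21 / 20) * e) + N%:R * expR (- (21 / 20) * e) by ring.
apply: lerD; last first.
  rewrite (eq_bigl (fun n => [&& prime n, (2 < n)%N & (n <= slevel e)%N])); last by move=> n; rewrite andbA.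
  by apply: le_trans h3 _; rewrite ler_wpM2l.
rewrite (eq_bigl (fun n => prime n && (slevel e < n)%N)); last first.
  move=> n /=; rewrite -ltnNge -andbA; congr (_ && _).
  by apply: andb_idl => h; apply: ltn_trans h; apply: leq_trans z4.
rewrite -big_filter; change [seq n <- I | prime n && (slevel e < n)%N] with (window N (slevel e)).
rewrite (bigID (fun n => ((n + 2)`_(upto (ylevel e)) <= alevel e)%N && ((n - 2)`_(upto (ylevel e)) <= alevel e)%N)) /=.
by apply: lerD => //; apply: le_trans h2 _; rewrite ler_wpM2l // mulr_ge0 // ltW.
Qed.

(** * Weyl sums over SL(2, Z) *)

Lemma uniq_flatten_map (S T : eqType) (L : S -> seq T) (tag : T -> S) (s : seq S) : uniq s ->
  (forall b, uniq (L b)) -> (forall b y, y \in L b -> tag y = b) -> uniq (flatten [seq L b | b <- s]).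
Proof.
move=> us uL hL; elim: s us => //= a s IH /andP[as_ us].
rewrite cat_uniq uL IH // andbT; apply/hasPn => y /flatten_mapP[b bs yb].
by apply/negP => ya; move: as_; rewrite -(hL _ _ ya) (hL _ _ yb) bs.
Qed.

Lemma quadbox_uniq M : uniq (quadbox M).
Proof.
apply: (@uniq_flatten_map _ _ _ (fun g : quad => qa g)); first exact: zbox_uniq.
  move=> a; apply: (@uniq_flatten_map _ _ _ (fun g : quad => qb g)); first exact: zbox_uniq.
    by move=> b; apply: allpairs_uniq; rewrite ?zbox_uniq // => -[? ?] [? ?] _ _ [-> ->].
  by move=> b y /allpairsP[] [c d] [_ _ ->].
by move=> a y /flatten_mapP[b _] /allpairsP[] [c d] [_ _ ->].
Qed.

Lemma mem_quadbox M (g : quad) :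
  (g \in quadbox M) = [&& (`|qa g| <= M)%N, (`|qb g| <= M)%N, (`|qc g| <= M)%N & (`|qd g| <= M)%N].
Proof.
rewrite -!mem_zbox; case: g => [[[a b] c] d]; rewrite /qa /qb /qc /qd /=.
apply/flatten_mapP/and4P => [[a' ha] /flatten_mapP[b' hb] /allpairsP[] [c' d'] [/= hc hd [-> -> -> ->]] //|].
move=> [ha hb hc hd]; exists a => //; apply/flatten_mapP; exists b => //.
by apply/allpairsP; exists (c, d).
Qed.

Definition slpair (g : quad) : gauss * gauss :=
  ((qa g + qd g, qb g - qc g), (qa g - qd g, qb g + qc g)).

Lemma nuHE g : (nuH g)%:Z = qa g ^+ 2 + qb g ^+ 2 + qc g ^+ 2 + qd g ^+ 2.
Proof.
have sq (m : int) : (`|m| ^ 2)%N%:Z = m ^+ 2 by lia.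
by rewrite /nuH !PoszD !sq.
Qed.

Lemma slpair_inj : injective slpair.
Proof.
move=> [[[a b] c] d] [[[a' b'] c'] d'] [] /=; rewrite /qa /qb /qc /qd /= => h1 h2 h3 h4.
have ha : a = a' by clear -h1 h3; lia.
have hb : b = b' by clear -h2 h4; lia.
by congr (_, _, _, _) => //; [clear -h2 h4; lia | clear -h1 h3; lia].
Qed.

Lemma slpair_norm g : inSL2Z g -> gnorm (slpair g).1 = (nuH g + 2)%N /\ (gnorm (slpair g).2 + 2 = nuH g)%N.
Proof.
case: g => [[[a b] c] d] /eqP hg; have h := nuHE (a, b, c, d).
have h1 := gnormE (slpair (a, b, c, d)).1; have h2 := gnormE (slpair (a, b, c, d)).2.
move: h1 h2 h hg; rewrite /qa /qb /qc /qd /slpair /=.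
rewrite /qa /qb /= => h1 h2; move: h1 h2.
move: (gnorm (a + d, b - c)) (gnorm (a - d, b + c)) (nuH _) => n1 n2 n h1 h2 h hg.
have e1 : n1%:Z = n%:Z + 2 * (a * d - b * c) by rewrite h1 h; ring.
have e2 : n2%:Z = n%:Z - 2 * (a * d - b * c) by rewrite h2 h; ring.
by move: e1 e2; rewrite hg; clear; split; lia.
Qed.

Definition slset N p : seq quad := [seq g <- quadbox N | inSL2Z g && (nuH g == p)].

Definition godd_pairs m n : seq (gauss * gauss) := [seq (z, w) | z <- gset m, w <- gset n].

Definition irot (t : gauss * gauss) : gauss * gauss := (gmul (0, 1) t.1, gmul (0, 1) t.2).

Lemma irot_inj : injective irot.
Proof.
move=> [[a b] [c d]] [[a' b'] [c' d']] []; rewrite /gmul /= !mul0r !mul1r !sub0r !add0r.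
by move=> /oppr_inj -> -> /oppr_inj -> ->.
Qed.

Lemma gnorm_irot z : gnorm (gmul (0, 1) z) = gnorm z.
Proof. by rewrite gnormM mul1n. Qed.

Lemma mem_godd_pairs m n t : (t \in godd_pairs m n) =
  [&& godd t.1, gnorm t.1 == m, godd t.2 & gnorm t.2 == n].
Proof.
case: t => z w /=; apply/allpairsP/and4P => [[] [z' w'] [/= + + [-> ->]]|[h1 h2 h3 h4]].
  by rewrite !mem_gset => /andP[? ?] /andP[? ?].
by exists (z, w); rewrite !mem_gset /= h1 h2 h3 h4.
Qed.

Lemma godd_pairs_uniq m n : uniq (godd_pairs m n).
Proof. by apply: allpairs_uniq; rewrite ?gset_uniq // => -[? ?] [? ?] _ _ [-> ->]. Qed.

Lemma godd_irot z : odd (gnorm z) -> godd (gmul (0, 1) z) = ~~ godd z.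
Proof.
rewrite godd_norm /godd /gmul /= !mul0r !mul1r sub0r add0r abszN.
by case: (odd _); case: (odd _).
Qed.

Lemma same_parity (x u : int) : odd `|x| = odd `|u| -> exists a d, x = a + d /\ u = a - d.
Proof.
move=> h; have [a ha] : exists a, x + u = 2 * a by exists ((x + u) %/ 2)%Z; lia.
by exists a, (x - a); split; lia.
Qed.

(** The coordinates satisfy a + d = a - d and b - c = b + c modulo 2, so z and w are both of odd
    type or both i times odd type. Conversely such a pair has integer entries a, b, c, d, and ad -
    bc = (N(z) - N(w)) / 4 = 1. *)
Lemma slset_perm N p : odd p -> (1 < p)%N -> (p <= N)%N ->
  perm_eq (map slpair (slset N p))
   (godd_pairs (p + 2) (p - 2) ++ map irot (godd_pairs (p + 2) (p - 2))).
Proof.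
move=> po p1 pN; apply: uniq_perm.
- by rewrite (map_inj_uniq slpair_inj) filter_uniq ?quadbox_uniq.
- rewrite cat_uniq (map_inj_uniq irot_inj) !godd_pairs_uniq andbT /=.
  apply/hasPn => _ /mapP[[z w] hzw ->]; apply/negP.
  move: hzw; rewrite !mem_godd_pairs /= => /and4P[h1 /eqP h2 _ _].
  by rewrite godd_irot ?h1 // h2 addn2 /= negbK.
have pN2 : odd (p + 2) by rewrite addn2 /= negbK.
have pS2 : odd (p - 2) by rewrite oddB // po.
have key z w : gnorm z = (p + 2)%N -> gnorm w = (p - 2)%N -> godd z = godd w ->
    (z, w) \in map slpair (slset N p).
  case: z w => [x y] [u v] h1 h2 h3.
  have n1 := gnormE (x, y); have n2 := gnormE (u, v); rewrite h1 /= in n1; rewrite h2 /= in n2.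
  have o1 : odd `|x| (+) odd `|y| by rewrite -(godd_norm (x, y)) h1.
  have o2 : odd `|u| (+) odd `|v| by rewrite -(godd_norm (u, v)) h2.
  have [px py] : odd `|x| = odd `|u| /\ odd `|v| = odd `|y|.
    move: h3 o1 o2; rewrite /godd /=; clear.
    by case: (odd `|x|); case: (odd `|y|); case: (odd `|u|); case: (odd `|v|).
  have [a [d [ea ed]]] := same_parity px; have [b [c [ec eb]]] := same_parity py.
  apply/mapP; exists (a, b, c, d); last by rewrite /slpair /= ea ed eb ec.
  have e1 : a * d - b * c = 1 by move: n1 n2 p1; rewrite ea ed eb ec !expr2; clear; lia.
  have e2 : nuH (a, b, c, d) = p.
    have := nuHE (a, b, c, d); rewrite /qa /qb /qc /qd /=; move: n1 n2 p1; rewrite ea ed eb ec !expr2; clear; lia.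
  rewrite mem_filter e2 eqxx /inSL2Z /qa /qb /qc /qd /= e1 /=.
  rewrite mem_quadbox /qa /qb /qc /qd /=; move: e2; rewrite /nuH /qa /qb /qc /qd /=.
  move: pN; clear; move: `|a|%N `|b|%N `|c|%N `|d|%N => i j k l pN e.
  by apply/and4P; split; nia.
case=> z w; rewrite mem_cat mem_godd_pairs; apply/idP/idP => [/mapP[g]|].
  rewrite mem_filter => /andP[/andP[sg /eqP ng] _] e.
  have [] := slpair_norm sg; rewrite -e ng /= => h1 h2.
  have h3 : gnorm w = (p - 2)%N by lia.
  case: (boolP (godd z)) => gz.
    rewrite h1 h3 !eqxx /= andbT; apply/orP; left.
    have o2 : odd (gnorm w) by rewrite h3.
    move: gz o2; case: g {sg ng} e => [[[a b] c] d]; rewrite /slpair /qa /qb /qc /qd /= => -[-> ->].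
    by rewrite godd_norm /godd /=; clear; lia.
  apply/orP; right; apply/mapP.
  exists (gmul (0, -1) z, gmul (0, -1) w); last first.
    by rewrite /irot /= !gmulA; congr pair; case: (z) => *; case: (w) => *; rewrite /gmul /=; congr pair; ring.
  have nn u : gnorm (gmul (0, -1) u) = gnorm u by rewrite gnormM mul1n.
  rewrite mem_godd_pairs /= !nn h1 h3 !eqxx andbT /=.
  have gm u : odd (gnorm u) -> godd (gmul (0, -1) u) = ~~ godd u.
    rewrite godd_norm /godd /gmul /= !mul0r !mulN1r opprK add0r add0r abszN.
    by case: (odd _); case: (odd _).
  rewrite !gm ?h1 ?h3 // gz /=.
  case: g {sg ng} e => [[[a b] c] d]; rewrite /slpair /qa /qb /qc /qd /= => -[ez1 ez2].
  have o1 : odd (gnorm z) by rewrite h1. have o2 : odd (gnorm w) by rewrite h3.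
  move: gz o1 o2; rewrite ez1 ez2 !godd_norm /godd /=; clear; lia.
case/orP => [/and4P[h1 /eqP h2 h3 /eqP h4]|/mapP[[z' w']]]; first by apply: key; rewrite ?h1 ?h3.
rewrite mem_godd_pairs /= => /and4P[h1 /eqP h2 h3 /eqP h4] [-> ->].
by apply: key; rewrite ?gnorm_irot // !godd_irot ?h2 ?h4 // h1 h3.
Qed.

Lemma gt0_of_ge1000 (R : realType) (e : R) : 1000 <= e -> 0 < e.
Proof. by move=> he; lra. Qed.

Lemma truncn_loglog (R : realType) (E x : R) : 1000 <= E -> expR (expR E) + 1 <= x ->
  let N := Num.truncn x in let e := ln (ln N%:R) in
  [/\ E <= e, N%:R = expR (expR e), 0 < N%:R :> R, N%:R <= x & 0 < ln x <= 2 * expR e].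
Proof.
move=> hE hx N e; have L0 := expR_gt0 (expR E); have hL := exp_ge_500 hE.
have h1 := expR_ge1Dx (expR E); have E0 := gt0_of_ge1000 hE.
have x1 : 1 < x by clear -hx L0; lra.
have x0 : 0 < x by exact: lt_trans x1.
have xN : x < N.+1%:R by exact: truncnS_gt.
have Nx : N%:R <= x by rewrite truncn_le ltW.
have NE : expR (expR E) <= N%:R by rewrite -natr1 in xN; clear -xN hx; lra.
have N0 : 0 < N%:R :> R by exact: lt_le_trans NE.
have lNE : expR E <= ln N%:R by rewrite -[X in X <= _]expRK ler_ln ?posrE.
have lN0 : 0 < ln N%:R :> R by exact: lt_le_trans (expR_gt0 E) lNE.
have Ee : E <= e by rewrite -[X in X <= _]expRK ler_ln ?posrE ?expR_gt0.
have heE : expR e = ln N%:R by rewrite lnK.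
have hN : N%:R = expR (expR e) by rewrite heE lnK.
have N1 : 2 <= N%:R :> R by apply: le_trans NE; clear -h1 hL hE; lra.
split=> //; rewrite ln_gt0 //=.
have -> : 2 * expR e = ln (N%:R ^+ 2) by rewrite lnXn // heE mulr_natl.
rewrite ler_ln ?posrE ?exprn_gt0 //.
rewrite -natr1 in xN; rewrite expr2; have : 2 * N%:R <= N%:R * N%:R :> R by rewrite ler_pM2r.
by move: (N%:R * _) => t; clear -xN N1; lra.
Qed.

(** Against x / ln x, the bound leaves the factor exp(- e / 20) <= 20 / e; with ln x <= 2 exp e the
    quotient is at most 40 K / (c1 e), which explains the threshold. *)
Lemma average_small (R : realType) (K c1 ep E e x n P S : R) : 0 < K -> 0 < c1 -> 0 < ep ->
  1000 <= E -> 40 * K / (c1 * ep) <= E -> E <= e -> 0 < n -> n <= x -> 0 < ln x <= 2 * expR e ->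
  c1 * (x / ln x) <= P -> `|S| <= K * n * expR (- (21 / 20) * e) -> `|P^-1 * S| <= ep.
Proof.
move=> K0 c0 ep0 hE KE Ee n0 nx /andP[lx0 lx] hlow hS.
have e0 : 0 < e by apply: gt0_of_ge1000; exact: le_trans Ee.
have x0 : 0 < x by exact: lt_le_trans nx.
have P0 : 0 < P by apply: lt_le_trans hlow; rewrite !mulr_gt0 ?invr_gt0.
rewrite normrM ger0_norm ?invr_ge0 ?(ltW P0) // [X in X <= _]mulrC ler_pdivrMr //.
apply: le_trans hS _; apply: le_trans (ler_wpM2l (ltW ep0) hlow).
rewrite !mulrA ler_pdivlMr //.
apply: (@le_trans _ _ (K * x * expR (- (21 / 20) * e) * (2 * expR e))).
  apply: ler_pM; rewrite ?(ltW lx0) ?mulr_ge0 ?expR_ge0 ?(ltW K0) ?(ltW n0) //.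
  by rewrite ler_wpM2r ?expR_ge0 // ler_wpM2l ?(ltW K0).
have e20 : expR (- (21 / 20) * e) * expR e <= 20 / e.
  rewrite -expRD; have -> : - (21 / 20) * e + e = - (e / 20) by field.
  rewrite expRN -[20 / e]invf_div lef_pV2 ?posrE ?expR_gt0 ?divr_gt0 //.
  by have := expR_ge1Dx (e / 20); clear; lra.
have fin : 40 * K / e <= ep * c1.
  rewrite ler_pdivrMr // [ep * c1]mulrC [X in _ <= X]mulrC -ler_pdivrMr ?mulr_gt0 //.
  exact: le_trans Ee.
have -> : K * x * expR (- (21 / 20) * e) * (2 * expR e) = x * (2 * K * (expR (- (21 / 20) * e) * expR e)).
  by move: (expR _) (expR e) => u v; ring.
rewrite [ep * c1 * x]mulrC ler_pM2l //; apply: le_trans fin.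
have -> : 40 * K / e = 2 * K * (20 / e) by field; rewrite gt_eqF.
by rewrite ler_wpM2l // mulr_ge0 // ltW.
Qed.

Section Weyl.
Variable R : realType.

Lemma cos_sin_mulz (a b : R) : cos a = cos b -> sin a = sin b ->
  forall k : int, cos (a *~ k) = cos (b *~ k) /\ sin (a *~ k) = sin (b *~ k).
Proof.
move=> hc hs [k|k]; first by rewrite -!pmulrn; exact: cos_sin_muln.
by rewrite NegzE !mulrNz !cosN !sinN -!pmulrn; have [-> ->] := cos_sin_muln hc hs k.+1.
Qed.

Lemma cos_absz (a : R) (k : int) : cos (a *~ k) = cos (a *+ `|k|%N).
Proof. by case: k => k; rewrite ?NegzE ?mulrNz ?cosN ?abszN pmulrn. Qed.

Lemma sum_sin_gsetz (k : int) n : \sum_(z <- gset n) sin (garg R z *~ k) = 0.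
Proof.
case: k => k; first by under eq_bigr do rewrite -pmulrn; exact: sum_sin_gset.
rewrite NegzE; under eq_bigr do rewrite mulrNz sinN -pmulrn.
by rewrite sumrN sum_sin_gset oppr0.
Qed.

Lemma sum_cos_gsetz (k : int) n :
  \sum_(z <- gset n) cos (garg R z *~ k) = if odd `|k| then 0 else 2 * cc R `|k|./2 n.
Proof.
under eq_bigr do rewrite cos_absz.
case: ifP => hk; first exact: sum_cos_gset_odd.
by rewrite /cc mulrA divff // mul1r -{1}(odd_double_half `|k|) hk add0n.
Qed.

(** The sine sums vanish by conjugation, so the phase s leaves only cos s. Carrying a phase lets one
    cosine statement cover sines and the constant shifts of the angles. *)
Lemma sum_cos_pairs (k l : int) m n (s : R) :
  \sum_(t <- godd_pairs m n) cos (garg R t.1 *~ k + garg R t.2 *~ l - s) =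
  (\sum_(z <- gset m) cos (garg R z *~ k)) * (\sum_(w <- gset n) cos (garg R w *~ l)) * cos s.
Proof.
rewrite big_allpairs_dep /=.
under eq_bigr => z _.
  under eq_bigr => w _.
    have -> : cos (garg R z *~ k + garg R w *~ l - s) =
        (cos (garg R z *~ k) * cos s + sin (garg R z *~ k) * sin s) * cos (garg R w *~ l)
        + (cos (garg R z *~ k) * sin s - sin (garg R z *~ k) * cos s) * sin (garg R w *~ l).
      by rewrite !cosD !sinD !cosN !sinN; ring.
    over.
  rewrite big_split /= -!mulr_sumr sum_sin_gsetz mulr0 addr0.
  over.
rewrite -mulr_suml big_split /= -!mulr_suml sum_sin_gsetz mul0r addr0.
by rewrite -!mulrA; congr (_ * _); rewrite mulrC.
Qed.

Lemma garg_irot z (k : int) : (0 < gnorm z)%N ->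
  cos (garg R (gmul (0, 1) z) *~ k) = cos ((garg R z + pi / 2) *~ k) /\
  sin (garg R (gmul (0, 1) z) *~ k) = sin ((garg R z + pi / 2) *~ k).
Proof.
move=> z0; have r0 := rho_gt0 R z0.
have e : rho R (gmul (0, 1) z) = rho R z by rewrite /rho gnorm_irot.
apply: cos_sin_mulz; apply: (mulfI (lt0r_neq0 r0)).
  rewrite -{1}e rho_cos cosD cos_pihalf sin_pihalf mulr0 sub0r mulr1 mulrN rho_sin.
  by rewrite /gmul /= mul0r mul1r sub0r rmorphN.
rewrite -{1}e rho_sin sinD cos_pihalf sin_pihalf mulr0 add0r mulr1 rho_cos.
by rewrite /gmul /= mul0r mul1r add0r.
Qed.

Lemma cartan_pair (g : quad) (t1 t2 : R) : cartan (toRmx R g) t1 t2 -> exists u v : R,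
  [/\ 0 < u, 0 <= v, (slpair g).1.1%:~R = u * cos (t1 + t2) /\ (slpair g).1.2%:~R = u * sin (t1 + t2)
   & (slpair g).2.1%:~R = v * cos (t2 - t1 + pi) /\ (slpair g).2.2%:~R = v * sin (t2 - t1 + pi)].
Proof.
move=> [r [r0 e]].
exists (expR (- (r / 2)) + expR (r / 2)), (expR (r / 2) - expR (- (r / 2))).
have ent i j := congr1 (fun M : 'M[R]_2 => M i j) e.
have h00 := ent ord0 ord0; have h01 := ent ord0 ord_max.
have h10 := ent ord_max ord0; have h11 := ent ord_max ord_max.
move: h00 h01 h10 h11; rewrite !mxE !big_ord_recl !big_ord0 !mxE !big_ord_recl !big_ord0 !mxE /=.
rewrite !addr0 !mulr0 !addr0 !add0r.
move=> ha hb hc hd; split.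
- by rewrite addr_gt0 ?expR_gt0.
- by rewrite subr_ge0 ler_expR; lra.
- by rewrite /slpair /= rmorphB !rmorphD /= ha hb hc hd cosD sinD; split; ring.
by rewrite /slpair /= rmorphB !rmorphD /= ha hb hc hd !cosDpi !sinDpi cosB sinB; split; ring.
Qed.

Lemma cos_sin_sum (a a' b b' s : R) : cos a = cos a' -> sin a = sin a' ->
  cos b = cos b' -> sin b = sin b' -> cos (a + b - s) = cos (a' + b' - s).
Proof. by move=> ca sa cb sb; rewrite !(cosD, sinD) ca sa cb sb. Qed.

Lemma angle_change (a b c s : R) (m n : int) : a *~ (2 * m) + b *~ (2 * n) - s =
  (a + b) *~ (m + n) + (b - a + c) *~ (n - m) - (s + c *~ (n - m)).
Proof.
have e k : 2 * k = k + k :> int by ring.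
rewrite !e !(mulrzDl, mulrzDr, mulrzBl, mulrzBr, mulNrz, mulrNz).
move: (a *~ m) (a *~ n) (b *~ m) (b *~ n) (c *~ m) (c *~ n) => *; ring.
Qed.

Lemma angle_shift (a b c s : R) (k l : int) :
  (a + c) *~ k + (b + c) *~ l - s = a *~ k + b *~ l - (s - c *~ k - c *~ l).
Proof. by rewrite !mulrzDl; move: (a *~ k) (b *~ l) (c *~ k) (c *~ l) => *; ring. Qed.

Lemma garg_polar z (t u : R) : (0 < gnorm z)%N -> 0 <= u -> z.1%:~R = u * cos t -> z.2%:~R = u * sin t ->
  forall k : int, cos (garg R z *~ k) = cos (t *~ k) /\ sin (garg R z *~ k) = sin (t *~ k).
Proof.
move=> z0 u0 h1 h2; have r0 := rho_gt0 R z0.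
have e : rho R z = u.
  by rewrite /rho gnorm_intr h1 h2 !exprMn -mulrDr cos2Dsin2 mulr1 sqrtr_sqr ger0_norm.
apply: cos_sin_mulz; apply: (mulfI (lt0r_neq0 r0)); first by rewrite rho_cos h1 e.
by rewrite rho_sin h2 e.
Qed.

Variables theta1 theta2 : quad -> R.
Hypothesis htheta : forall g : quad, inSL2Z g -> cartan (toRmx R g) (theta1 g) (theta2 g).

(** m1 + m2 and m2 - m1 have the same parity; if it is odd, the sign change z -> -z kills the sum.
    Otherwise the two blocks of [slset_perm] differ by a phase only: 8 is 2 * 2 from the halves in
    [cc], times 2 blocks. *)
Lemma weyl_prime (m1 m2 : int) (s : R) N p : odd p -> (2 < p)%N -> (p <= N)%N ->
  `|\sum_(g <- slset N p) cos (theta1 g *~ (2 * m1) + theta2 g *~ (2 * m2) - s)| <=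
  if odd `|m1 + m2| then 0 else
    8 * (`|cc R `|m1 + m2|./2 (p + 2)| * `|cc R `|m2 - m1|./2 (p - 2)|).
Proof.
move=> po p2 pN; set k := m1 + m2; set l := m2 - m1.
have okl : odd `|l| = odd `|k| by rewrite /k /l; clear; lia.
pose G (t : gauss * gauss) := cos (garg R t.1 *~ k + garg R t.2 *~ l - (s + pi *~ l)).
have -> : \sum_(g <- slset N p) cos (theta1 g *~ (2 * m1) + theta2 g *~ (2 * m2) - s) =
          \sum_(t <- map slpair (slset N p)) G t.
  rewrite big_map big_seq [RHS]big_seq; apply: eq_bigr => g; rewrite mem_filter => /andP[/andP[sg /eqP ng] _].
  have [n1 n2] := slpair_norm sg; have [u [v [u0 v0 [h1 h2] [h3 h4]]]] := cartan_pair (htheta sg).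
  have z0 : (0 < gnorm (slpair g).1)%N by rewrite n1 addn2.
  have w0 : (0 < gnorm (slpair g).2)%N by lia.
  have [c1 s1] := garg_polar z0 (ltW u0) h1 h2 k; have [c2 s2] := garg_polar w0 v0 h3 h4 l.
  rewrite /G (cos_sin_sum _ c1 s1 c2 s2); congr cos; rewrite /k /l.
  exact: angle_change.
rewrite (perm_big _ (slset_perm po (ltnW p2) pN)) big_cat /= big_map.
have -> : \sum_(t <- godd_pairs (p + 2) (p - 2)) G (irot t) =
   \sum_(t <- godd_pairs (p + 2) (p - 2)) cos (garg R t.1 *~ k + garg R t.2 *~ l
      - (s + pi *~ l - (pi / 2) *~ k - (pi / 2) *~ l)).
  rewrite big_seq [RHS]big_seq; apply: eq_bigr => -[z w].
  rewrite mem_godd_pairs /= => /and4P[_ /eqP h2 _ /eqP h4].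
  have z0 : (0 < gnorm z)%N by rewrite h2 addn2.
  have w0 : (0 < gnorm w)%N by rewrite h4 subn_gt0.
  have [c1 s1] := garg_irot k z0; have [c2 s2] := garg_irot l w0.
  rewrite /G /irot /= (cos_sin_sum _ c1 s1 c2 s2); congr cos.
  exact: angle_shift.
rewrite !sum_cos_pairs -mulrDr !sum_cos_gsetz okl; case: ifP => _; first by rewrite !mul0r normr0.
set x := cc _ _ _; set y := cc _ _ _; set c1 := cos _; set c2 := cos _.
have -> : 2 * x * (2 * y) * (c1 + c2) = (4 * (x * y)) * (c1 + c2) by ring.
rewrite normrM; have h : `|c1 + c2| <= 2.
  apply: le_trans (ler_normD _ _) _.
  have h1 : `|c1| <= 1 by rewrite ler_norml cos_le1 cos_geN1.
  have h2 : `|c2| <= 1 by rewrite ler_norml cos_le1 cos_geN1.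
  lra.
apply: le_trans (ler_wpM2l (normr_ge0 _) h) _.
by rewrite !normrM (ger0_norm (ler0n _ 4)); move: (`|x| * `|y|) => t; lra.
Qed.

Lemma primeSL_sum (F : quad -> R) (x : R) : 0 <= x ->
  \sum_(g <- primeSL x) F g =
  \sum_(p <- iota 0 (Num.truncn x).+1 | prime p) \sum_(g <- slset (Num.truncn x) p) F g.
Proof.
move=> x0; rewrite /primeSL big_filter; set N := Num.truncn x.
under [RHS]eq_bigr do rewrite big_filter.
rewrite [RHS]big_seq_cond.
have hN g : ((nuH g)%:R <= x) = (nuH g <= N)%N by rewrite /N -truncn_ge_nat.
rewrite (exchange_big_dep (fun g => inSL2Z g && prime (nuH g) && ((nuH g)%:R <= x))) /=; last first.
  by move=> p g /andP[pN pp] /andP[sg /eqP e]; rewrite sg e pp /= -e hN e; move: pN; rewrite (mem_iota 0 N.+1) ltnS.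
apply: eq_bigr => g /andP[/andP[sg pg]]; rewrite hN => gN; rewrite -big_filter.
have -> : [seq p <- iota 0 N.+1 | (p \in iota 0 N.+1) && prime p && (inSL2Z g && (nuH g == p))] = [:: nuH g].
  rewrite -(@filter_pred1_uniq _ (iota 0 N.+1) (nuH g)) ?iota_uniq //; last by rewrite mem_iota ltnS.
  apply: eq_in_filter => p pN; rewrite pN sg /= eq_sym.
  by apply/andP/idP => [[_ ->] //|/eqP e]; rewrite e eqxx pg.
by rewrite big_seq1.
Qed.

(** For p = 2 the element w is 0 and has no argument; all entries are then at most 1 in absolute
    value, so a trivial count is enough. *)
Lemma slset2_le (F : quad -> R) N : (forall g, `|F g| <= 1) ->
  `|\sum_(g <- slset N 2) F g| <= (size (quadbox 1))%:R.
Proof.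
move=> hF; apply: le_trans (ler_norm_sum _ _ _) _.
apply: (@le_trans _ _ (\sum_(g <- slset N 2) 1)); first exact: ler_sum.
rewrite big_const_seq count_predT iter_addr_0 ler_nat.
apply: uniq_leq_size; first exact: filter_uniq (quadbox_uniq N).
move=> g; rewrite mem_filter mem_quadbox => /andP[/andP[_ /eqP]] + _.
rewrite /nuH mem_quadbox; move: `|qa g|%N `|qb g|%N `|qc g|%N `|qd g|%N => i j k l e.
by apply/and4P; split; nia.
Qed.

Lemma weyl_sum (m1 m2 : int) : (m1 != 0) || (m2 != 0) -> exists K : R, 0 < K /\
  forall (s x e : R), 0 <= x -> 1000 <= e -> (Num.truncn x)%:R = expR (expR e) ->
  `|\sum_(g <- primeSL x) cos (theta1 g *~ (2 * m1) + theta2 g *~ (2 * m2) - s)|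
    <= K * (Num.truncn x)%:R * expR (- (21 / 20) * e).
Proof.
move=> m0; set k := m1 + m2; set l := m2 - m1.
have [K [K0 hK]] : exists K : R, 0 < K /\ forall (e : R) N, 1000 <= e -> N%:R = expR (expR e) ->
    \sum_(p <- iota 0 N.+1 | prime p && (2 < p)%N) (if odd `|k| then 0 else
      8 * (`|cc R `|k|./2 (p + 2)| * `|cc R `|l|./2 (p - 2)|)) <= K * N%:R * expR (- (21 / 20) * e).
  case hk: (odd `|k|).
    exists 1; split=> // e N _ _; rewrite big1 // mul1r mulr_ge0 ?expR_ge0 //.
  have kl0 : (`|k|./2 != 0)%N || (`|l|./2 != 0)%N.
    by move: m0 hk; rewrite /k /l; clear; lia.
  have [K [K0 hK]] := pair_sum R kl0; exists (8 * K); split; first by rewrite mulr_gt0.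
  by move=> e N he hN; rewrite -mulr_sumr -!mulrA ler_wpM2l // mulrA; exact: hK.
pose K0' := (size (quadbox 1))%:R : R.
exists (K0' + K); split; first exact: ltr_wpDl.
move=> s x e x0 he hN; rewrite primeSL_sum //; set N := Num.truncn x in hN *.
have L0 := expR_gt0 e; have hL := exp_ge_500 he.
have N2 : (2 <= N)%N by rewrite -(ler_nat R) hN; have := expR_ge1Dx (expR e); lra.
have -> : \sum_(p <- iota 0 N.+1 | prime p) \sum_(g <- slset N p) cos (theta1 g *~ (2 * m1) + theta2 g *~ (2 * m2) - s)
   = \sum_(g <- slset N 2) cos (theta1 g *~ (2 * m1) + theta2 g *~ (2 * m2) - s) +
    \sum_(p <- iota 0 N.+1 | prime p && (2 < p)%N) \sum_(g <- slset N p) cos (theta1 g *~ (2 * m1) + theta2 g *~ (2 * m2) - s).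
  rewrite (bigID (pred1 2%N)) /=; congr (_ + _).
    rewrite -big_filter (_ : [seq _ <- _ | _] = [:: 2%N]) ?big_seq1 //.
    rewrite -(@filter_pred1_uniq _ (iota 0 N.+1) 2) ?iota_uniq // ?mem_iota //.
    by apply: eq_filter => p /=; case: eqP => [->|]; rewrite ?andbF.
  by apply: eq_bigl => p; case: (boolP (prime p)) => //= /prime_gt1; rewrite leq_eqVlt eq_sym; case: eqP => [->|].
apply: le_trans (ler_normD _ _) _; rewrite (mulrDl K0' K) (mulrDl (K0' * _)); apply: lerD.
  apply: (@le_trans _ _ K0'); first by apply: slset2_le => g; rewrite ler_norml cos_le1 cos_geN1.
  rewrite -[X in X <= _]mulr1 -mulrA ler_wpM2l // hN -expRD -[X in X <= _]expR0 ler_expR.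
  by clear -hL he; lra.
apply: le_trans (ler_norm_sum _ _ _) _; apply: le_trans (hK _ _ he hN).
rewrite big_seq_cond [X in _ <= X]big_seq_cond; apply: ler_sum => p /andP[pN /andP[pp p2]].
apply: weyl_prime => //; last by move: pN; rewrite mem_iota ltnS.
by case: (even_prime pp) => // e2; rewrite e2 in p2.
Qed.

Variables c1 c2 : R.
Hypothesis hc1 : 0 < c1.
Hypothesis hasym : \forall x \near +oo,
  c1 * (x / ln x) <= piEcount x /\ piEcount x <= c2 * (x / ln x).

Lemma weyl_average (m1 m2 : int) (s : R) : (m1 != 0) || (m2 != 0) ->
  (fun x : R => (piEcount x)^-1 *
     \sum_(g <- primeSL x) cos (theta1 g *~ (2 * m1) + theta2 g *~ (2 * m2) - s)) @ +oo --> (0 : R).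
Proof.
move=> m0; have [K [K0 hK]] := weyl_sum m0.
apply/cvgr0Pnorm_le => /= ep ep0.
have mx (a b : R) : exists E, a <= E /\ b <= E by exists (Num.max a b); rewrite !le_max !lexx orbT.
have [E [hE KE]] := mx 1000 (40 * K / (c1 * ep)).
near=> x.
have hx : expR (expR E) + 1 <= x by near: x; apply: nbhs_pinfty_ge; exact: num_real.
have [hlow _] : c1 * (x / ln x) <= piEcount x /\ piEcount x <= c2 * (x / ln x) by near: x.
have [Ee hN N0 Nx lx] := truncn_loglog hE hx.
have x0 : 0 <= x by exact: le_trans (ltW N0) Nx.
exact: average_small K0 hc1 ep0 hE KE Ee N0 Nx lx hlow (hK s x _ x0 (le_trans hE Ee) hN).
Unshelve. all: by end_near.
Qed.

End Weyl.

(** * Fejer kernels and equidistribution on the torus *)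

Section Fejer.
Variable R : realType.
Implicit Types (t u v : R) (q : nat).

Lemma sum_ord_const q (c : R) : \sum_(i < q) c = c * q%:R.
Proof. by rewrite sumr_const card_ord -[LHS]mulr_natr. Qed.

Definition csum q t := \sum_(j < q) cos (t *+ j).
Definition ssum q t := \sum_(j < q) sin (t *+ j).
Definition fejer q t := q%:R^-1 * (csum q t ^+ 2 + ssum q t ^+ 2).

(* (1 - e^(it)) * sum_(j < q) e^(ijt) = 1 - e^(iqt), in real and imaginary parts. *)
Lemma csum_ssum_telescope q t :
  csum q t * (1 - cos t) + ssum q t * sin t = 1 - cos (t *+ q) /\
  ssum q t * (1 - cos t) - csum q t * sin t = - sin (t *+ q).
Proof.
elim: q => [|q [h1 h2]]; first by rewrite /csum /ssum !big_ord0 mulr0n cos0 sin0; split; ring.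
rewrite /csum /ssum !big_ord_recr /= -/(csum q t) -/(ssum q t) mulrSr cosD sinD.
move: h1 h2; move: (csum q t) (ssum q t) (cos (t *+ q)) (sin (t *+ q)) (cos t) (sin t) => C S c s x y h1 h2.
have -> : (C + c) * (1 - x) + (S + s) * y = (C * (1 - x) + S * y) + (c * (1 - x) + s * y) by ring.
have -> : (S + s) * (1 - x) - (C + c) * y = (S * (1 - x) - C * y) + (s * (1 - x) - c * y) by ring.
by rewrite h1 h2; split; ring.
Qed.

Lemma csum_ssum_sq q t :
  (csum q t ^+ 2 + ssum q t ^+ 2) * (1 - cos t) = 1 - cos (t *+ q).
Proof.
have [h1 h2] := csum_ssum_telescope q t.
have e1 := cos2Dsin2 t; have e2 := cos2Dsin2 (t *+ q).
move: h1 h2 e1 e2; move: (csum q t) (ssum q t) (cos (t *+ q)) (sin (t *+ q)) (cos t) (sin t) => C S c s x y h1 h2 e1 e2.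
have h : (C * (1 - x) + S * y) ^+ 2 + (S * (1 - x) - C * y) ^+ 2
   = (C ^+ 2 + S ^+ 2) * (1 - 2 * x + (x ^+ 2 + y ^+ 2)) by ring.
rewrite h1 h2 e1 in h.
have h' : (1 - c) ^+ 2 + (- s) ^+ 2 = 1 - 2 * c + (c ^+ 2 + s ^+ 2) by ring.
rewrite e2 in h'; rewrite h' in h.
move: h; move: (C ^+ 2 + S ^+ 2) => z h.
have h3 : 2 * (z * (1 - x)) = 2 * (1 - c) by rewrite -[RHS]/(2 * (1 - c)); lra.
by apply: (mulfI _ h3); rewrite pnatr_eq0.
Qed.

Lemma fejer_ge0 q t : 0 <= fejer q t.
Proof. by rewrite /fejer mulr_ge0 ?invr_ge0 // addr_ge0 ?sqr_ge0. Qed.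

(** Concentration of the kernel, measured by 1 - cos t so that it follows at once from the closed
    form [csum_ssum_sq]. *)
Lemma fejer_gap q t : fejer q t * (1 - cos t) <= 2 / q%:R.
Proof.
rewrite /fejer -mulrA csum_ssum_sq mulrC ler_wpM2r ?invr_ge0 //.
by have := cos_geN1 (t *+ q); lra.
Qed.

Lemma fejerE q t :
  fejer q t = q%:R^-1 * \sum_(a < q) \sum_(b < q) cos (t *~ (a%:Z - b%:Z)).
Proof.
rewrite /fejer; congr (_ * _); rewrite !expr2 /csum /ssum !mulr_suml -big_split; apply: eq_bigr => a _ /=.
rewrite !mulr_sumr -big_split; apply: eq_bigr => b _ /=.
by rewrite mulrzBr -!pmulrn cosB.
Qed.

Lemma periodic_int (h : R -> R) (T : R) : (forall u, h (u + T) = h u) ->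
  forall (m : int) u, h (u + T *~ m) = h u.
Proof.
move=> hT; have hn (n : nat) u : h (u + T *+ n) = h u.
  by elim: n u => [|n IH] u; rewrite ?mulr0n ?addr0 // mulrSr addrA hT IH.
case=> n u; first by rewrite -pmulrn hn.
by rewrite -[LHS](hn n.+1) NegzE mulrNz -pmulrn subrK.
Qed.

(** A smooth 1-periodic substitute for the distance to the nearest integer. *)
Definition gauge t := 1 - cos (2 * pi * t).

Lemma gauge_ge0 t : 0 <= gauge t.
Proof. by rewrite subr_ge0 cos_le1. Qed.

Lemma gauge_int t (m : int) : gauge (t + m%:~R) = gauge t.
Proof.
rewrite -[m%:~R]/(1 *~ m); apply: periodic_int => u.
rewrite /gauge; congr (_ - _).
by rewrite mulrDr mulr1 [X in _ + X]mulr_natl cosD2pi.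
Qed.

Lemma gauge_eq0 t : `|t| <= 1 -> gauge t = 0 -> [\/ t = 0, t = 1 | t = -1].
Proof.
move=> t1 /subr0_eq/esym h; have hs : sin (pi * `|t|) ^+ 2 = 0.
  have : cos ((pi * `|t|) *+ 2) = 1.
    rewrite -h -[RHS]cos_norm; congr cos.
    by rewrite !normrM (ger0_norm (pi_ge0 R)) ger0_norm // -mulr_natl mulrA.
  by rewrite cos_mulr2n; have := cos2Dsin2 (pi * `|t|); lra.
have [t0|t0] := eqVneq t 0; first by constructor 1.
have {}t0 : 0 < `|t| by rewrite normr_gt0.
have [lt1|ge1] := ltP `|t| 1.
  have : 0 < sin (pi * `|t|).
    by apply: sin_gt0_pi; rewrite mulr_gt0 ?pi_gt0 //= gtr_pMr ?pi_gt0.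
  by move/eqP: hs; rewrite sqrf_eq0 => /eqP ->; rewrite ltxx.
have {t1 ge1 t0} : `|t| = 1 by apply/eqP; rewrite eq_le t1 ge1.
by case: (ler0P t) => h0 e; [constructor 3; rewrite -e opprK | constructor 2].
Qed.

(** For m <> 0, th = -2 pi m / q has cos (q th) = 1 but cos th <> 1 because |m| < q, so
    [csum_ssum_sq] forces both sums over multiples of th to vanish. *)
Lemma sum_cos_grid q (m : int) t : (`|m| < q)%N ->
  \sum_(i < q) cos ((t - 2 * pi * (i%:R / q%:R)) *~ m) = if m == 0 then q%:R else 0.
Proof.
move=> mq; case: eqP => [->|/eqP m0].
  by under eq_bigr do rewrite mulr0z cos0; rewrite sumr_const card_ord.
have q0 : 0 < q%:R :> R by rewrite ltr0n; case: q mq.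
pose th := - (2 * pi * (m%:~R / q%:R)) : R.
have thq : cos (th *+ q) = 1.
  rewrite /th mulNrn cosN -[X in cos X]mulr_natr.
  have -> : 2 * pi * (m%:~R / q%:R) * q%:R = 2 * pi * m%:~R :> R by field; rewrite gt_eqF.
  have -> : 2 * pi * m%:~R = 0 + (pi *+ 2) *~ m :> R by rewrite add0r -[RHS]mulrzr -(mulr_natl pi 2).
  by rewrite (periodic_int (@cosD2pi R)) cos0.
have th1 : 1 - cos th != 0.
  rewrite /th cosN -/(gauge _); apply/eqP => /gauge_eq0.
  have hn : `|m%:~R / q%:R| = `|m|%:R / q%:R :> R.
    by rewrite normrM normfV (ger0_norm (ltW q0)) -intr_norm natr_absz.
  have lt1 : `|m%:~R / q%:R| < 1 :> R by rewrite hn ltr_pdivrMr // mul1r ltr_nat.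
  case=> [||e|e]; first exact: ltW.
  - by move/eqP; rewrite mulf_eq0 invr_eq0 (gt_eqF q0) orbF intr_eq0 (negbTE m0).
  - by move: lt1; rewrite e normr1 ltxx.
  - by move: lt1; rewrite e normrN1 ltxx.
have := csum_ssum_sq q th; rewrite thq subrr => /eqP; rewrite mulf_eq0 (negbTE th1) orbF.
rewrite paddr_eq0 ?sqr_ge0 // !sqrf_eq0 => /andP[/eqP c0 /eqP s0].
have e (i : 'I_q) : (t - 2 * pi * (i%:R / q%:R)) *~ m = t *~ m + th *+ i.
  rewrite mulrzBl; congr (_ + _); rewrite /th mulNrn -mulrzr -mulr_natr; congr (- _).
  by field; rewrite gt_eqF.
under eq_bigr do rewrite e cosD.
by rewrite sumrB -!mulr_sumr -/(csum q th) -/(ssum q th) c0 s0 !mulr0 subrr.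
Qed.

Lemma sum_fejer_grid q t : (0 < q)%N ->
  \sum_(i < q) fejer q (t - 2 * pi * (i%:R / q%:R)) = q%:R.
Proof.
move=> q0; have qn0 : q%:R != 0 :> R by rewrite pnatr_eq0 -lt0n.
under eq_bigr do rewrite fejerE.
rewrite -mulr_sumr exchange_big /=.
under eq_bigr => a _.
  rewrite exchange_big /=.
  under eq_bigr => b _.
    rewrite sum_cos_grid; last by have := ltn_ord a; have := ltn_ord b; lia.
    over.
  rewrite (bigD1 a) //= subrr eqxx big1 ?addr0; last first.
    move=> b ba; case: eqP => // /eqP; rewrite subr_eq0 eqz_nat => /eqP/val_inj e.
    by rewrite e eqxx in ba.
  over.
by rewrite (sum_ord_const q) mulrA mulVf // mul1r.
Qed.

Definition grid q (i : 'I_q) : R := i%:R / q%:R.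
(** Non-negative weights on the grid with sum 1; averaging with them is a discrete convolution with
    the product kernel. *)
Definition fweight q u v (i j : 'I_q) : R :=
  q%:R ^- 2 * (fejer q (2 * pi * u - 2 * pi * grid i) * fejer q (2 * pi * v - 2 * pi * grid j)).

Lemma fweight_ge0 q u v (i j : 'I_q) : 0 <= fweight u v i j.
Proof.
apply: mulr_ge0; first by rewrite invr_ge0 exprn_ge0.
exact: mulr_ge0 (fejer_ge0 _ _) (fejer_ge0 _ _).
Qed.

Lemma sum_fweight q u v : (0 < q)%N -> \sum_i \sum_j @fweight q u v i j = 1.
Proof.
move=> q0; have qn0 : q%:R != 0 :> R by rewrite pnatr_eq0 -lt0n.
rewrite /fweight; under eq_bigr do rewrite -mulr_sumr -mulr_sumr sum_fejer_grid //.
by rewrite -mulr_sumr -mulr_suml sum_fejer_grid // -expr2 mulVf // expf_neq0.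
Qed.

Lemma sum_weight_split q (Q : R) (A B G H : 'I_q -> R) :
  \sum_i \sum_j Q * (A i * B j) * (G i + H j) =
  Q * ((\sum_i A i * G i) * \sum_j B j) + Q * ((\sum_i A i) * \sum_j B j * H j).
Proof.
rewrite -mulrDr !mulr_suml -big_split mulr_sumr; apply: eq_bigr => i _ /=.
rewrite !mulr_sumr -big_split mulr_sumr; apply: eq_bigr => j _ /=; ring.
Qed.

Lemma sum_fweight_gauge q u v : (0 < q)%N ->
  \sum_i \sum_j @fweight q u v i j * (gauge (u - grid i) + gauge (v - grid j)) <= 4 / q%:R.
Proof.
move=> q0; have qn0 : q%:R != 0 :> R by rewrite pnatr_eq0 -lt0n.
have gap t : \sum_(i < q) fejer q (2 * pi * t - 2 * pi * grid i) * gauge (t - grid i) <= 2.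
  apply: (@le_trans _ _ (\sum_(i < q) 2 / q%:R)).
    by apply: ler_sum => i _; rewrite /gauge [2 * pi * (_ - _)]mulrBr; exact: fejer_gap.
  by rewrite sum_ord_const divfK.
rewrite sum_weight_split !sum_fejer_grid // -mulrDr [X in X <= _]mulrC ler_pdivrMr ?exprn_gt0 ?ltr0n //.
have -> : 4 / q%:R * q%:R ^+ 2 = 2 * q%:R + q%:R * 2 :> R by field.
by apply: lerD; rewrite ?ler_wpM2r ?ler_wpM2l.
Qed.
End Fejer.

(** * Modulus of continuity on the torus *)

Section GaugeModulus.
Variable R : realType.
Variable f : R * R -> R.
Hypothesis fcont : continuous f.
Hypothesis fper1 : forall u v : R, f (u + 1, v) = f (u, v).
Hypothesis fper2 : forall u v : R, f (u, v + 1) = f (u, v).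

Let square : set (R * R) := `[0, 1]%classic `*` `[0, 1]%classic.

Lemma continuous_gauge : continuous (@gauge R).
Proof.
move=> t; rewrite /gauge; apply: cvgB; first exact: cvg_cst.
apply: (@continuous_comp _ _ _ (fun t => 2 * pi * t)); last exact: continuous_cos.
by apply: cvgM; [exact: cvg_cst | exact: cvg_id].
Qed.

Lemma square_compact : compact square.
Proof. by apply: compact_setX; exact: segment_compact. Qed.

Lemma square_sup : exists M : R, 0 <= M /\ forall p, square p -> `|f p| <= M.
Proof.
have ne : square !=set0 by exists (0, 0); split; rewrite /= in_itv /= lexx ler01.
have ct : {within square, continuous (fun p => `|f p|)}.
  by apply: continuous_subspaceT => p; apply: continuous_comp; [exact: fcont | exact: norm_continuous].
have [c _ hc] := compact_EVT_max ne square_compact ct.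
by exists `|f c|; split=> // p hp; apply: hc; rewrite inE.
Qed.

(** Zero gauge forces each coordinate difference to be 0, 1 or -1; periodicity identifies opposite
    edges of the square. *)
Lemma gauge_separates (x : (R * R) * (R * R)) : (square `*` square) x ->
  gauge (x.1.1 - x.2.1) + gauge (x.1.2 - x.2.2) = 0 -> f x.1 = f x.2.
Proof.
case: x => [[u v] [u' v']] [] [] /=; rewrite /= !in_itv /= => /andP[u0 u1] /andP[v0 v1] [] /=.
rewrite !in_itv /= => /andP[u0' u1'] /andP[v0' v1'] /eqP.
rewrite paddr_eq0 ?gauge_ge0 // => /andP[/eqP g1 /eqP g2].
have hu : `|u - u'| <= 1 by rewrite ler_norml; lra.
have hv : `|v - v'| <= 1 by rewrite ler_norml; lra.
have fu w : f (u, w) = f (u', w).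
  case: (gauge_eq0 hu g1) => h.
  - by congr (f (_, _)); lra.
  - by have -> : u = u' + 1 by lra.
  - by have -> : u' = u + 1 by lra.
rewrite fu; case: (gauge_eq0 hv g2) => h.
- by congr (f (_, _)); lra.
- by have -> : v = v' + 1 by lra.
- by have -> : v' = v + 1 by lra.
Qed.

(** On the compact set of pairs with |f x.1 - f x.2| >= e the gauge sum has a positive minimum by
    [gauge_separates], and A = 2 M over that minimum works. The bound is linear in the gauge so that
    it can be summed against [sum_fweight_gauge]. *)
Lemma gauge_modulus_square (e : R) : 0 < e -> exists A : R, 0 <= A /\
  forall x, (square `*` square) x ->
  `|f x.1 - f x.2| <= e + A * (gauge (x.1.1 - x.2.1) + gauge (x.1.2 - x.2.2)).
Proof.
move=> e0; have [M [M0 hM]] := square_sup.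
pose G (x : (R * R) * (R * R)) : R := gauge (x.1.1 - x.2.1) + gauge (x.1.2 - x.2.2).
have G0 x : 0 <= G x by rewrite addr_ge0 ?gauge_ge0.
have cD : continuous (fun x : (R * R) * (R * R) => `|f x.1 - f x.2|).
  move=> x; apply: cvg_norm; apply: cvgB.
    by apply: (@continuous_comp _ _ _ fst f); [exact: cvg_fst | exact: fcont].
  by apply: (@continuous_comp _ _ _ snd f); [exact: cvg_snd | exact: fcont].
have cG : continuous G.
  move=> x; apply: cvgD.
    apply: (@continuous_comp _ _ _ (fun x : (R * R) * (R * R) => x.1.1 - x.2.1)); last exact: continuous_gauge.
    apply: cvgB.
      by apply: (@continuous_comp _ _ _ fst fst); exact: cvg_fst.
    by apply: (@continuous_comp _ _ _ snd fst); [exact: cvg_snd | exact: cvg_fst].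
  apply: (@continuous_comp _ _ _ (fun x : (R * R) * (R * R) => x.1.2 - x.2.2)); last exact: continuous_gauge.
  apply: cvgB.
    by apply: (@continuous_comp _ _ _ fst snd); [exact: cvg_fst | exact: cvg_snd].
  by apply: (@continuous_comp _ _ _ snd snd); exact: cvg_snd.
pose K := (square `*` square) `&` [set x | e <= `|f x.1 - f x.2|].
have cK : compact K.
  apply: compact_closedI; first by apply: compact_setX; exact: square_compact.
  have -> : [set x | e <= `|f x.1 - f x.2|] = (fun x => `|f x.1 - f x.2|) @^-1` [set t | e <= t] by [].
  by apply: preimage_closed; [move=> x _; exact: cD | exact: closed_ge].
have [K0|Kn] := pselect (K !=set0); last first.
  exists 0; split=> // x hx; rewrite mul0r addr0 leNgt; apply/negP => h.
  by apply: Kn; exists x; split=> //=; exact: ltW.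
have [c] := compact_EVT_min K0 cK (continuous_subspaceT cG).
rewrite inE => -[cS ce] hc.
have Gc : 0 < G c.
  rewrite lt_neqAle G0 andbT eq_sym; apply/eqP => /(gauge_separates cS) h.
  by move: ce; rewrite /= h subrr normr0 leNgt e0.
exists (2 * M / G c); split; first by rewrite divr_ge0 // mulr_ge0.
move=> x hx; case: (leP e `|f x.1 - f x.2|) => h; last first.
  by apply: le_trans (ltW h) _; rewrite lerDl mulr_ge0 ?divr_ge0 ?mulr_ge0 // (G0 x).
apply: (@le_trans _ _ (2 * M)).
  case: hx => h1 h2; have := hM _ h1; have := hM _ h2; have := ler_normB (f x.1) (f x.2); lra.
apply: (@le_trans _ _ (2 * M / G c * G x)); last by rewrite lerDr ltW.
rewrite -mulrA ler_peMr ?mulr_ge0 // mulrC ler_pdivlMr // mul1r.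
by apply: hc; rewrite inE; split.
Qed.

Lemma gauge_modulus (e : R) : 0 < e -> exists A : R, 0 <= A /\
  forall p q, square q -> `|f p - f q| <= e + A * (gauge (p.1 - q.1) + gauge (p.2 - q.2)).
Proof.
move=> e0; have [A [A0 hA]] := gauge_modulus_square e0; exists A; split=> // -[u v] q hq /=.
have fr (w : R) : 0 <= w - (Num.floor w)%:~R <= 1.
  by rewrite subr_ge0 floor_le_tmp lerBlDr addrC; have := floorD1_gt w; rewrite intrD => /ltW.
have fu a b : f (a, b) = f (a - (Num.floor a)%:~R, b).
  have := periodic_int (fun w => fper1 w b) (- Num.floor a) a.
  by rewrite mulrNz => <-.
have fv a b : f (a, b) = f (a, b - (Num.floor b)%:~R).
  have := periodic_int (fun w => fper2 a w) (- Num.floor b) b.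
  by rewrite mulrNz => <-.
have gi (w s : R) : gauge (w - s) = gauge (w - (Num.floor w)%:~R - s).
  rewrite -(gauge_int _ (- Num.floor w)); congr gauge; rewrite rmorphN /=; ring.
rewrite fu fv (gi u) (gi v).
apply: (hA ((u - (Num.floor u)%:~R, v - (Num.floor v)%:~R), q)).
by split=> //; split; rewrite /= in_itv /= fr.
Qed.
End GaugeModulus.

(** * Mean values along the sequence *)

Section Mean.
Variables (R : realType) (T : Type) (S : R -> seq T).
Hypothesis S_gt0 : \forall x \near +oo, (0 < size (S x))%N.

Definition has_mean (g : T -> R) (l : R) :=
  (fun x : R => (size (S x))%:R^-1 * \sum_(t <- S x) g t) @ +oo --> l.

Lemma has_mean_eq g h l : has_mean g l -> g =1 h -> has_mean h l.
Proof. by move=> + gh; have -> : h = g by apply/funext => t. Qed.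

Lemma has_mean_cst c : has_mean (fun=> c) c.
Proof.
rewrite /has_mean; apply: cvg_near_cst; near=> x.
have s0 : (0 < size (S x))%N by near: x.
by rewrite big_const_seq count_predT iter_addr_0 -[c *+ _]mulr_natl mulrA mulVf ?mul1r // pnatr_eq0 -lt0n.
Unshelve. all: by end_near.
Qed.

Lemma has_meanD g h a b : has_mean g a -> has_mean h b -> has_mean (fun t => g t + h t) (a + b).
Proof.
move=> hg hh; rewrite /has_mean.
have -> : (fun x : R => (size (S x))%:R^-1 * \sum_(t <- S x) (g t + h t)) =
  (fun x : R => (size (S x))%:R^-1 * \sum_(t <- S x) g t + (size (S x))%:R^-1 * \sum_(t <- S x) h t).
  by apply/funext => x; rewrite big_split mulrDr.
exact: cvgD.
Qed.

Lemma has_meanZ c g a : has_mean g a -> has_mean (fun t => c * g t) (c * a).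
Proof.
move=> hg; rewrite /has_mean.
have -> : (fun x : R => (size (S x))%:R^-1 * \sum_(t <- S x) c * g t) =
  (fun x : R => c * ((size (S x))%:R^-1 * \sum_(t <- S x) g t)).
  by apply/funext => x; rewrite -mulr_sumr; ring.
by apply: cvgM; [exact: cvg_cst | exact: hg].
Qed.

Lemma has_mean_sum (I : Type) (r : seq I) (G : I -> T -> R) (l : I -> R) :
  (forall i, has_mean (G i) (l i)) -> has_mean (fun t => \sum_(i <- r) G i t) (\sum_(i <- r) l i).
Proof.
move=> hG; elim: r => [|i r IH].
  by rewrite big_nil; apply: (has_mean_eq (@has_mean_cst 0)) => t; rewrite big_nil.
by rewrite big_cons; apply: (has_mean_eq (has_meanD (hG i) IH)) => t; rewrite big_cons.
Qed.

Variables U V : T -> R.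
Hypothesis weyl : forall (m n : int) s, (m != 0) || (n != 0) ->
  has_mean (fun t => cos (U t *~ m + V t *~ n - s)) 0.

Lemma has_mean_cos_cos (a b : R) (m n : int) :
  has_mean (fun t => cos ((U t - a) *~ m) * cos ((V t - b) *~ n)) ((m == 0) && (n == 0))%:R.
Proof.
have [/andP[/eqP -> /eqP ->]|h] := boolP ((m == 0) && (n == 0)).
  by apply: (has_mean_eq (@has_mean_cst 1)) => t; rewrite !mulr0z cos0 mulr1.
have h1 : (m != 0) || (n != 0) by rewrite -negb_and.
have h2 : (m != 0) || (- n != 0) by rewrite oppr_eq0.
have -> : false%:R = 2^-1 * (0 + 0) :> R by rewrite addr0 mulr0.
apply: (has_mean_eq (@has_meanZ 2^-1 _ _ (has_meanD (@weyl _ _ (a *~ m + b *~ n) h1) (@weyl _ _ (a *~ m - b *~ n) h2)))) => t.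
have -> : U t *~ m + V t *~ n - (a *~ m + b *~ n) = (U t - a) *~ m + (V t - b) *~ n.
  by rewrite !mulrzBl; ring.
have -> : U t *~ m + V t *~ - n - (a *~ m - b *~ n) = (U t - a) *~ m - (V t - b) *~ n.
  by rewrite !mulrzBl mulrNz; ring.
by rewrite cosD cosB; field.
Qed.

(** The product expands into q^4 products of cosines; the q^2 with i = j and k = l have mean 1, all
    others mean 0, and the factor is q^(-2). *)
Lemma has_mean_fejer q (a b : R) : (0 < q)%N ->
  has_mean (fun t => fejer q (U t - a) * fejer q (V t - b)) 1.
Proof.
move=> q0; have qn0 : q%:R != 0 :> R by rewrite pnatr_eq0 -lt0n.
have -> : 1 = q%:R ^- 2 * \sum_(i < q) \sum_(j < q) \sum_(k < q) \sum_(l < q)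
    ((i%:Z - j%:Z == 0) && (k%:Z - l%:Z == 0))%:R :> R.
  have diag (i : 'I_q) (c : bool) : \sum_(j < q) ((i%:Z - j%:Z == 0) && c)%:R = c%:R :> R.
    rewrite (bigD1 i) //= subrr eqxx /= big1 ?addr0 // => j ji; case: eqP => // /eqP.
    by rewrite subr_eq0 eqz_nat => /eqP/val_inj e; rewrite e eqxx in ji.
  under [X in _ * X]eq_bigr => i _.
    under eq_bigr => j _.
      under eq_bigr => k _.
        under eq_bigr => l _ do rewrite andbC.
        rewrite diag; over.
      over.
    rewrite exchange_big /=.
    under eq_bigr => k _.
      under eq_bigr => j _ do rewrite -[_ == 0]andbT.
      rewrite diag; over.
    rewrite sum_ord_const; over.
  by rewrite sum_ord_const mul1r -expr2 mulVf // expf_neq0.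
have H : has_mean (fun t => q%:R ^- 2 * \sum_(i < q) \sum_(j < q) \sum_(k < q) \sum_(l < q)
      cos ((U t - a) *~ (i%:Z - j%:Z)) * cos ((V t - b) *~ (k%:Z - l%:Z)))
    (q%:R ^- 2 * \sum_(i < q) \sum_(j < q) \sum_(k < q) \sum_(l < q)
      ((i%:Z - j%:Z == 0) && (k%:Z - l%:Z == 0))%:R).
  by apply: has_meanZ; do 4!apply: has_mean_sum => ?; exact: has_mean_cos_cos.
apply: (has_mean_eq H) => t.
rewrite !fejerE -[q%:R ^- 2]exprVn expr2 mulrACA; congr (_ * _).
rewrite mulr_suml; apply: eq_bigr => i _; rewrite mulr_suml; apply: eq_bigr => j _.
rewrite mulr_sumr; apply: eq_bigr => k _; rewrite mulr_sumr; apply: eq_bigr => l _.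
by [].
Qed.
End Mean.

(** * Integrals of step functions and Riemann sums *)

Section SimpleIntegral.
Context d (T : measurableType d) (R : realType) (mu : {measure set T -> \bar R}).
Variables (D : set T) (I : Type) (c : I -> R) (A : I -> set T).
Hypotheses (mD : measurable D) (Dfin : (mu D < +oo)%E) (mA : forall i, measurable (A i)).

Lemma bounded_indic (a : R) (B : set T) : [bounded a * \1_B x | x in D].
Proof.
exists `|a|; split; first exact: num_real.
move=> y hy x _ /=; apply: le_trans (ltW hy).
by rewrite indicE normrM; case: (x \in B); rewrite ?normr1 ?mulr1 // normr0 mulr0.
Qed.

Lemma integrable_indic_cst (a : R) (B : set T) : measurable B ->
  mu.-integrable D (EFin \o (fun x => a * \1_B x)).
Proof.
move=> mB; apply: measurable_bounded_integrable => //; last exact: bounded_indic.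
by apply: measurable_realfun.measurable_funM; [exact: measurable_cst | exact: measurable_realfun.measurable_indic].
Qed.

Lemma Rintegral_indic_cst (a : R) (B : set T) : measurable B ->
  \int[mu]_(x in D) (a * \1_B x) = a * fine (mu (B `&` D)).
Proof.
move=> mB; rewrite RintegralZl //; last first.
  have := integrable_indic_cst 1 mB; congr (mu.-integrable D (EFin \o _)).
  by apply/funext => x; rewrite mul1r.
by congr (_ * _); rewrite /Rintegral integral_indic.
Qed.

Lemma integrable_simple (r : seq I) :
  mu.-integrable D (EFin \o (fun x => \sum_(i <- r) c i * \1_(A i) x)).
Proof.
elim: r => [|i r IH].
  rewrite (_ : EFin \o _ = EFin \o (fun x => 0 * \1_D x)); first exact: integrable_indic_cst.
  by apply/funext => x /=; rewrite big_nil mul0r.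
rewrite (_ : EFin \o _ = (EFin \o (fun x => c i * \1_(A i) x))%R \+ (EFin \o (fun x => \sum_(i <- r) c i * \1_(A i) x))%R)%E.
  by apply: integrableD => //; exact: integrable_indic_cst.
by apply/funext => x /=; rewrite big_cons EFinD.
Qed.

Lemma Rintegral_simple (r : seq I) :
  \int[mu]_(x in D) (\sum_(i <- r) c i * \1_(A i) x) = \sum_(i <- r) c i * fine (mu (A i `&` D)).
Proof.
elim: r => [|i r IH].
  rewrite big_nil; under eq_Rintegral do rewrite big_nil.
  by rewrite Rintegral_cst // mul0r.
rewrite big_cons -IH; under eq_Rintegral do rewrite big_cons.
rewrite RintegralD //; last exact: integrable_simple.
  by rewrite Rintegral_indic_cst.
exact: integrable_indic_cst.
Qed.
End SimpleIntegral.

Section Riemann.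
Variable R : realType.
Let RT := g_sigma_algebraType (R.-ocitv.-measurable).
Let square : set (RT * RT) := `[0, 1]%classic `*` `[0, 1]%classic.

(* The cell with index q is the single point 1, of measure 0. *)
Definition cell q k : set R :=
  if (k < q)%N then `[k%:R / q%:R, k.+1%:R / q%:R[%classic else `[1, 1]%classic.
Definition cell_length q k : R := if (k < q)%N then q%:R^-1 else 0.

Lemma measurable_cell q k : measurable (cell q k : set RT).
Proof. by rewrite /cell; case: ifP => _; exact: measurable_itv. Qed.

Lemma measurable_cells q p : measurable (cell q p.1 `*` cell q p.2 : set (RT * RT)).
Proof. by apply: measurableX; exact: measurable_cell. Qed.

Lemma lebesgue_cell q k : lebesgue_measure (cell q k) = (cell_length q k)%:E.
Proof.
rewrite /cell /cell_length; case: ifP => kq; rewrite lebesgue_measure_itv /= lte_fin ?ltxx //.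
have q0 : 0 < q%:R :> R by rewrite ltr0n; case: q kq.
rewrite ltr_pM2r ?invr_gt0 // ltr_nat ltnSn -EFinB; congr EFin.
by rewrite -natr1; field; rewrite gt_eqF.
Qed.

Lemma cell_sub q k : (k <= q)%N -> cell q k `<=` `[0, 1]%classic.
Proof.
rewrite /cell; case: ifP => kq _ x /=; rewrite !in_itv /=; last by move/andP => [h1 h2]; rewrite h2 (le_trans _ h1).
have q0 : 0 < q%:R :> R by rewrite ltr0n; case: q kq.
move=> /andP[h1 h2]; rewrite (le_trans _ h1) ?divr_ge0 //= (le_trans (ltW h2)) //.
by rewrite ler_pdivrMr // mul1r ler_nat.
Qed.

Lemma cell_truncn q k (u : R) : (0 < q)%N -> 0 <= u <= 1 ->
  (k <= q)%N -> (u \in cell q k) = (k == Num.truncn (u * q%:R)).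
Proof.
move=> q0 /andP[u0 u1] kq; have qp : 0 < q%:R :> R by rewrite ltr0n.
have uq0 : 0 <= u * q%:R by rewrite mulr_ge0.
rewrite /cell eq_sym; case: ifP => h; apply/idP/eqP.
- rewrite inE /= in_itv /= ler_pdivrMr // ltr_pdivlMr // => h1.
  by apply/eqP; rewrite truncn_eq.
- move=> /eqP; rewrite truncn_eq // => h1; rewrite inE /= in_itv /= ler_pdivrMr // ltr_pdivlMr //.
- rewrite inE /= in_itv /= => /andP[h1 h2]; have -> : u = 1 by lra.
  by rewrite mul1r natrK; lia.
move=> e; have ek : k = q by lia.
rewrite inE /= in_itv /= u1 -(ler_pM2r qp) mul1r; have : (Num.truncn (u * q%:R))%:R <= u * q%:R by rewrite truncn_le.
by rewrite e ek => ->.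
Qed.

(** Samples f at the lower left corner of the cell; the indices run up to q so that the cells cover
    the closed square. *)
Definition stepf q (f : RT * RT -> R) (x : RT * RT) : R :=
  \sum_(p <- [seq (k, l) | k <- iota 0 q.+1, l <- iota 0 q.+1])
     f (p.1%:R / q%:R, p.2%:R / q%:R) * \1_(cell q p.1 `*` cell q p.2) x.

Lemma stepfE q f x : (0 < q)%N -> square x ->
  stepf q f x = f ((Num.truncn (x.1 * q%:R))%:R / q%:R, (Num.truncn (x.2 * q%:R))%:R / q%:R).
Proof.
case: x => u v q0 [/=]; rewrite !in_itv /= => hu hv.
have tr (w : R) : 0 <= w <= 1 -> Num.truncn (w * q%:R) \in iota 0 q.+1.
  move=> /andP[w0 w1]; rewrite mem_iota ltnS /= -[X in (_ <= X)%N](@natrK R q) le_truncn //.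
  by rewrite -[X in _ <= X]mul1r ler_wpM2r.
have Iq k : k \in iota 0 q.+1 -> (k <= q)%N by rewrite mem_iota ltnS.
rewrite /stepf; move: tr Iq (iota_uniq 0 q.+1); move: (iota 0 q.+1) => I tr Iq uI.
rewrite (bigD1_seq (Num.truncn (u * q%:R), Num.truncn (v * q%:R))) /=; first last.
- by apply: allpairs_uniq => // -[? ?] [? ?] _ _ [-> ->].
- by apply/allpairsP; exists (Num.truncn (u * q%:R), Num.truncn (v * q%:R)); rewrite /= !tr.
have ind k l : k \in I -> l \in I -> \1_(cell q k `*` cell q l) (u, v) =
    ((k == Num.truncn (u * q%:R)) && (l == Num.truncn (v * q%:R)))%:R :> R.
  by move=> /Iq kq /Iq lq; rewrite indicE in_setX /= !cell_truncn.
rewrite ind ?tr // !eqxx mulr1 big_seq_cond big1 ?addr0 // => -[k l] /andP[] /allpairsP[] [k' l'] /=.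
move=> -[hk hl [-> ->]] kl; rewrite ind //.
by move: kl; rewrite xpair_eqE => /negbTE ->; rewrite mulr0.
Qed.

Notation mu2 := ((@lebesgue_measure R) \x (@lebesgue_measure R))%E.

Lemma measurable_square : measurable square.
Proof. by apply: measurableX; exact: measurable_itv. Qed.

Lemma mu2_square : mu2 square = 1%:E.
Proof.
have e : lebesgue_measure (`[0, 1]%classic : set RT) = 1%:E.
  by rewrite lebesgue_measure_itv /= lte_fin ltr01 oppr0 adde0.
have m1 : measurable (`[0, 1]%classic : set RT) by exact: measurable_itv.
apply: etrans (product_measure1E _ _ m1 m1) _.
exact: etrans (congr2 _ e e) (mule1 _).
Qed.

Lemma integrable_stepf q f : mu2.-integrable square (EFin \o stepf q f).
Proof.
have fin2 : (mu2 square < +oo)%E by rewrite mu2_square ltry.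
exact: (integrable_simple (fun p : nat * nat => f (p.1%:R / q%:R, p.2%:R / q%:R)) measurable_square fin2 (measurable_cells q)).
Qed.

Lemma Rintegral_stepf q f : (0 < q)%N ->
  Rintegral mu2 square (stepf q f) =
  q%:R ^- 2 * \sum_(i < q) \sum_(j < q) f (grid R i, grid R j).
Proof.
move=> q0.
have fin2 : (mu2 square < +oo)%E by rewrite mu2_square ltry.
rewrite (Rintegral_simple (fun p : nat * nat => f (p.1%:R / q%:R, p.2%:R / q%:R)) measurable_square fin2 (measurable_cells q)).
rewrite big_allpairs_dep.
have mk k l : (k <= q)%N -> (l <= q)%N -> fine (mu2 ((cell q k `*` cell q l) `&` square)) = cell_length q k * cell_length q l.
  move=> kq lq; rewrite (_ : _ `&` _ = cell q k `*` cell q l).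
    have -> : mu2 (cell q k `*` cell q l) = (cell_length q k * cell_length q l)%:E; last by [].
    apply: etrans (product_measure1E _ _ (measurable_cell q k) (measurable_cell q l)) _.
    exact: congr2 _ (lebesgue_cell q k) (lebesgue_cell q l).
  by apply/setIidPl => -[u v] [/= h1 h2]; split; [exact: (cell_sub kq) | exact: (cell_sub lq)].
have inner (F : nat -> R) : \sum_(l <- iota 0 q.+1) F l * cell_length q l = q%:R^-1 * \sum_(j < q) F j.
  rewrite -{1}[q.+1]subn0 -/(index_iota 0 q.+1) big_mkord big_ord_recr /= {2}/cell_length ltnn mulr0 addr0.
  by rewrite mulr_sumr; apply: eq_bigr => j _; rewrite /cell_length ltn_ord mulrC.
transitivity (\sum_(k <- iota 0 q.+1) (\sum_(l <- iota 0 q.+1) f (k%:R / q%:R, l%:R / q%:R) * cell_length q l) * cell_length q k).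
  rewrite big_seq [RHS]big_seq; apply: eq_bigr => k; rewrite mem_iota ltnS => kq.
  rewrite mulr_suml big_seq [RHS]big_seq; apply: eq_bigr => l; rewrite mem_iota ltnS /= => lq.
  by rewrite mk // mulrA mulrAC.
rewrite inner; under eq_bigr do rewrite inner.
by rewrite -mulr_sumr mulrA -invfM -expr2.
Qed.

Lemma riemann_sum (f : RT * RT -> R) (e : R) q : (0 < q)%N ->
  measurable_fun square f -> (forall x, square x -> `|stepf q f x - f x| <= e) ->
  [bounded f x | x in square] ->
  `|q%:R ^- 2 * \sum_(i < q) \sum_(j < q) f (grid R i, grid R j) - Rintegral mu2 square f| <= e.
Proof.
move=> q0 mf he bf; rewrite -Rintegral_stepf //.
have fin2 : (mu2 square < +oo)%E by rewrite mu2_square ltry.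
have if_ : mu2.-integrable square (EFin \o f).
  by apply: measurable_bounded_integrable => //; exact: measurable_square.
have is_ : mu2.-integrable square (EFin \o stepf q f).
  exact: integrable_stepf.
rewrite -RintegralB //; last exact: measurable_square.
have id_ : mu2.-integrable square (EFin \o (fun x => stepf q f x - f x)).
  rewrite (_ : EFin \o _ = (EFin \o stepf q f) \- (EFin \o f))%E; last by apply/funext => x /=; rewrite EFinB.
  by apply: integrableB => //; exact: measurable_square.
apply: le_trans (le_normr_Rintegral measurable_square id_) _.
have -> : e = Rintegral mu2 square (fun=> e).
  apply/esym; apply: etrans (Rintegral_cst _ measurable_square e) _.
  exact: etrans (congr1 (fun z => e * fine z) mu2_square) (mulr1 _).
apply: le_Rintegral => //; first exact: measurable_square.
  rewrite (_ : EFin \o _ = (fun x => `|(EFin \o (fun x => (stepf q f x - f x)%R)) x|)%E) //; exact: integrable_abse.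
apply: measurable_bounded_integrable; [exact: measurable_square | exact: fin2 | exact: measurable_cst |].
by exists `|e|; split; [exact: num_real | move=> y hy x _ /=; exact: ltW].
Qed.
End Riemann.

(** * From decay of Weyl sums to equidistribution *)

Section Equidistribution.
Variables (R : realType) (T : Type) (S : R -> seq T).
Hypothesis S_gt0 : \forall x \near +oo, (0 < size (S x))%N.
Variables U V : T -> R.
Hypothesis weyl : forall (m n : int) s, (m != 0) || (n != 0) ->
  has_mean S (fun t => cos (2 * pi * U t *~ m + 2 * pi * V t *~ n - s)) 0.
Variable f : R * R -> R.
Hypothesis fcont : continuous f.
Hypothesis fper1 : forall u v : R, f (u + 1, v) = f (u, v).
Hypothesis fper2 : forall u v : R, f (u, v + 1) = f (u, v).

Let RT := g_sigma_algebraType (R.-ocitv.-measurable).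
Let square : set (RT * RT) := `[0, 1]%classic `*` `[0, 1]%classic.

Lemma near_nat_div (a e : R) : 0 <= a -> 0 < e -> exists Q : nat, forall q, (Q < q)%N -> a / q%:R <= e.
Proof.
move=> a0 e0; exists (Num.truncn (a / e)) => q hq.
have q0 : 0 < q%:R :> R by rewrite ltr0n (leq_ltn_trans _ hq).
rewrite ler_pdivrMr // mulrC -ler_pdivrMr //; apply: le_trans (ltW (truncnS_gt _)) _.
by rewrite ler_nat.
Qed.

Lemma gauge_small (e : R) : 0 < e -> exists Q : nat, forall q, (Q < q)%N ->
  forall t : R, `|t| <= q%:R^-1 -> gauge t <= e.
Proof.
move=> e0; have /cvgrPdist_le /(_ _ e0) := @continuous_gauge R 0.
rewrite nearE /= => /nbhs_ballP[d /= d0 hd].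
have [Q hQ] := near_nat_div ler01 (divr_gt0 d0 (ltr0n _ 2)).
exists Q => q /hQ; rewrite div1r => hq t ht.
have := hd t; rewrite /ball /= sub0r normrN => /(_ _).
have -> : gauge (0 : R) = 0 by rewrite /gauge mulr0 cos0 subrr.
rewrite sub0r normrN (ger0_norm (gauge_ge0 t)); apply.
by apply: le_lt_trans ht _; apply: le_lt_trans hq _; rewrite ltr_pdivrMr // ltr_pMr // ltr1n.
Qed.

Lemma grid_square q (i j : 'I_q) : square (grid R i, grid R j).
Proof.
have h (k : 'I_q) : 0 <= grid R k <= 1.
  have q0 : 0 < q%:R :> R by rewrite ltr0n; case: (q) k => // -[].
  by rewrite /grid divr_ge0 //= ler_pdivrMr // mul1r ler_nat ltnW.
by split; rewrite /= in_itv /= h.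
Qed.

Lemma stepf_approx (e : R) : 0 < e -> exists Q : nat, forall q, (Q < q)%N ->
  forall x, square x -> `|stepf q f x - f x| <= e.
Proof.
move=> e0; have e2 : 0 < e / 2 by rewrite divr_gt0.
have [A [A0 hA]] := gauge_modulus fcont fper1 fper2 e2.
(* Two gauge terms of this size, multiplied by A, stay below e / 2; the +1 allows A = 0. *)
have e3 : 0 < e / (4 * (A + 1)) by rewrite divr_gt0 // mulr_gt0 // ltr_wpDl.
have [Q hQ] := gauge_small e3; exists Q => q hq x hx.
have q0 : (0 < q)%N by exact: leq_ltn_trans hq.
have qp : 0 < q%:R :> R by rewrite ltr0n.
rewrite stepfE //; apply: le_trans (hA _ _ hx) _.
have tr (w : R) : 0 <= w <= 1 -> gauge ((Num.truncn (w * q%:R))%:R / q%:R - w) <= e / (4 * (A + 1)).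
  move=> /andP[w0 w1]; apply: hQ hq _ _.
  have wq0 : 0 <= w * q%:R by rewrite mulr_ge0.
  have h1 : (Num.truncn (w * q%:R))%:R <= w * q%:R by rewrite truncn_le.
  have h2 : w * q%:R < (Num.truncn (w * q%:R)).+1%:R by exact: truncnS_gt.
  have -> : (Num.truncn (w * q%:R))%:R / q%:R - w = ((Num.truncn (w * q%:R))%:R - w * q%:R) / q%:R.
    by field; rewrite gt_eqF.
  rewrite normrM normfV (ger0_norm (ltW qp)) ler_piMl ?invr_ge0 ?(ltW qp) //.
  by rewrite ler_norml; rewrite -natr1 in h2; lra.
case: x hx => u v [/=]; rewrite !in_itv /= => hu hv.
apply: (@le_trans _ _ (e / 2 + A * (e / (4 * (A + 1)) + e / (4 * (A + 1))))).
  by rewrite lerD2l ler_wpM2l // lerD // tr.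
have -> : A * (e / (4 * (A + 1)) + e / (4 * (A + 1))) = e / 2 * (A / (A + 1)).
  by field; rewrite gt_eqF // ltr_wpDl.
have : e / 2 * (A / (A + 1)) <= e / 2.
  by rewrite ler_piMr ?(ltW e2) // ler_pdivrMr ?mul1r ?lerDl // ltr_wpDl.
lra.
Qed.

(** On the square f is the pointwise limit of the measurable functions [stepf], which gives
    measurability for the product sigma-algebra carried by the product measure. *)
Lemma measurable_square_fun : measurable_fun square f.
Proof.
apply: (@measurable_realfun.measurable_fun_cvg _ _ _ _ (fun q => stepf q f)) => [q|x hx].
  apply/measurable_realfun.measurable_EFinP/measurable_int/(integrable_stepf q f).
apply/cvgrPdist_le => e e0; have [Q hQ] := stepf_approx e0.
by exists Q.+1 => // q /= hq; rewrite distrC; exact: hQ hq x hx.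
Qed.

Lemma riemann_sum_cvg (e : R) : 0 < e -> exists Q : nat, forall q, (Q < q)%N ->
  `|q%:R ^- 2 * \sum_(i < q) \sum_(j < q) f (grid R i, grid R j) - Rintegral (@leb2 R) square f| <= e.
Proof.
move=> e0; have [Q hQ] := stepf_approx e0; exists Q => q hq.
have q0 : (0 < q)%N by exact: leq_ltn_trans hq.
apply: (riemann_sum q0 measurable_square_fun (hQ q hq)).
have [M [M0 hM]] := square_sup fcont.
exists M; split; first exact: num_real.
by move=> y hy x hx; apply: le_trans (ltW hy); exact: hM.
Qed.

Definition fejer_approx q (u v : R) : R := \sum_i \sum_j f (grid R i, grid R j) * @fweight R q u v i j.

(** Since the weights sum to 1, the difference is a weighted mean of f (u, v) - f (grid point), at
    most e / 2 + 4 A / q uniformly in (u, v). *)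
Lemma fejer_approx_le (e : R) : 0 < e -> exists Q : nat, forall q, (Q < q)%N ->
  forall u v, `|f (u, v) - fejer_approx q u v| <= e.
Proof.
move=> e0; have e2 : 0 < e / 2 by rewrite divr_gt0.
have [A [A0 hA]] := gauge_modulus fcont fper1 fper2 e2.
have A4 : 0 <= A * 4 by rewrite mulr_ge0.
have [Q hQ] := near_nat_div A4 e2; exists Q => q hq u v.
have q0 : (0 < q)%N by exact: leq_ltn_trans hq.
have -> : f (u, v) - fejer_approx q u v =
    \sum_(i < q) \sum_(j < q) (f (u, v) - f (grid R i, grid R j)) * fweight u v i j.
  rewrite -[X in X - _]mulr1 -(sum_fweight u v q0) mulr_sumr -sumrB; apply: eq_bigr => i _.
  by rewrite mulr_sumr -sumrB; apply: eq_bigr => j _; rewrite mulrBl.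
apply: (@le_trans _ _ (\sum_(i < q) \sum_(j < q)
   (e / 2 + A * (gauge (u - grid R i) + gauge (v - grid R j))) * fweight u v i j)).
  apply: le_trans (ler_norm_sum _ _ _) _; apply: ler_sum => i _.
  apply: le_trans (ler_norm_sum _ _ _) _; apply: ler_sum => j _.
  rewrite normrM (ger0_norm (fweight_ge0 _ _ _ _)) ler_wpM2r ?fweight_ge0 //.
  exact: hA (grid_square i j).
have -> : \sum_(i < q) \sum_(j < q) (e / 2 + A * (gauge (u - grid R i) + gauge (v - grid R j))) * fweight u v i j
   = e / 2 * (\sum_(i < q) \sum_(j < q) fweight u v i j)
    + A * \sum_(i < q) \sum_(j < q) fweight u v i j * (gauge (u - grid R i) + gauge (v - grid R j)).
  rewrite !mulr_sumr -big_split; apply: eq_bigr => i _ /=.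
  by rewrite !mulr_sumr -big_split; apply: eq_bigr => j _ /=; ring.
rewrite sum_fweight // mulr1; have := ler_wpM2l A0 (sum_fweight_gauge u v q0).
by rewrite mulrA; have := hQ q hq; lra.
Qed.

Lemma has_mean_fejer_approx q : (0 < q)%N ->
  has_mean S (fun t => fejer_approx q (U t) (V t)) (q%:R ^- 2 * \sum_(i < q) \sum_(j < q) f (grid R i, grid R j)).
Proof.
move=> q0; rewrite mulr_sumr; under eq_bigr do rewrite mulr_sumr.
have H (i j : 'I_q) : has_mean S (fun t => f (grid R i, grid R j) * fweight (U t) (V t) i j)
    (q%:R ^- 2 * f (grid R i, grid R j)).
  have h := @has_mean_fejer _ _ _ S_gt0 _ _ weyl q (2 * pi * grid R i) (2 * pi * grid R j) q0.
  rewrite -[q%:R ^- 2 * _]mulr1; apply: (has_mean_eq (has_meanZ h)) => t.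
  by rewrite /fweight; ring.
apply: (has_mean_sum S_gt0) => i; apply: (has_mean_sum S_gt0) => j; exact: H.
Qed.

Theorem equidistribution : has_mean S (fun t => f (U t, V t)) (Rintegral (@leb2 R) square f).
Proof.
apply/cvgrPdist_le => e e0; have e3 : 0 < e / 3 by rewrite divr_gt0.
have [Q1 h1] := riemann_sum_cvg e3; have [Q2 h2] := fejer_approx_le e3.
pose q := (maxn Q1 Q2).+1.
have q1 : (Q1 < q)%N by rewrite ltnS leq_maxl. have q2 : (Q2 < q)%N by rewrite ltnS leq_maxr.
have /cvgrPdist_le /(_ _ e3) h3 := has_mean_fejer_approx (ltn0Sn (maxn Q1 Q2)).
near=> x.
have s0 : (0 < size (S x))%N by near: x.
have sp : 0 < (size (S x))%:R :> R by rewrite ltr0n.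
have h5 : `|q%:R ^- 2 * \sum_(i < q) \sum_(j < q) f (grid R i, grid R j) -
    (size (S x))%:R^-1 * \sum_(t <- S x) fejer_approx q (U t) (V t)| <= e / 3 by near: x; exact: h3.
have h4 : `|(size (S x))%:R^-1 * \sum_(t <- S x) f (U t, V t) -
    (size (S x))%:R^-1 * \sum_(t <- S x) fejer_approx q (U t) (V t)| <= e / 3.
  rewrite -mulrBr -sumrB normrM ger0_norm ?invr_ge0 // mulrC ler_pdivrMr //.
  apply: le_trans (ler_norm_sum _ _ _) _.
  apply: (@le_trans _ _ (\sum_(t <- S x) e / 3)); first by apply: ler_sum => t _; exact: h2.
  by rewrite big_const_seq count_predT iter_addr_0 -[X in X <= _]mulr_natr.
have tri (a b c d : R) : `|a - d| <= e / 3 -> `|a - c| <= e / 3 -> `|b - c| <= e / 3 -> `|d - b| <= e.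
  by rewrite !ler_norml; lra.
exact: tri (h1 q q1) h5 h4.
Unshelve. all: by end_near.
Qed.
End Equidistribution.

Theorem theorem1p3 (R : realType)
  (theta1 theta2 : quad -> R)
  (htheta : forall g : quad, inSL2Z g -> cartan (toRmx R g) (theta1 g) (theta2 g))
  (c1 c2 : R) (hc1 : 0 < c1) (hc12 : c1 <= c2)
  (hasym : \forall x \near +oo,
      c1 * (x / ln x) <= piEcount x /\ piEcount x <= c2 * (x / ln x))
  (f : R * R -> R) (fcont : continuous f)
  (fper1 : forall u v : R, f (u + 1, v) = f (u, v))
  (fper2 : forall u v : R, f (u, v + 1) = f (u, v)) :
  (fun x : R => (piEcount x)^-1 *
      \sum_(g <- primeSL x) f (theta1 g / pi, theta2 g / pi))
    @ +oo --> Rintegral (@leb2 R) (`[0, 1] `*` `[0, 1]) f.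
Proof.
have S_gt0 : \forall x \near +oo, (0 < size (@primeSL R x))%N.
  near=> x.
  have [h _] : c1 * (x / ln x) <= piEcount x /\ piEcount x <= c2 * (x / ln x) by near: x.
  have x1 : 1 < x by near: x; apply: nbhs_pinfty_gt; exact: num_real.
  rewrite -(ltr0n R); apply: lt_le_trans h.
  by rewrite mulr_gt0 // divr_gt0 ?ln_gt0 // (lt_trans ltr01).
apply: (equidistribution S_gt0 _ fcont fper1 fper2) => m n s mn.
(* Frequency k in theta / pi is the even frequency 2 k in theta, hence insensitive to theta modulo
   pi. *)
have e (t : R) (k : int) : 2 * pi * (t / pi) *~ k = t *~ (2 * k).
  have pi0 : (pi : R) != 0 by rewrite gt_eqF // pi_gt0.
  have -> : 2 * pi * (t / pi) = t + t by rewrite -mulrA (mulrC pi) divfK // mulr_natl mulr2n.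
  have -> : 2 * k = k + k :> int by ring.
  by rewrite mulrzDl mulrzDr.
apply: (has_mean_eq (weyl_average htheta hc1 hasym s mn)) => g /=.
by rewrite !e.
Unshelve. all: by end_near.
Qed.
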